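(* Let $k$ be an algebraically closed field of characteristic $0$. Let $A\cong A_{\mathrm r}\times A_{\mathrm u}$ be a commutative affine algebraic group over $k$, where $A_{\mathrm r}$ is its reductive (diagonalizable) part and $A_{\mathrm u}\cong\mathbb G_a^m$ its unipotent radical. Let $\mathfrak a,\mathfrak a_{\mathrm r},\mathfrak a_{\mathrm u}$ be the Lie algebras of $A,A_{\mathrm r},A_{\mathrm u}$. Then the following hold: (1) There are group isomorphisms $$H^2_{\mathrm{inv}}(A_{\mathrm r})\cong H^2(\widehat{A_{\mathrm r}},k^\times)\cong\mathrm{Hom}(\wedge^2\widehat{A_{\mathrm r}},k^\times).$$ Furthermore, minimal Hopf $2$-cocycles for $A_{\mathrm r}$ correspond under this isomorphism to non-degenerate alternating bicharacters on $\widehat{A_{\mathrm r}}$. (2) There is a vector space isomorphism $$\wedge^2\mathfrak a_{\mathrm u}\xrightarrow{\ \cong\ }H^2_{\mathrm{inv}}(A_{\mathrm u}),\qquad r\mapsto[\exp(r/2)].$$ Furthermore, minimal Hopf $2$-cocycles for $A_{\mathrm u}$ correspond under this isomorphism to non-degenerate elements of $\wedge^2\mathfrak a_{\mathrm u}$. In particular, $\mathcal O(A_{\mathrm u})$ has a minimal Hopf $2$-cocycle if and only if $m$ is even. (3) There are group isomorphisms $$H^2_{\mathrm{inv}}(A)\cong H^2(\widehat{A_{\mathrm r}},k^\times)\times(\mathfrak a\wedge\mathfrak a_{\mathrm u})\cong\mathrm{Hom}(\wedge^2\widehat{A_{\mathrm r}},k^\times)\times(\mathfrak a_{\mathrm r}\otimes\mathfrak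 a_{\mathrm u}\oplus\wedge^2\mathfrak a_{\mathrm u}).$$
   Context: For a Hopf algebra $H$ over $k$ (Sweedler notation), $H^*$ and $(H\otimes H)^*$ are algebras under convolution $*$. A Hopf $2$-cocycle for $H$ is an invertible $J\in(H\otimes H)^*$ with $\sum J(a_1b_1,c)J(a_2,b_2)=\sum J(a,b_1c_1)J(b_2,c_2)$ and $J(a,1)=\varepsilon(a)=J(1,a)$. It is invariant if $\sum J(a_1,b_1)a_2b_2=\sum a_1b_1J(a_2,b_2)$ for all $a,b$ (automatic if $H$ is cocommutative). Invariant Hopf $2$-cocycles form a group $Z^2_{\mathrm{inv}}(H)$ under convolution, with central subgroup $B^2_{\mathrm{inv}}(H)$ of elements $\partial(x)(a,b)=\sum x(a_1b_1)x^{-1}(a_2)x^{-1}(b_2)$, $x$ an invertible central element of $H^*$; $H^2_{\mathrm{inv}}(H):=Z^2_{\mathrm{inv}}(H)/B^2_{\mathrm{inv}}(H)$ and $[J]$ is the class of $J$. For an affine algebraic group $G$, $H^2_{\mathrm{inv}}(G):=H^2_{\mathrm{inv}}(\mathcal O(G))$, and a Hopf $2$-cocycle for $G$ is one for $\mathcal O(G)$. $H^J$ is $H$ with the new product $m^J=J^{-1}*m*J$. A cotriangular Hopf algebra $(H,R)$ is a Hopf algebra with invertible $R\in(H\otimes H)^*$ such that $\sum R(h_1,g_1)R(g_2,h_2)=\varepsilon(g)\varepsilon(h)$, $R(h,gl)=\sum R(h_1,g)R(h_2,l)$, $R(hg,l)=\sum R(g,l_1)R(h,l_2)$, $\sum R(h_1,g_1)g_2h_2=\sum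 h_1g_1R(h_2,g_2)$; it is minimal if $R$ is non-degenerate as a bilinear form. A Hopf $2$-cocycle $J$ for $G$ is minimal if $(\mathcal O(G)^J,J_{21}^{-1}*J)$ is minimal cotriangular, where $J_{21}(a,b)=J(b,a)$. $\widehat{A_{\mathrm r}}=\mathrm{Hom}(A_{\mathrm r},k^\times)$ is the character group, so $\mathcal O(A_{\mathrm r})\cong k[\widehat{A_{\mathrm r}}]$. $\mathrm{Hom}(\wedge^2\widehat{A_{\mathrm r}},k^\times)$ is the group of alternating bicharacters on $\widehat{A_{\mathrm r}}$, and the isomorphism $H^2(\widehat{A_{\mathrm r}},k^\times)\cong\mathrm{Hom}(\wedge^2\widehat{A_{\mathrm r}},k^\times)$ is $J\mapsto J_{21}^{-1}J$. Here $\mathfrak a\subset\mathcal O(A)^*$ is viewed as the space of point derivations at $1$, elements of $\wedge^2\mathfrak a$ are viewed as antisymmetric tensors ($x\wedge y=x\otimes y-y\otimes x$) in $(\mathcal O(A)\otimes\mathcal O(A))^*$, and $\exp$ is taken in this convolution algebra. $\mathfrak a\wedge\mathfrak a_{\mathrm u}\subseteq\wedge^2\mathfrak a$ is the span of $x\wedge y$ with $x\in\mathfrak a$, $y\in\mathfrak a_{\mathrm u}$, so $\mathfrak a\wedge\mathfrak a_{\mathrm u}=\mathfrak a_{\mathrm r}\otimes\mathfrak a_{\mathrm u}\oplus\wedge^2\mathfrak a_{\mathrm u}$; vector spaces are regarded as additive groups. *)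

(* Defs.v *)
From HB Require Import structures.
From mathcomp Require Import all_boot all_order all_algebra.
From mathcomp Require Import boolp classical_sets functions.
From mathcomp Require mpoly.

Set Implicit Arguments.
Unset Strict Implicit.
Unset Printing Implicit Defensive.

Import GRing.Theory.
Local Open Scope classical_set_scope.
Local Open Scope ring_scope.

(* The group Z/B, where Z (qg_num) is a set of elements closed under the
   operation qg_mul and B (qg_den) is a subgroup of Z. *)
Record quot_group := QuotGroup {
  qg_sort :> Type;
  qg_mul : qg_sort -> qg_sort -> qg_sort;
  qg_one : qg_sort;
  qg_num : set qg_sort;
  qg_den : set qg_sort }.

Definition qg_eqv (Q : quot_group) (x y : Q) : Prop :=
  exists2 n, qg_den n & x = qg_mul y n.

(* Z is a group and B is a normal subgroup of Z. *)
Record is_quot_group (Q : quot_group) : Prop := IsQuotGroup {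
  qg_num1 : qg_num (qg_one Q);
  qg_numM : forall x y : Q, qg_num x -> qg_num y -> qg_num (qg_mul x y);
  qg_mulA : forall x y z : Q, qg_num x -> qg_num y -> qg_num z ->
    qg_mul x (qg_mul y z) = qg_mul (qg_mul x y) z;
  qg_mul1x : forall x : Q, qg_num x -> qg_mul (qg_one Q) x = x;
  qg_mulx1 : forall x : Q, qg_num x -> qg_mul x (qg_one Q) = x;
  qg_inv : forall x : Q, qg_num x -> exists y : Q,
    [/\ qg_num y, qg_mul x y = qg_one Q, qg_mul y x = qg_one Q
      & qg_den x -> qg_den y];
  qg_den_num : qg_den (q := Q) `<=` qg_num (q := Q);
  qg_den1 : qg_den (qg_one Q);
  qg_denM : forall x y : Q, qg_den x -> qg_den y -> qg_den (qg_mul x y);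
  qg_norm : forall x n : Q, qg_num x -> qg_den n ->
    exists2 n', qg_den n' & qg_mul n x = qg_mul x n' }.

(* f, given on representatives, induces a group isomorphism
   Z/B -> Z'/B'. *)
Record group_iso (Q Q' : quot_group) (f : Q -> Q') : Prop := GroupIso {
  giso_dom : is_quot_group Q;
  giso_cod : is_quot_group Q';
  giso_num : forall x, qg_num x -> qg_num (f x);
  giso_mul : forall x y, qg_num x -> qg_num y ->
    qg_eqv (f (qg_mul x y)) (qg_mul (f x) (f y));
  giso_ker : forall x, qg_num x -> (qg_den (f x) <-> qg_den x);
  giso_surj : forall y, qg_num y -> exists2 x, qg_num x & qg_eqv y (f x) }.

Definition quot_prod (Q Q' : quot_group) : quot_group :=
  @QuotGroup (Q * Q')
    (fun x y => (qg_mul x.1 y.1, qg_mul x.2 y.2)) (qg_one Q, qg_one Q')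
    [set x | qg_num x.1 /\ qg_num x.2] [set x | qg_den x.1 /\ qg_den x.2].

Definition additive_group (V : zmodType) (S : set V) : quot_group :=
  @QuotGroup V +%R 0 S [set 0].

(* The operation scal makes the (commutative) group Z/B a k-vector space. *)
Record is_vector_space (k : fieldType) (Q : quot_group) (scal : k -> Q -> Q)
    : Prop := IsVectorSpace {
  vs_group : is_quot_group Q;
  vs_addC : forall x y : Q, qg_num x -> qg_num y ->
    qg_eqv (qg_mul x y) (qg_mul y x);
  vs_num : forall t x, qg_num x -> qg_num (scal t x);
  vs_eqv : forall t x y, qg_num x -> qg_num y ->
    qg_eqv x y -> qg_eqv (scal t x) (scal t y);
  vs_addr : forall t x y, qg_num x -> qg_num y ->
    qg_eqv (scal t (qg_mul x y)) (qg_mul (scal t x) (scal t y));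
  vs_addl : forall s t x, qg_num x ->
    qg_eqv (scal (s + t) x) (qg_mul (scal s x) (scal t x));
  vs_scalA : forall s t x, qg_num x ->
    qg_eqv (scal (s * t) x) (scal s (scal t x));
  vs_scal1 : forall x, qg_num x -> qg_eqv (scal 1 x) x }.

(* The comultiplication returns a representative of an element of H (x) H:
   the list s stands for \sum_(p <- s) p.1 (x) p.2, so that Sweedler sums are
   sums over (hcop a).  Over a field two lists stand for the same tensor iff
   all bilinear forms agree on them; the axioms below that live in H (x) H or
   H (x) H (x) H are tested on multilinear forms. *)
Record hopf_data (k : fieldType) := HopfData {
  hsort :> lmodType k;
  hmul : hsort -> hsort -> hsort;
  hone : hsort;
  hcop : hsort -> seq (hsort * hsort);
  heps : hsort -> k }.

Section Hopf.
Variables (k : fieldType) (H : hopf_data k).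
Implicit Types (a b c : H) (x y : H -> k) (J K R : H -> H -> k).

(* Elements of (H (x) H)^*. *)
Definition biform J : Prop := bilinear_for *%R *%R J.

Definition triform (T : H -> H -> H -> k) : Prop :=
  [/\ forall b c, scalar (fun a => T a b c),
      forall a c, scalar (fun b => T a b c)
    & forall a b, scalar (fun c => T a b c)].

Record is_hopf : Prop := IsHopf {
  hmul_bilin : bilinear_for *:%R *:%R (@hmul k H);
  hmulA : forall a b c, hmul a (hmul b c) = hmul (hmul a b) c;
  hmul1x : forall a, hmul (hone H) a = a;
  hmulx1 : forall a, hmul a (hone H) = a;
  hcop_lin : forall J, biform J ->
    scalar (fun a => \sum_(p <- hcop a) J p.1 p.2);
  heps_lin : scalar (@heps k H);
  hcopA : forall T, triform T -> forall a,
    \sum_(p <- hcop a) \sum_(q <- hcop p.1) T q.1 q.2 p.2 =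
    \sum_(p <- hcop a) \sum_(q <- hcop p.2) T p.1 q.1 q.2;
  hcounitl : forall a, \sum_(p <- hcop a) heps p.1 *: p.2 = a;
  hcounitr : forall a, \sum_(p <- hcop a) heps p.2 *: p.1 = a;
  hcopM : forall J, biform J -> forall a b,
    \sum_(p <- hcop (hmul a b)) J p.1 p.2 =
    \sum_(p <- hcop a) \sum_(q <- hcop b) J (hmul p.1 q.1) (hmul p.2 q.2);
  hcop1 : forall J, biform J ->
    \sum_(p <- hcop (hone H)) J p.1 p.2 = J (hone H) (hone H);
  hepsM : forall a b, heps (hmul a b) = heps a * heps b;
  heps1 : heps (hone H) = 1;
  hantipode : exists S : H -> H, [/\ linear S,
    forall a, \sum_(p <- hcop a) hmul (S p.1) p.2 = heps a *: hone H
  & forall a, \sum_(p <- hcop a) hmul p.1 (S p.2) = heps a *: hone H] }.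

(* The convolution algebra H^*. *)
Definition conv1 x y : H -> k := fun a => \sum_(p <- hcop a) x p.1 * y p.2.

Definition is_inv1 x y : Prop :=
  [/\ scalar y, conv1 x y = @heps k H & conv1 y x = @heps k H].

Definition inv1 x : H -> k := xget 0 [set y | is_inv1 x y].

Definition central1 x : Prop := forall y, scalar y -> conv1 x y = conv1 y x.

(* The convolution algebra (H (x) H)^*. *)
Definition conv J K : H -> H -> k := fun a b =>
  \sum_(p <- hcop a) \sum_(q <- hcop b) J p.1 q.1 * K p.2 q.2.

Definition conv_one : H -> H -> k := fun a b => heps a * heps b.

Definition is_inv2 J K : Prop :=
  [/\ biform K, conv J K = conv_one & conv K J = conv_one].

Definition inv2 J : H -> H -> k := xget 0 [set K | is_inv2 J K].

Definition flip2 J : H -> H -> k := fun a b => J b a.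

Fixpoint conv_pow J (n : nat) : H -> H -> k :=
  if n is n'.+1 then conv J (conv_pow J n') else conv_one.

(* The actions of (H (x) H)^* on linear maps H (x) H -> H by convolution. *)
Definition convl J (F : H -> H -> H) : H -> H -> H := fun a b =>
  \sum_(p <- hcop a) \sum_(q <- hcop b) J p.1 q.1 *: F p.2 q.2.

Definition convr (F : H -> H -> H) J : H -> H -> H := fun a b =>
  \sum_(p <- hcop a) \sum_(q <- hcop b) J p.2 q.2 *: F p.1 q.1.

Record hopf_2cocycle J : Prop := Hopf2Cocycle {
  h2_biform : biform J;
  h2_inv : exists K, is_inv2 J K;
  h2_cocycle : forall a b c,
    \sum_(p <- hcop a) \sum_(q <- hcop b) J (hmul p.1 q.1) c * J p.2 q.2 =
    \sum_(q <- hcop b) \sum_(r <- hcop c) J a (hmul q.1 r.1) * J q.2 r.2;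
  h2_normr : forall a, J a (hone H) = heps a;
  h2_norml : forall a, J (hone H) a = heps a }.

Definition invariant J : Prop := convl J (@hmul k H) = convr (@hmul k H) J.

Definition Z2inv : set (H -> H -> k) :=
  [set J | hopf_2cocycle J /\ invariant J].

Definition cobound x : H -> H -> k := fun a b =>
  \sum_(p <- hcop a) \sum_(q <- hcop b)
    x (hmul p.1 q.1) * inv1 x p.2 * inv1 x q.2.

(* The intersection with Z2inv only imposes the normalization x(1) = 1. *)
Definition B2inv : set (H -> H -> k) :=
  Z2inv `&` [set J | exists x,
    [/\ scalar x, exists y, is_inv1 x y, central1 x & J = cobound x]].

Definition H2inv : quot_group := QuotGroup conv conv_one Z2inv B2inv.

Record cotriangular R : Prop := Cotriangular {
  ct_hopf : is_hopf;
  ct_biform : biform R;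
  ct_inv : exists K, is_inv2 R K;
  ct_skew : forall h g,
    \sum_(p <- hcop h) \sum_(q <- hcop g) R p.1 q.1 * R q.2 p.2 =
    heps g * heps h;
  ct_mulr : forall h g l,
    R h (hmul g l) = \sum_(p <- hcop h) R p.1 g * R p.2 l;
  ct_mull : forall h g l,
    R (hmul h g) l = \sum_(p <- hcop l) R g p.1 * R h p.2;
  ct_comm : forall h g,
    \sum_(p <- hcop h) \sum_(q <- hcop g) R p.1 q.1 *: hmul q.2 p.2 =
    \sum_(p <- hcop h) \sum_(q <- hcop g) R p.2 q.2 *: hmul p.1 q.1 }.

Definition nondegenerate_form R : Prop :=
  (forall a, (forall b, R a b = 0) -> a = 0) /\
  (forall b, (forall a, R a b = 0) -> b = 0).

Definition minimal_cotriangular R : Prop :=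
  cotriangular R /\ nondegenerate_form R.

(* The Hopf algebra H^J. *)
Definition twist J : hopf_data k :=
  @HopfData k H (convr (convl (inv2 J) (@hmul k H)) J) (hone H)
    (@hcop k H) (@heps k H).

End Hopf.

Arguments conv_one {k} H.
Arguments hopf_2cocycle {k} H J.
Arguments cotriangular {k} H R.
Arguments minimal_cotriangular {k} H R.
Arguments twist {k} H J.

Definition minimal_2cocycle (k : fieldType) (H : hopf_data k)
    (J : H -> H -> k) : Prop :=
  minimal_cotriangular (twist H J) (conv (inv2 (flip2 J)) J).

Arguments minimal_2cocycle {k} H J.

(* The sum of a series with finitely many nonzero terms (0 if there are
   infinitely many): convergence in the convolution algebra is pointwise,
   for the discrete topology of k. *)
Definition fin_series (k : fieldType) (u : nat -> k) : k :=
  xget 0 [set v | exists N, forall M, (N <= M)%N -> \sum_(n < M) u n = v].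

Section ExpLog.
Variables (k : fieldType) (H : hopf_data k).
Implicit Types (J r : H -> H -> k).

Definition conv_exp r : H -> H -> k := fun a b =>
  fin_series (fun n => (n`!%:R)^-1 * conv_pow r n a b).

Definition conv_log J : H -> H -> k := fun a b =>
  fin_series (fun n =>
    (-1) ^+ n / n.+1%:R * conv_pow (J - conv_one H) n.+1 a b).

(* The power J^t, for t in k. *)
Definition conv_powr (t : k) J : H -> H -> k := conv_exp (fun a b => t * conv_log J a b).

End ExpLog.

Arguments conv_exp {k} H r.
Arguments conv_powr {k} H t J.

Section RegularFunctions.
Variables (k : fieldType).

Definition subalgebra (X : Type) (S : set (X -> k)) : Prop :=
  [/\ S (fun=> 1), forall c f g, S f -> S g -> S (c \*o f \+ g)
    & forall f g, S f -> S g -> S (f \* g)].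

(* The image of S (x) T in the functions on X * Y. *)
Definition tensor_functions (X Y : Type) (S : set (X -> k)) (T : set (Y -> k))
    : set (X * Y -> k) :=
  [set F | exists s : seq ((X -> k) * (Y -> k)),
    (forall p, p \in s -> S p.1 /\ T p.2) /\
    forall x y, F (x, y) = \sum_(p <- s) p.1 x * p.2 y].

End RegularFunctions.

(* A group X whose underlying set is an affine variety, given by its algebra
   reg of regular functions: reg is a finitely generated algebra of functions,
   the points of X are exactly the characters of the algebra reg (X is the
   maximal spectrum of reg), and the group operations are regular. *)
Record is_affine_group (k : fieldType) (X : groupType) (reg : set (X -> k))
    : Prop := IsAffineGroup {
  ag_subalg : subalgebra reg;
  ag_fingen : exists s : seq (X -> k),
    [set` s] `<=` reg /\
    forall S, subalgebra S -> [set` s] `<=` S -> reg `<=` S;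
  ag_points : forall phi : (X -> k) -> k,
    phi (fun=> 1) = 1 ->
    (forall c f g, reg f -> reg g ->
       phi (c \*o f \+ g) = c * phi f + phi g) ->
    (forall f g, reg f -> reg g -> phi (f \* g) = phi f * phi g) ->
    exists! x : X, forall f, reg f -> phi f = f x;
  ag_mul : forall f, reg f ->
    tensor_functions reg reg (fun z => f (z.1 * z.2)%g);
  ag_inv : forall f, reg f -> reg (fun x => f (x^-1)%g) }.

Record affine_group (k : fieldType) := AffineGroup {
  ag_pt :> groupType;
  ag_reg : set (ag_pt -> k);
  ag_axioms : is_affine_group ag_reg }.

Section CoordinateAlgebra.
Variables (k : fieldType) (G : affine_group k).

Definition reg_pred : {pred G -> k^o} := mem (ag_reg (a := G)).

Lemma reg_submod_closed : submod_closed reg_pred.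
Proof.
have [r1 rD _] := ag_subalg (ag_axioms G).
have r0 : ag_reg (0 : G -> k^o).
  have := rD (-1) _ _ r1 r1; congr (ag_reg _).
  by apply/funext => x; rewrite -[LHS]/(-1 * 1 + 1) mulr1 addNr.
split; first by rewrite /reg_pred inE.
by move=> c f g; rewrite /reg_pred !inE; apply: rD.
Qed.

HB.instance Definition _ :=
  GRing.isSubmodClosed.Build k (G -> k^o) reg_pred reg_submod_closed.

(* The algebra O(G). *)
Record regfun := RegFun { reg_val :> G -> k^o; reg_valP : reg_val \in reg_pred }.

HB.instance Definition _ := [isSub of regfun for reg_val].
HB.instance Definition _ := [Choice of regfun by <:].
HB.instance Definition _ := [SubChoice_isSubLmodule of regfun by <:].

Lemma reg_one_subproof : (fun=> 1) \in reg_pred.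
Proof. by rewrite inE; have [] := ag_subalg (ag_axioms G). Qed.

Lemma reg_mul_subproof (f g : regfun) : (f : G -> k) \* (g : G -> k) \in reg_pred.
Proof.
rewrite inE; have [_ _ rM] := ag_subalg (ag_axioms G).
by apply: rM; apply/set_mem; apply: reg_valP.
Qed.

(* The comultiplication is dual to the multiplication of G:
   f(xy) = \sum f_1(x) f_2(y). *)
Definition coord_alg : hopf_data k :=
  @HopfData k regfun
    (fun f g => RegFun (reg_mul_subproof f g))
    (RegFun reg_one_subproof)
    (fun f => xget [::] [set s : seq (regfun * regfun) |
       forall x y : G, f (x * y)%g = \sum_(p <- s) p.1 x * p.2 y])
    (fun f => f 1%g).

(* Such a chi takes nonzero values, as chi(x) chi(x^-1) = chi(1) = 1. *)
Definition is_character (chi : G -> k) : Prop :=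
  [/\ ag_reg chi, chi 1%g = 1
    & forall x y, chi (x * y)%g = chi x * chi y].

Definition character := {chi : G -> k | is_character chi}.

Lemma char_one_subproof : is_character (fun=> 1).
Proof.
split=> //; first by have [] := ag_subalg (ag_axioms G).
by move=> x y; rewrite mulr1.
Qed.

Lemma char_mul_subproof (chi omega : character) :
  is_character (sval chi \* sval omega).
Proof.
case: chi omega => [f [rf f1 fM]] [g [rg g1 gM]] /=.
have [_ _ rM] := ag_subalg (ag_axioms G).
split; first exact: rM.
- by rewrite /= f1 g1 mulr1.
- by move=> x y; rewrite /= fM gM mulrACA.
Qed.

Definition char_one : character := exist _ _ char_one_subproof.
Definition char_mul (chi omega : character) : character :=
  exist _ _ (char_mul_subproof chi omega).

Lemma char_reg_subproof (chi : character) : sval chi \in reg_pred.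
Proof. by rewrite inE; case: (svalP chi). Qed.

Definition char_reg (chi : character) : coord_alg :=
  RegFun (char_reg_subproof chi).

Definition diagonalizable_group : Prop :=
  forall f : G -> k, ag_reg f -> exists s : seq (k * character),
    forall x, f x = \sum_(p <- s) p.1 * sval p.2 x.

(* G is isomorphic to G_a^m. *)
Definition vector_group (m : nat) : Prop :=
  exists theta : 'rV[k]_m -> G,
    [/\ bijective theta, forall u v, theta (u + v) = (theta u * theta v)%g
      & forall f : G -> k, ag_reg f <->
          exists p : mpoly.mpoly m k,
            forall u, f (theta u) = mpoly.meval (fun i => u 0 i) p].

Definition lie : set (coord_alg -> k) :=
  [set x | scalar x /\
    forall f g : coord_alg, x (hmul f g) = x f * heps g + heps f * x g].

End CoordinateAlgebra.

Arguments reg_pred {k} G.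
Arguments lie {k} G.

Section Characters.
Variables (k : fieldType) (G : affine_group k).
Implicit Types (c b : character G -> character G -> k).

Definition pmul2 c c' : character G -> character G -> k :=
  fun chi omega => c chi omega * c' chi omega.

Definition grp_Z2 : set (character G -> character G -> k) :=
  [set c | (forall chi omega, c chi omega != 0) /\
    forall chi omega psi,
      c (char_mul chi omega) psi * c chi omega =
      c chi (char_mul omega psi) * c omega psi].

Definition grp_B2 : set (character G -> character G -> k) :=
  [set c | exists2 u : character G -> k, forall chi, u chi != 0 &
    c = fun chi omega => u chi * u omega / u (char_mul chi omega)].

(* H^2(\hat G, k^x), for the trivial action on k^x. *)
Definition grp_H2 : quot_group :=
  QuotGroup pmul2 (fun _ _ => 1) grp_Z2 grp_B2.

Definition alt_bichar : set (character G -> character G -> k) :=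
  [set b | [/\ forall chi omega, b chi omega != 0,
    forall chi chi' omega,
      b (char_mul chi chi') omega = b chi omega * b chi' omega,
    forall chi omega omega',
      b chi (char_mul omega omega') = b chi omega * b chi omega'
    & forall chi, b chi chi = 1]].

(* Hom(wedge^2 \hat G, k^x). *)
Definition hom_wedge2 : quot_group :=
  QuotGroup pmul2 (fun _ _ => 1) alt_bichar [set fun _ _ => 1].

Definition nondegenerate_bichar b : Prop :=
  forall chi, (forall omega, b chi omega = 1) -> chi = char_one G.

(* The map J |-> J_21^-1 J. *)
Definition alternate c : character G -> character G -> k :=
  fun chi omega => (c omega chi)^-1 * c chi omega.

(* The restriction to \hat G of a bilinear form on O(G). *)
Definition char_restrict (J : coord_alg G -> coord_alg G -> k)
    : character G -> character G -> k :=
  fun chi omega => J (char_reg chi) (char_reg omega).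

End Characters.

(* For subspaces V and W of the duals of U and U', the tensor x (x) y is the
   bilinear form (a, b) |-> x(a) y(b). *)
Section Tensors.
Variables (k : fieldType).

Definition sum_tensor (U U' : Type) (s : seq ((U -> k) * (U' -> k)))
    : U -> U' -> k := fun a b => \sum_(p <- s) p.1 a * p.2 b.

Definition in_pairs (U U' : Type) (V : set (U -> k)) (W : set (U' -> k))
    (s : seq ((U -> k) * (U' -> k))) : Prop :=
  forall p, p \in s -> V p.1 /\ W p.2.

Definition tensor (U U' : Type) (V : set (U -> k)) (W : set (U' -> k))
    : set (U -> U' -> k) :=
  [set r | exists2 s, in_pairs V W s & r = sum_tensor s].

(* The span of the x wedge y = x (x) y - y (x) x. *)
Definition wedge (U : Type) (V W : set (U -> k)) : set (U -> U -> k) :=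
  [set r | exists2 s, in_pairs V W s &
    r = fun a b => \sum_(p <- s) (p.1 a * p.2 b - p.2 a * p.1 b)].

(* An element r = \sum x (x) y of V (x) V is non-degenerate if the map
   V^* -> V, xi |-> \sum xi(x) y, is injective (hence bijective, for V of
   finite dimension). *)
Definition nondegenerate_tensor (U : Type) (V : set (U -> k))
    (r : U -> U -> k) : Prop :=
  forall xi : (U -> k) -> k,
    (forall c x y, V x -> V y -> xi (c \*o x \+ y) = c * xi x + xi y) ->
    forall s, in_pairs V V s -> r = sum_tensor s ->
    (forall a, \sum_(p <- s) xi p.1 * p.2 a = 0) ->
    forall x, V x -> xi x = 0.

End Tensors.

Record alg_hom (k : fieldType) (G G' : affine_group k) := AlgHom {
  ah_fun :> G -> G';
  ah_mul : forall x y, ah_fun (x * y)%g = (ah_fun x * ah_fun y)%g;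
  ah_reg : forall f, ag_reg f -> ag_reg (f \o ah_fun) }.

Section Homs.
Variables (k : fieldType) (G G' : affine_group k) (phi : alg_hom G G').

Lemma pullback_subproof (f : coord_alg G') :
  (f : regfun G') \o phi \in reg_pred G.
Proof. by rewrite inE; apply: ah_reg; apply/set_mem; apply: reg_valP. Qed.

Definition pullback (f : coord_alg G') : coord_alg G :=
  RegFun (pullback_subproof f).

(* The differential of phi. *)
Definition pushforward (x : coord_alg G -> k) : coord_alg G' -> k :=
  fun f => x (pullback f).

End Homs.

Section Products.
Variables (k : fieldType) (A Ar Au : affine_group k).
Variables (ir : alg_hom Ar A) (iu : alg_hom Au A).

(* (x, y) |-> ir x * iu y is an isomorphism of varieties Ar * Au -> A; it is
   an isomorphism of algebraic groups when A is commutative. *)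
Definition product_decomposition : Prop :=
  let theta (z : Ar * Au) := (ir z.1 * iu z.2)%g in
  bijective theta /\
  forall f : A -> k, ag_reg f <->
    tensor_functions (ag_reg (a := Ar)) (ag_reg (a := Au)) (f \o theta).

(* The map (t, w) |-> t + w from (a_r (x) a_u) (+) wedge^2 a_u to
   a wedge a_u, where t = x (x) y is sent to x wedge y. *)
Definition wedge_sum (t : coord_alg Ar -> coord_alg Au -> k)
    (w : coord_alg Au -> coord_alg Au -> k) : coord_alg A -> coord_alg A -> k :=
  fun f g =>
    t (pullback ir f) (pullback iu g) - t (pullback ir g) (pullback iu f)
    + w (pullback iu f) (pullback iu g).

End Products.

(* Main.v *)
(* Choose a basis of O(A) of monomials chi x_1^e_1 ... x_m^e_m, with chi a
   character and the x_i primitive.  A Hopf 2-cocycle J is then c * exp f, where c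
   is the restriction of J to the characters, extended by zero, and f is an
   additive 2-cocycle vanishing on the characters.  The antisymmetrization
   r = f - f_21 is a biderivation, that is an element of a /\ a_u.  The class of J
   is determined by those of c and r: if r = 0 then f is symmetric, so the forms
   a |-> f(a, x_i) are the partial derivatives of a single linear form g, and f is
   the coboundary of g.  Conversely c and r are arbitrary, J being c * exp(r/2).

   For characters, k^x is divisible, so symmetric 2-cocycles split and every
   alternating bicharacter is an alternation.  O(A) is commutative and
   cocommutative, so twisting does not change its product, and J_21^-1 * J is
   alternate(c) on a torus and exp r on a vector group; its kernel is visible on
   the characters, respectively on the coordinates x_i. *)

(* Evaluated on monomials, forms multiply under convolution by the shuffle product, separately for
   each character. Product, counits and flip act on such series by ring morphisms, so identities
   between Sweedler sums become identities in a commutative ring. A series without constant term has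
   a locally finite exponential; dividing J by c is what gives log J a meaning. The laws of exp and
   log follow from uniqueness for the differential equation of the derivation that multiplies by
   word length.

   The 1/2 in exp(r/2) comes from antisymmetry: r/2 minus its flip is r. The biderivation rule for f
   - f_21 is a signed sum of three instances of the additive cocycle identity.

   The obstacle on characters is torsion. Pulled back to Z^n, an alternating bicharacter is the
   alternation of its upper triangular part, but that part does not descend to the quotient. It is
   symmetric against the kernel, so divisibility of k^x trivializes it there, and the trivialization
   corrects it into a cocycle on the quotient. *)
From HB Require Import structures.
Require Import Defs.
From mathcomp Require Import all_boot all_order all_algebra.
From mathcomp Require Import boolp classical_sets functions.
From mathcomp Require Import ring zify.
Set Implicit Arguments.
Unset Strict Implicit.
Unset Printing Implicit Defensive.

Import GRing.Theory.
Local Open Scope classical_set_scope.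
Local Open Scope ring_scope.

(** * Shuffle series *)

(* A linear form on O(G) given by its values on the monomials chi_t x_i1 ... x_in,
   with chi_t a character and the x_i primitive: convolution of forms becomes
   the shuffle product of words, separately for each t. *)
Definition ser (k : fieldType) (X I : Type) := X -> seq I -> k.

Section Ser.
Variables (k : fieldType) (X I : Type).
Implicit Types (F G : ser k X I) (w : seq I).

(** Dual to a coproduct with primitive letters: the leading letter goes to one factor or to the
    other. The result sums [f u * g v] over all splittings of [w] into complementary subwords u and
    v. *)
Fixpoint shuf (f g : seq I -> k) w : k :=
  if w is i :: v then
    shuf (fun u => f (i :: u)) g v + shuf f (fun u => g (i :: u)) v
  else f [::] * g [::].

Definition ser_mul F G : ser k X I := fun t => shuf (F t) (G t).
Definition ser_one : ser k X I := fun _ w => (nilp w)%:R.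

HB.instance Definition _ := GRing.Zmodule.on (ser k X I).

Lemma shufC f g w : shuf f g w = shuf g f w.
Proof.
elim: w f g => [|i w IH] f g /=; first by rewrite mulrC.
by rewrite IH addrC IH.
Qed.

Lemma shufDl f1 f2 g w : shuf (fun u => f1 u + f2 u) g w = shuf f1 g w + shuf f2 g w.
Proof.
elim: w f1 f2 g => [|i w IH] f1 f2 g /=; first by rewrite mulrDl.
by rewrite !IH addrACA.
Qed.

Lemma shuf0l g w : shuf (fun=> 0) g w = 0.
Proof. by elim: w g => [|i w IH] g /=; rewrite ?mul0r // !IH addr0. Qed.

Lemma shuf1l g w : shuf (fun u => (nilp u)%:R) g w = g w.
Proof.
elim: w g => [|i w IH] g /=; first by rewrite mul1r.
by rewrite IH shuf0l add0r.
Qed.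

Lemma shufA f g h w : shuf f (shuf g h) w = shuf (shuf f g) h w.
Proof.
elim: w f g h => [|i w IH] f g h /=; first by rewrite mulrA.
rewrite -[fun u => shuf g h (i :: u)]/(fun u => shuf _ h u + shuf g _ u).
rewrite -[fun u => shuf f g (i :: u)]/(fun u => shuf _ g u + shuf f _ u).
rewrite shufDl [X in _ + X]shufC shufDl ![shuf _ f w]shufC !addrA.
by rewrite !IH.
Qed.

Fact ser_mulA : associative ser_mul.
Proof. by move=> F G K; apply/funext => t; apply/funext => w; apply: shufA. Qed.
Fact ser_mulC : commutative ser_mul.
Proof. by move=> F G; apply/funext => t; apply/funext => w; apply: shufC. Qed.
Fact ser_mul1 : left_id ser_one ser_mul.
Proof. by move=> F; apply/funext => t; apply/funext => w; apply: shuf1l. Qed.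
Fact ser_mulD : left_distributive ser_mul +%R.
Proof. by move=> F G K; apply/funext => t; apply/funext => w; apply: shufDl. Qed.

HB.instance Definition _ := GRing.Zmodule_isComPzRing.Build (ser k X I)
  ser_mulA ser_mulC ser_mul1 ser_mulD.

Lemma serP F G : (forall t w, F t w = G t w) -> F = G.
Proof. by move=> FG; apply/funext => t; apply/funext => w. Qed.

Lemma serM F G t w : (F * G) t w = shuf (F t) (G t) w. Proof. by []. Qed.
Lemma serD F G t w : (F + G) t w = F t w + G t w. Proof. by []. Qed.
Lemma serN F t w : (- F) t w = - F t w. Proof. by []. Qed.
Lemma serB F G t w : (F - G) t w = F t w - G t w. Proof. by []. Qed.
Lemma ser1 t w : (1 : ser k X I) t w = (nilp w)%:R. Proof. by []. Qed.

Lemma serM0 F G t : (F * G) t [::] = F t [::] * G t [::]. Proof. by []. Qed.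

Lemma ser_sum (T : Type) (s : seq T) (P : pred T) (F : T -> ser k X I) t w :
  (\sum_(j <- s | P j) F j) t w = \sum_(j <- s | P j) F j t w.
Proof. exact: (big_morph (fun G : ser k X I => G t w)). Qed.

Definition scale_ser (c : k) F : ser k X I := fun t w => c * F t w.

Lemma shufZ c f g w : shuf (fun u => c * f u) g w = c * shuf f g w.
Proof.
elim: w f g => [|i w IH] f g /=; first by rewrite mulrA.
by rewrite !IH mulrDr.
Qed.

Lemma scale_serAl c F G : scale_ser c F * G = scale_ser c (F * G).
Proof. by apply: serP => t w; apply: shufZ. Qed.

Lemma scale_serAr c F G : F * scale_ser c G = scale_ser c (F * G).
Proof. by rewrite mulrC scale_serAl mulrC. Qed.

Lemma scale_serA c d F : scale_ser c (scale_ser d F) = scale_ser (c * d) F.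
Proof. by apply: serP => t w; apply: mulrA. Qed.

Lemma scale_ser1 F : scale_ser 1 F = F.
Proof. by apply: serP => t w; apply: mul1r. Qed.

(* Euler's derivation reduces the exponential and logarithm identities to linear
   differential equations. *)
Definition eul F : ser k X I := fun t w => (size w)%:R * F t w.

Lemma eulD F G : eul (F + G) = eul F + eul G.
Proof. by apply: serP => t w; apply: mulrDr. Qed.
Lemma eulN F : eul (- F) = - eul F.
Proof. by apply: serP => t w; apply: mulrN. Qed.
Lemma eulB F G : eul (F - G) = eul F - eul G.
Proof. by rewrite eulD eulN. Qed.
Lemma eulZ c F : eul (scale_ser c F) = scale_ser c (eul F).
Proof. by apply: serP => t w; apply: mulrCA. Qed.

(** In each term of the shuffle product the lengths of the two subwords add up to the length of the
    word. *)
Lemma eulM F G : eul (F * G) = eul F * G + F * eul G.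
Proof.
apply: serP => t w; rewrite serD !serM /eul serM.
elim: w (F t) (G t) => [|i w IH] f g /=; first by rewrite !mul0r mulr0 addr0.
rewrite -natr1 mulrDl mul1r mulrDr !IH.
have E (h g' : seq I -> k) : shuf (fun u => (size u).+1%:R * h u) g' w =
   shuf (fun u => (size u)%:R * h u) g' w + shuf h g' w.
  rewrite -shufDl; congr (shuf _ _ w); apply/funext => u /=.
  by rewrite -natr1 mulrDl mul1r.
rewrite E [X in _ = _ + (_ + X)]shufC E [shuf _ f w]shufC [shuf (fun u => g _) f w]shufC.
ring.
Qed.

Lemma eul1 : eul 1 = 0.
Proof. by apply: serP => t [|i w]; rewrite /eul ser1 ?mul0r ?mulr0. Qed.

Lemma eulX F n : eul (F ^+ n.+1) = scale_ser n.+1%:R (F ^+ n * eul F).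
Proof.
elim: n => [|n IH]; first by rewrite expr1 expr0 mul1r scale_ser1.
rewrite exprS eulM IH scale_serAr mulrA -exprS [eul F * _]mulrC.
apply: serP => t w; rewrite serD /scale_ser.
by rewrite -[n.+2%:R]natr1 mulrDl mul1r addrC.
Qed.

(** The filtration by word length, which replaces a topology: orders add in products ([ordgeM]), and
    only 0 has every order ([ordge_eq0]). *)
Definition ordge F n := forall t w, (size w < n)%N -> F t w = 0.

Lemma ordge1 F : (forall t, F t [::] = 0) -> ordge F 1.
Proof. by move=> F0 t [|//]. Qed.

Lemma ordgeD F G n : ordge F n -> ordge G n -> ordge (F + G) n.
Proof. by move=> Fn Gn t w lt; rewrite serD Fn ?Gn ?addr0. Qed.

Lemma ordgeN F n : ordge F n -> ordge (- F) n.
Proof. by move=> Fn t w lt; rewrite serN Fn ?oppr0. Qed.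

Lemma ordge_le F m n : (m <= n)%N -> ordge F n -> ordge F m.
Proof. by move=> mn Fn t w lt; apply: Fn; apply: leq_trans mn. Qed.

Lemma ordgeM F G m n : ordge F m -> ordge G n -> ordge (F * G) (m + n).
Proof.
move=> Fm Gn t w; rewrite serM.
move: (Fm t) (Gn t); elim: w (F t) (G t) m n {Fm Gn} => [|i w IH] f g m n fm gn /=.
  case: m fm => [|m] fm; last by rewrite fm // mul0r.
  by case: n gn => [|n] gn // _; rewrite gn ?mulr0.
move=> lt; rewrite (IH _ _ m.-1 n) ?(IH _ _ m n.-1) ?addr0 //.
- by move=> u lu; apply: gn => /=; lia.
- by move: lt => /=; lia.
- by move=> u lu; apply: fm => /=; lia.
- by move: lt => /=; lia.
Qed.

Lemma ordgeMl F G n : ordge F n -> ordge (F * G) n.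
Proof. by move=> Fn; rewrite -[n]addn0; apply: ordgeM. Qed.

Lemma ordgeX F n : ordge F 1 -> ordge (F ^+ n) n.
Proof.
by move=> F1; elim: n => [|n IH] //; rewrite exprS -add1n; apply: ordgeM.
Qed.

Lemma ordge_eul F n : ordge F n -> ordge (eul F) n.
Proof. by move=> Fn t w lt; rewrite /eul Fn ?mulr0. Qed.

Lemma ordge_eul1 F : ordge (eul F) 1.
Proof. by apply: ordge1 => t; rewrite /eul mul0r. Qed.

Lemma ordgeZ c F n : ordge F n -> ordge (scale_ser c F) n.
Proof. by move=> Fn t w lt; rewrite /scale_ser Fn ?mulr0. Qed.

Lemma ordge_eq0 F : (forall n, ordge F n) -> F = 0.
Proof. by move=> Fn; apply: serP => t w; apply: (Fn (size w).+1). Qed.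

Hypothesis char0 : [pchar k] =i pred0.

Lemma natS_neq0 n : n.+1%:R != 0 :> k.
Proof. by rewrite (pcharf0P k).1. Qed.

(** The order of F can be raised without end: if F has order n, then [P * F] has order n + 1, and on
    a nonempty word the factor [size w] cancels in characteristic 0. *)
Lemma eul_uniq0 P F : ordge P 1 -> eul F = P * F -> (forall t, F t [::] = 0) ->
  F = 0.
Proof.
move=> P1 EF F0; apply: ordge_eq0; elim=> // n IH t [|i w] lt //.
have := ordgeM P1 IH; rewrite -EF add1n => /(_ t (i :: w) lt).
by move/eqP; rewrite /eul mulf_eq0 /= (negPf (natS_neq0 _)) => /eqP.
Qed.

Lemma eul_uniq P F G : ordge P 1 -> eul F = P * F -> eul G = P * G ->
  (forall t, F t [::] = G t [::]) -> F = G.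
Proof.
move=> P1 EF EG FG; apply/eqP; rewrite -subr_eq0; apply/eqP.
apply: (eul_uniq0 P1); first by rewrite eulB EF EG mulrBr.
by move=> t; rewrite serB FG subrr.
Qed.

Lemma eul_inj F G : eul F = eul G -> (forall t, F t [::] = G t [::]) -> F = G.
Proof.
move=> EFG FG; apply/eqP; rewrite -subr_eq0; apply/eqP.
apply: (@eul_uniq0 0); first by [].
  by rewrite eulB EFG subrr mul0r.
by move=> t; rewrite serB FG subrr.
Qed.

(* The n-th term has order at least n, so only finitely many terms contribute
   to a coefficient. *)
Definition ser_lim (u : nat -> ser k X I) : ser k X I :=
  fun t w => \sum_(n < (size w).+1) u n t w.

Lemma ser_limE u t w N : (forall n, ordge (u n) n) -> (size w < N)%N ->
  ser_lim u t w = \sum_(n < N) u n t w.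
Proof.
move=> un lt; rewrite /ser_lim -(subnKC lt).
rewrite -!(big_mkord xpredT (fun n => u n t w)).
rewrite [RHS](big_cat_nat (n := (size w).+1)) ?leq_addr //=.
rewrite [X in _ = _ + X]big_nat [X in _ = _ + X]big1 ?addr0 // => n /andP[le _].
exact: un.
Qed.

Lemma ser_lim_trunc u N : (forall n, ordge (u n) n) ->
  ordge (ser_lim u - \sum_(n < N) u n) N.
Proof.
by move=> un t w lt; rewrite serB ser_sum (ser_limE _ un lt) subrr.
Qed.

Definition ser_exp z := ser_lim (fun n => scale_ser (n`!%:R)^-1 (z ^+ n)).
Definition ser_log F :=
  ser_lim (fun n => scale_ser ((-1) ^+ n / n.+1%:R) ((F - 1) ^+ n.+1)).

Lemma ser_exp0 z t : ser_exp z t [::] = 1.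
Proof. by rewrite /ser_exp /ser_lim big_ord1 /scale_ser fact0 invr1 mul1r expr0 ser1. Qed.

(** Termwise differentiation lowers the index by one, so the truncation at [N.+1] on the left
    matches exactly the truncation at [N] on the right. The remainders have order N, for every N. *)
Lemma eul_exp z : ordge z 1 -> eul (ser_exp z) = eul z * ser_exp z.
Proof.
move=> z1; apply/eqP; rewrite -subr_eq0; apply/eqP; apply: ordge_eq0 => N.
pose u n := scale_ser (n`!%:R)^-1 (z ^+ n).
have un n : ordge (u n) n by apply/ordgeZ/ordgeX.
have EN : eul (\sum_(n < N.+1) u n) = eul z * \sum_(n < N) u n.
  rewrite (big_morph eul eulD (_ : eul 0 = 0)); last first.
    by apply: serP => t w; apply: mulr0.
  rewrite big_ord_recl /= {1}/u expr0 eulZ eul1.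
  have -> : scale_ser (0`!%:R)^-1 0 = 0 by apply: serP => t w; apply: mulr0.
  rewrite add0r mulr_sumr; apply: eq_bigr => n _.
  rewrite /u /bump leq0n add1n eulZ eulX scale_serA scale_serAr [eul z * _]mulrC; congr scale_ser.
  rewrite factS natrM invfM mulrAC mulVf ?mul1r //.
  exact: natS_neq0.
rewrite -[ser_exp z](subrK (\sum_(n < N.+1) u n)) eulD EN.
set a := ser_exp z - _.
rewrite [X in _ - eul z * X](_ : _ = (ser_exp z - \sum_(n < N) u n) + \sum_(n < N) u n); last first.
  by rewrite /a !subrK.
rewrite mulrDr opprD addrACA subrr addr0; apply: ordgeD.
  apply/ordge_eul/(ordge_le (leqnSn N)); exact: ser_lim_trunc.
by rewrite mulrC; apply/ordgeN/ordgeMl/ser_lim_trunc.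
Qed.

(** Both sides solve [eul F = eul (y + z) * F] with constant term 1. *)
Lemma ser_expD y z : ordge y 1 -> ordge z 1 ->
  ser_exp (y + z) = ser_exp y * ser_exp z.
Proof.
move=> y1 z1; apply: (@eul_uniq (eul (y + z))).
- exact: ordge_eul1.
- by apply: eul_exp; apply: ordgeD.
- rewrite eulM !eul_exp // eulD mulrDl !mulrA; congr (_ + _).
  by rewrite [ser_exp y * _]mulrC.
- by move=> t; rewrite serM0 !ser_exp0 mulr1.
Qed.

Lemma ser_exp_0 : ser_exp 0 = 1.
Proof.
apply: (@eul_uniq 0) => //; last by move=> t; rewrite ser_exp0.
  rewrite eul_exp //; congr (_ * _); apply: serP => t w; exact: mulr0.
by rewrite eul1 mul0r.
Qed.

Lemma ser_expV z : ordge z 1 -> ser_exp z * ser_exp (- z) = 1.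
Proof. by move=> z1; rewrite -ser_expD ?subrr ?ser_exp_0 //; apply: ordgeN. Qed.

Lemma ser_log0 F t : F t [::] = 1 -> ser_log F t [::] = 0.
Proof.
move=> F1; rewrite /ser_log /ser_lim big_ord1 /scale_ser expr1 serB F1 ser1.
by rewrite subrr mulr0.
Qed.

Lemma eul_log F : (forall t, F t [::] = 1) -> eul (ser_log F) * F = eul F.
Proof.
move=> F1; apply/eqP; rewrite -subr_eq0; apply/eqP; apply: ordge_eq0 => N.
pose y := F - 1; have y1 : ordge y 1.
  by apply: ordge1 => t; rewrite /y serB F1 ser1 subrr.
pose u n := scale_ser ((-1) ^+ n / n.+1%:R) (y ^+ n.+1).
have un n : ordge (u n) n.
  by apply/ordgeZ/(ordge_le (leqnSn n))/ordgeX.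
(* The derivative of the truncated logarithm is a geometric sum in -y times [eul F]; it telescopes
   against F = 1 - (-y). *)
have EN : eul (\sum_(n < N) u n) * F = (1 - (- y) ^+ N) * eul F.
  rewrite (big_morph eul eulD (_ : eul 0 = 0)); last first.
    by apply: serP => t w; apply: mulr0.
  rewrite (eq_bigr (fun n : 'I_N => (- y) ^+ n * eul F)); last first.
    move=> n _; rewrite /u eulZ eulX scale_serA divfK ?natS_neq0 //.
    rewrite -scale_serAl (_ : eul y = eul F); last by rewrite /y eulB eul1 subr0.
    congr (_ * _); rewrite [in RHS]exprNn; apply: serP => t w.
    rewrite -[(-1) ^+ n : k]signr_odd -[(-1) ^+ n : ser k X I]signr_odd /scale_ser.
    by case: (odd n); rewrite ?expr1 ?expr0 ?mulN1r ?mul1r.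
  rewrite -mulr_suml mulrAC; congr (_ * _).
  rewrite -[X in X - _](expr1n _ N) subrXX mulrC; congr (_ * _).
    by rewrite /y opprK subrKC.
  by apply: eq_bigr => n _; rewrite expr1n mul1r.
rewrite -[ser_log F](subrK (\sum_(n < N) u n)) eulD mulrDl EN.
rewrite mulrBl mul1r -addrA [X in _ + X]addrAC subrr add0r; apply: ordgeD.
  exact/ordgeMl/ordge_eul/ser_lim_trunc.
exact/ordgeN/ordgeMl/ordgeX/ordgeN.
Qed.

Lemma ordge_log F : (forall t, F t [::] = 1) -> ordge (ser_log F) 1.
Proof. by move=> F1; apply: ordge1 => t; apply: ser_log0. Qed.

Lemma ser_expK z : ordge z 1 -> ser_log (ser_exp z) = z.
Proof.
move=> z1; apply: eul_inj; last first.
  by move=> t; rewrite z1 // ser_log0 // ser_exp0.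
have := eul_log (@ser_exp0 z); rewrite eul_exp // => /(congr1 ( *%R^~ (ser_exp (- z)))).
by rewrite -!mulrA ser_expV // !mulr1.
Qed.

Lemma ser_logK F : (forall t, F t [::] = 1) -> ser_exp (ser_log F) = F.
Proof.
move=> F1; apply: (@eul_uniq (eul (ser_log F))).
- exact: ordge_eul1.
- exact/eul_exp/ordge_log.
- by rewrite eul_log.
- by move=> t; rewrite ser_exp0 F1.
Qed.

Lemma ser_logM F G : (forall t, F t [::] = 1) -> (forall t, G t [::] = 1) ->
  ser_log (F * G) = ser_log F + ser_log G.
Proof.
move=> F1 G1; have lF := ordge_log F1; have lG := ordge_log G1.
by rewrite -{1}(ser_logK F1) -{1}(ser_logK G1) -ser_expD // ser_expK //; apply: ordgeD.
Qed.

End Ser.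

(** * Renaming and killing letters: morphisms of shuffle series *)

Section Pull.
Variables (k : fieldType) (X Y I L : Type) (g : X -> Y) (h : I -> option L).
Implicit Types (F G : ser k Y L).

(** Dual to the map of words that renames letters by [h] and kills any word with a letter sent to
    [None], as the counit kills a primitive element. Written by shifting [f], like [shuf], so that
    [pullM] is a direct induction. *)
Fixpoint pullw (f : seq L -> k) (w : seq I) : k :=
  if w is i :: v then
    if h i is Some j then pullw (fun u => f (j :: u)) v else 0
  else f [::].

Definition pull F : ser k X I := fun t => pullw (F (g t)).

Lemma pull0 F t : pull F t [::] = F (g t) [::]. Proof. by []. Qed.

Lemma pullwD f f' w : pullw (fun u => f u + f' u) w = pullw f w + pullw f' w.
Proof.
elim: w f f' => //= i w IH f f'.
by case: (h i) => [j|]; rewrite ?addr0.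
Qed.

Lemma pullN F : pull (- F) = - pull F.
Proof.
apply: serP => t w; rewrite serN /pull.
change ((- F) (g t)) with (fun u => - F (g t) u).
elim: w (F _) => //= i w IH f.
by case: (h i) => [j|]; rewrite ?oppr0.
Qed.

Lemma pullw0 w : pullw (fun=> 0) w = 0.
Proof. by elim: w => //= i w ->; case: (h i). Qed.

Lemma pull_one : pull 1 = 1.
Proof.
by apply: serP => t [|i w] //=; rewrite /pull /=; case: (h i) => // j; apply: pullw0.
Qed.

Lemma pullM F G : pull (F * G) = pull F * pull G.
Proof.
apply: serP => t w; rewrite serM /pull.
change ((F * G) (g t)) with (shuf (F (g t)) (G (g t))).
elim: w (F _) (G _) => //= i w IH f f'.
case: (h i) => [j|]; last by rewrite shuf0l shufC shuf0l addr0.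
by rewrite pullwD !IH.
Qed.

Lemma pullZ c F : pull (scale_ser c F) = scale_ser c (pull F).
Proof.
apply: serP => t w; rewrite /pull /scale_ser.
elim: w (F _) => //= i w IH f.
by case: (h i) => [j|]; rewrite ?mulr0.
Qed.

Lemma pull_eul F : pull (eul F) = eul (pull F).
Proof.
apply: serP => t w; rewrite /pull /eul.
(* A shifted form no longer sees the letters already read; the offset, initially 0, counts them
   through the induction. *)
rewrite -[size w]addn0.
have <- : pullw (fun u => (0 + size u)%:R * F (g t) u) w = pullw (fun u => (size u)%:R * F (g t) u) w by [].
rewrite addnC; elim: w 0%N (F _) => //= i w IH n f.
case: (h i) => [j|]; last by rewrite mulr0.
by rewrite addnS -addSn -IH; congr pullw; apply/funext => u; rewrite addSnnS.
Qed.

Lemma ordge_pull1 F : ordge F 1 -> ordge (pull F) 1.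
Proof. by move=> F1; apply: ordge1 => t; rewrite pull0 F1. Qed.

Hypothesis char0 : [pchar k] =i pred0.

(** Since [pull] commutes with [eul], both sides solve [eul F = eul (pull z) * F] with constant term
    1. *)
Lemma pull_exp z : ordge z 1 -> pull (ser_exp z) = ser_exp (pull z).
Proof.
move=> z1; apply: (@eul_uniq _ _ _ char0 (eul (pull z))).
- exact: ordge_eul1.
- by rewrite -pull_eul eul_exp // pullM pull_eul.
- by rewrite eul_exp //; apply: ordge_pull1.
- by move=> t; rewrite pull0 !ser_exp0.
Qed.

Lemma pull_log F : (forall t, F t [::] = 1) -> pull (ser_log F) = ser_log (pull F).
Proof.
move=> F1; rewrite -{2}(ser_logK char0 F1) pull_exp ?ser_expK //.
- exact/ordge_pull1/ordge_log.
- exact/ordge_log.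
Qed.

End Pull.

(** * Symmetric series *)

Section SymSer.
Variables (k : fieldType) (X : Type) (I : eqType).
Implicit Types (F G : ser k X I) (w : seq I).

(** Variables commute, so the values of a linear form on monomials are symmetric in the word;
    [c_ext] below is the converse. *)
Definition symw (f : seq I -> k) := forall w w', perm_eq w w' -> f w = f w'.
Definition symser F := forall t, symw (F t).

(** Reduces invariance under all permutations to a swap of the two leading letters, see
    [symw_ind]. *)
Lemma perm_cons_swap (i j : I) v v' : perm_eq (i :: v) (j :: v') -> i != j ->
  exists u, perm_eq v (j :: u) /\ perm_eq v' (i :: u).
Proof.
move=> p ij; have jv : j \in v.
  by have := perm_mem p j; rewrite !inE eqxx eq_sym (negPf ij).
exists (rem j v); have vj := perm_to_rem jv; split=> //.
rewrite -(perm_cons j) -(permPl p) perm_sym.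
have := perm_cons i v (j :: rem j v); rewrite vj => /esym e.
rewrite perm_sym; apply: perm_trans (_ : perm_eq (i :: j :: rem j v) _); first exact/esym/e.
by rewrite (perm_catCA [:: i] [:: j]).
Qed.

Lemma symw_shift f i : symw f -> symw (fun u => f (i :: u)).
Proof. by move=> sf w w' p; apply: sf; rewrite perm_cons. Qed.

Lemma symw_ind f :
  (forall i, symw (fun u => f (i :: u))) ->
  (forall i j u, f (i :: j :: u) = f (j :: i :: u)) -> symw f.
Proof.
move=> fs fC [|i v] [|j v'] p //; try by have := perm_size p.
have [ij|ij] := eqVneq i j; first by rewrite -ij in p *; apply: fs; rewrite -(perm_cons i).
have [u [pv pv']] := perm_cons_swap p ij.
by rewrite (fs i _ _ pv) (fs j _ _ pv') fC.
Qed.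

Lemma symw_shuf f g : symw f -> symw g -> symw (shuf f g).
Proof.
move=> sf sg w; have [n] := ubnP (size w).
elim: n w f g sf sg => // n IH [|i v] f g sf sg lt [|j v'] p //;
  try by have := perm_size p.
have lv : (size v < n)%N by [].
have step l u : (size u < n)%N -> perm_eq u l -> shuf f g (i :: u) = shuf f g (i :: l).
  by move=> lu pu /=; rewrite !(IH u _ _ _ _ lu l pu) //; apply: symw_shift.
have lv' : (size v' < n)%N by have [<-] := perm_size p.
have [ij|ij] := eqVneq i j.
  by rewrite -ij in p *; apply: step; rewrite // -(perm_cons i).
have [u [pv pv']] := perm_cons_swap p ij.
rewrite (step (j :: u)) //.
have -> : shuf f g (j :: v') = shuf f g (j :: i :: u).
  by rewrite /= !(IH v' _ _ _ _ lv' (i :: u) pv') //; apply: symw_shift.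
rewrite /=.
have fE : (fun u0 => f (i :: j :: u0)) = (fun u0 => f (j :: i :: u0)).
  by apply/funext => l; apply: sf; rewrite (perm_catCA [:: i] [:: j]).
have gE : (fun u0 => g (i :: j :: u0)) = (fun u0 => g (j :: i :: u0)).
  by apply/funext => l; apply: sg; rewrite (perm_catCA [:: i] [:: j]).
by rewrite fE gE addrACA.
Qed.

Lemma symserM F G : symser F -> symser G -> symser (F * G).
Proof. by move=> sF sG t; apply: symw_shuf. Qed.

Lemma symser1 : symser 1.
Proof. by move=> t w w' p; rewrite !ser1 /nilp (perm_size p). Qed.

Lemma symserX F n : symser F -> symser (F ^+ n).
Proof. by move=> sF; elim: n => [|n IH]; [apply: symser1 | rewrite exprS; apply: symserM]. Qed.

Lemma symserN F : symser F -> symser (- F).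
Proof. by move=> sF t w w' p; rewrite !serN (sF _ _ _ p). Qed.

Lemma symser_exp F : symser F -> symser (ser_exp F).
Proof.
move=> sF t w w' p; rewrite /ser_exp /ser_lim (perm_size p).
by apply: eq_bigr => n _; congr (_ * _); apply: symserX.
Qed.

End SymSer.

Arguments hmul : simpl never.
Arguments heps : simpl never.
Arguments hone : simpl never.

(** * Linear forms on coordinate algebras *)

Section Linear.
Variables (k : fieldType) (U V : lmodType k).

Lemma linf_sum (f : U -> k) (T : Type) (s : seq T) (P : pred T) (c : T -> k) (u : T -> U) :
  scalar f -> f (\sum_(i <- s | P i) c i *: u i) = \sum_(i <- s | P i) c i * f (u i).
Proof.
move=> lf; elim/big_rec2: _ => [|i x y _ <-]; last by rewrite lf.
by have := lf (-1) 0 0; rewrite scaler0 add0r mulN1r addNr.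
Qed.

Lemma linf0 (f : U -> k) : scalar f -> f 0 = 0.
Proof. by move=> lf; have := lf (-1) 0 0; rewrite scaler0 add0r mulN1r addNr. Qed.

Lemma linfZ (f : U -> k) c u : scalar f -> f (c *: u) = c * f u.
Proof. by move=> lf; have := lf c u 0; rewrite addr0 (linf0 lf) addr0. Qed.

Lemma linf_sum1 (f : U -> k) (T : Type) (s : seq T) (u : T -> U) :
  scalar f -> f (\sum_(i <- s) u i) = \sum_(i <- s) f (u i).
Proof.
move=> lf; have := linf_sum s xpredT (fun=> 1) u lf.
under eq_bigr do rewrite scale1r.
by move=> ->; apply: eq_bigr => i _; rewrite mul1r.
Qed.

Lemma scalar_add (f g : U -> k) : scalar f -> scalar g -> scalar (fun a => f a + g a).
Proof. by move=> lf lg c u v; rewrite lf lg mulrDr addrACA. Qed.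

Lemma scalar_opp (f : U -> k) : scalar f -> scalar (fun a => - f a).
Proof. by move=> lf c u v; rewrite lf opprD mulrN. Qed.

Lemma scalar_scale (f : U -> k) d : scalar f -> scalar (fun a => d * f a).
Proof. by move=> lf c u v; rewrite lf mulrDr mulrCA. Qed.

Lemma scalar_bigsum (T : Type) (s : seq T) (F : T -> U -> k) :
  (forall i, scalar (F i)) -> scalar (fun a => \sum_(i <- s) F i a).
Proof.
move=> lF c u v; rewrite mulr_sumr -big_split /=.
by apply: eq_bigr => i _; apply: lF.
Qed.

Lemma scalar_zero : scalar (fun _ : U => 0 : k).
Proof. by move=> c u v; rewrite mulr0 addr0. Qed.

Lemma scalar_comp (f : V -> k) (g : U -> V) :
  scalar f -> linear g -> scalar (fun a => f (g a)).
Proof. by move=> lf lg c u v; rewrite lg lf. Qed.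

End Linear.

Section Coordinates.
Variables (k : fieldType) (G : affine_group k).
Local Notation H := (coord_alg G).
Implicit Types (f g h a b c : H) (x y z : G).

Definition ev x f : k := reg_val f x.
Arguments ev : simpl never.

Lemma regP f g : (forall x, ev x f = ev x g) -> f = g.
Proof. by move=> fg; apply: val_inj; apply/funext. Qed.

Lemma ev_scalar x : scalar (ev x). Proof. by []. Qed.

Lemma evD x f g : ev x (f + g) = ev x f + ev x g. Proof. by []. Qed.
Lemma evM x f g : ev x (hmul f g) = ev x f * ev x g. Proof. by []. Qed.
Lemma evZ x (t : k) f : ev x (t *: f) = t * ev x f. Proof. by []. Qed.
Lemma ev_one x : ev x (hone H) = 1. Proof. by []. Qed.
Lemma ev1 f : ev 1%g f = heps f. Proof. by []. Qed.
Lemma ev_sum x (T : Type) (s : seq T) (F : T -> H) :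
  ev x (\sum_(i <- s) F i) = \sum_(i <- s) ev x (F i).
Proof. exact/linf_sum1/ev_scalar. Qed.

Lemma hmulC f g : hmul f g = hmul g f.
Proof. by apply: regP => x; rewrite !evM mulrC. Qed.
Lemma hmul_assoc f g h : hmul f (hmul g h) = hmul (hmul f g) h.
Proof. by apply: regP => x; rewrite !evM mulrA. Qed.
Lemma hmulCA f g h : hmul f (hmul g h) = hmul g (hmul f h).
Proof. by rewrite !hmul_assoc [hmul f g]hmulC. Qed.
Lemma hmul1l f : hmul (hone H) f = f.
Proof. by apply: regP => x; rewrite evM ev_one mul1r. Qed.
Lemma hmul1r f : hmul f (hone H) = f.
Proof. by rewrite hmulC hmul1l. Qed.
Lemma hmul_linl g : linear (fun f => hmul f g).
Proof. by move=> t f f'; apply: regP => x; rewrite !(evM, evD, evZ) mulrDl mulrA. Qed.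
Lemma hmul_linr f : linear (fun g => hmul f g).
Proof. by move=> t g g'; rewrite -[LHS]hmulC hmul_linl ![hmul _ f]hmulC. Qed.
Lemma heps_scalar : scalar (@heps k H). Proof. by []. Qed.
Lemma heps_mul f g : heps (hmul f g) = heps f * heps g. Proof. by []. Qed.
Lemma heps_one : heps (hone H) = 1. Proof. by []. Qed.

(** Gaussian elimination on points. A new function minus its interpolant is 0 or nonzero at some
    [z0]; in the second case it is added, normalized at [z0], and the earlier functions are
    corrected to vanish there. *)
Lemma interpolation (L : seq H) : exists s : seq (H * G),
  forall h, h \in L -> h = \sum_(p <- s) ev p.2 h *: p.1.
Proof.
elim: L => [|h L [s Hs]]; first by exists [::].
pose h' := h - \sum_(p <- s) ev p.2 h *: p.1.
have [h'0|/eqP h'N0] := eqVneq h' 0.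
  exists s => g; rewrite inE => /orP[/eqP->|/Hs//].
  by apply/eqP; rewrite -subr_eq0 -/h' h'0.
have [z0 z0P] : exists z0, ev z0 h' != 0.
  by apply: contrapT => nz; apply: h'N0; apply: regP => x; apply: contrapT => /eqP e; apply: nz; exists x.
pose eta0 := (ev z0 h')^-1 *: h'.
exists ((eta0, z0) :: [seq (p.1 - ev z0 p.1 *: eta0, p.2) | p <- s]) => g.
rewrite big_cons big_map /=.
have -> : \sum_(p <- s) ev p.2 g *: (p.1 - ev z0 p.1 *: eta0) =
    (\sum_(p <- s) ev p.2 g *: p.1) -
    ev z0 (\sum_(p <- s) ev p.2 g *: p.1) *: eta0.
  rewrite (linf_sum s xpredT (fun p => ev p.2 g) (fun p => p.1) (ev_scalar z0)).
  by rewrite scaler_suml -sumrB; apply: eq_bigr => p _; rewrite scalerBr scalerA.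
rewrite inE => /orP[/eqP->|/Hs gE]; last by rewrite -gE addrC subrK.
rewrite addrCA -scalerBl -[h in h = _](subrK (\sum_(p <- s) ev p.2 h *: p.1)).
rewrite -/h' addrC; congr (_ + _).
by rewrite -[_ - _]/(ev z0 h') scalerA mulfV // scale1r.
Qed.

End Coordinates.
Arguments ev : simpl never.

Section TensorInjectivity.
Variables (k : fieldType) (G G' : affine_group k).
Local Notation H := (coord_alg G).
Local Notation H' := (coord_alg G').

(** Injectivity of O(G) (x) O(G') into the functions on the product. Interpolating the second
    factors leaves, at each node, a sum of first factors that vanishes at every point. *)
Lemma bilinear_vanish (B : H -> H' -> k) (s : seq (H * H')) :
  bilinear_for *%R *%R B ->
  (forall x y, \sum_(p <- s) ev x p.1 * ev y p.2 = 0) ->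
  \sum_(p <- s) B p.1 p.2 = 0.
Proof.
move=> [Bl Br] s0; have [t tP] := interpolation [seq p.2 | p <- s].
have -> : \sum_(p <- s) B p.1 p.2 =
    \sum_(p <- s) \sum_(q <- t) ev q.2 p.2 * B p.1 q.1.
  rewrite big_seq [RHS]big_seq; apply: eq_bigr => p ps.
  rewrite {1}(tP p.2) ?map_f //.
  exact: (linf_sum t xpredT (fun q => ev q.2 p.2) _ (Br p.1)).
rewrite exchange_big big1 //= => q _.
rewrite -(linf_sum s xpredT (fun p => ev q.2 p.2) (fun p => p.1) (Bl q.1)).
rewrite (_ : \sum_(_ <- _) _ = 0) ?(linf0 (Bl q.1)) //.
apply: regP => x; rewrite ev_sum -[ev x 0]/(0 : k) -[RHS](s0 x q.2).
by apply: eq_bigr => p _; rewrite evZ mulrC.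
Qed.

Lemma bilinear_eq (B : H -> H' -> k) (s s' : seq (H * H')) :
  bilinear_for *%R *%R B ->
  (forall x y, \sum_(p <- s) ev x p.1 * ev y p.2 =
               \sum_(p <- s') ev x p.1 * ev y p.2) ->
  \sum_(p <- s) B p.1 p.2 = \sum_(p <- s') B p.1 p.2.
Proof.
move=> bB ss'; apply/eqP; rewrite -subr_eq0; apply/eqP.
have [Bl Br] := bB.
pose s2 := s ++ [seq (-1 *: p.1, p.2) | p <- s'].
have := @bilinear_vanish B s2 bB; rewrite /s2 big_cat big_map /=.
have -> : \sum_(p <- s') B (-1 *: p.1) p.2 = - \sum_(p <- s') B p.1 p.2.
  by rewrite -sumrN; apply: eq_bigr => p _; rewrite (linfZ _ _ (Bl _)) mulN1r.
apply=> x y; rewrite big_cat big_map /= ss' -big_split big1 //= => p _.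
by rewrite evZ mulN1r mulNr subrr.
Qed.

End TensorInjectivity.

Lemma tensor_regfun (k : fieldType) (G1 G2 : affine_group k) (F : G1 * G2 -> k) :
  tensor_functions (ag_reg (a := G1)) (ag_reg (a := G2)) F ->
  exists s : seq (coord_alg G1 * coord_alg G2),
    forall x y, F (x, y) = \sum_(p <- s) ev x p.1 * ev y p.2.
Proof.
move=> [s [sP sE]].
suff [s' s'E] : exists s' : seq (coord_alg G1 * coord_alg G2),
    forall x y, \sum_(p <- s) p.1 x * p.2 y = \sum_(p <- s') ev x p.1 * ev y p.2.
  by exists s' => x y; rewrite sE s'E.
elim: s sP {sE} => [|p s IH] sP; first by exists [::] => x y; rewrite !big_nil.
have [s' s'E] := IH (fun q qs => sP q (mem_behead (s := p :: s) qs)).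
have [/mem_set p1 /mem_set p2] := sP p (mem_head _ _).
exists ((RegFun (reg_val := p.1) p1, RegFun (reg_val := p.2) p2) :: s') => x y.
by rewrite !big_cons s'E.
Qed.

Section Coproduct.
Variables (k : fieldType) (G : affine_group k).
Local Notation H := (coord_alg G).
Implicit Types (f g h a b c : H) (x y z : G) (B J K : H -> H -> k).

(** [hcop] is a choice with default [[::]]. Regularity of the multiplication of G provides a
    representing list, so the default is never taken. *)
Lemma hcop_spec f x y : ev (x * y)%g f = \sum_(p <- hcop f) ev x p.1 * ev y p.2.
Proof.
have ex : exists s : seq (H * H),
    forall x y, ev (x * y)%g f = \sum_(p <- s) ev x p.1 * ev y p.2.
  have := ag_mul (ag_axioms G) (set_mem (valP f)).
  by move=> /tensor_regfun[s sE]; exists s => x' y'; rewrite -sE.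
exact: (xgetPex [::] ex).
Qed.

(** Frees the development from the chosen representative: a coproduct is computed by exhibiting any
    list that represents f(xy). *)
Lemma hcop_eq B f (s : seq (H * H)) : biform B ->
  (forall x y, ev (x * y)%g f = \sum_(p <- s) ev x p.1 * ev y p.2) ->
  \sum_(p <- hcop f) B p.1 p.2 = \sum_(p <- s) B p.1 p.2.
Proof. by move=> bB sE; apply: bilinear_eq => // x y; rewrite -hcop_spec. Qed.

Lemma hcop_scalar B : biform B -> scalar (fun f => \sum_(p <- hcop f) B p.1 p.2).
Proof.
move=> bB t f g; have [Bl Br] := bB.
rewrite (hcop_eq (s := [seq (t *: p.1, p.2) | p <- hcop f] ++ hcop g)) //.
  rewrite big_cat big_map /=; congr (_ + _); rewrite mulr_sumr.
  by apply: eq_bigr => p _; rewrite (linfZ _ _ (Bl _)).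
move=> x y; rewrite big_cat big_map /= evD evZ !hcop_spec; congr (_ + _).
by rewrite mulr_sumr; apply: eq_bigr => p _; rewrite evZ mulrA.
Qed.

Lemma hcop_mul B f g : biform B ->
  \sum_(p <- hcop (hmul f g)) B p.1 p.2 =
  \sum_(p <- hcop f) \sum_(q <- hcop g) B (hmul p.1 q.1) (hmul p.2 q.2).
Proof.
move=> bB; pose s := [seq (hmul p.1 q.1, hmul p.2 q.2) | p <- hcop f, q <- hcop g].
rewrite (hcop_eq (s := s)) /s ?big_allpairs_dep //= => x y.
rewrite big_allpairs_dep /= evM !hcop_spec mulr_suml; apply: eq_bigr => p _.
rewrite mulr_sumr; apply: eq_bigr => q _; rewrite !evM; exact: mulrACA.
Qed.

Lemma hcop_group B f : biform B -> (forall x y, ev (x * y)%g f = ev x f * ev y f) ->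
  \sum_(p <- hcop f) B p.1 p.2 = B f f.
Proof.
by move=> bB fM; rewrite (hcop_eq (s := [:: (f, f)])) ?big_seq1 // => x y; rewrite big_seq1.
Qed.

Lemma hcop_one B : biform B -> \sum_(p <- hcop (hone H)) B p.1 p.2 = B (hone H) (hone H).
Proof. by move=> bB; apply: hcop_group => // x y; rewrite !ev_one mulr1. Qed.

Lemma hcop_prim B u a : biform B -> (forall x y, ev (x * y)%g u = ev x u + ev y u) ->
  \sum_(p <- hcop (hmul u a)) B p.1 p.2 =
  \sum_(p <- hcop a) B (hmul u p.1) p.2 + \sum_(p <- hcop a) B p.1 (hmul u p.2).
Proof.
move=> bB uD.
pose s := [seq (hmul u p.1, p.2) | p <- hcop a] ++ [seq (p.1, hmul u p.2) | p <- hcop a].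
rewrite (hcop_eq (s := s)) /s ?big_cat ?big_map //= => x y.
rewrite big_cat !big_map /= evM uD hcop_spec mulrDl !mulr_sumr; congr (_ + _).
  by apply: eq_bigr => p _; rewrite evM mulrA.
by apply: eq_bigr => p _; rewrite evM mulrCA.
Qed.

Lemma hcop_epsl f : \sum_(p <- hcop f) heps p.1 *: p.2 = f.
Proof.
apply: regP => y; rewrite ev_sum -[in RHS](mul1g y) hcop_spec.
by apply: eq_bigr => p _; rewrite evZ.
Qed.

Lemma hcop_epsr f : \sum_(p <- hcop f) heps p.2 *: p.1 = f.
Proof.
apply: regP => y; rewrite ev_sum -[in RHS](mulg1 y) hcop_spec.
by apply: eq_bigr => p _; rewrite evZ mulrC.
Qed.

Lemma hcop_epsl_form (phi : H -> k) f : scalar phi ->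
  \sum_(p <- hcop f) heps p.1 * phi p.2 = phi f.
Proof. by move=> lphi; rewrite -(linf_sum _ xpredT) // hcop_epsl. Qed.

Lemma hcop_epsr_form (phi : H -> k) f : scalar phi ->
  \sum_(p <- hcop f) phi p.1 * heps p.2 = phi f.
Proof.
move=> lphi; rewrite -[in RHS](hcop_epsr f) (linf_sum _ xpredT) //.
by apply: eq_bigr => p _; rewrite mulrC.
Qed.

Lemma hcop_assoc (T : H -> H -> H -> k) f : triform T ->
  \sum_(p <- hcop f) \sum_(q <- hcop p.1) T q.1 q.2 p.2 =
  \sum_(p <- hcop f) \sum_(q <- hcop p.2) T p.1 q.1 q.2.
Proof.
move=> [T1 T2 T3].
have bT3 c : biform (fun a b => T a b c) by [].
(* Expand the third factor by interpolation, then the first two are handled by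
   injectivity of the tensor product. *)
pose L := [seq p.2 | p <- hcop f] ++ [seq q.2 | p <- hcop f, q <- hcop p.2].
have [t tP] := interpolation L.
have -> : \sum_(p <- hcop f) \sum_(q <- hcop p.1) T q.1 q.2 p.2 =
    \sum_(r <- t) \sum_(p <- hcop f) \sum_(q <- hcop p.1) (ev r.2 p.2 * T q.1 q.2 r.1).
  rewrite [RHS]exchange_big /= big_seq [RHS]big_seq; apply: eq_bigr => p pf.
  rewrite [RHS]exchange_big /=; apply: eq_bigr => q _.
  rewrite {1}(tP p.2) ?mem_cat ?map_f //.
  exact: (linf_sum t xpredT (fun r => ev r.2 p.2) _ (T3 q.1 q.2)).
have -> : \sum_(p <- hcop f) \sum_(q <- hcop p.2) T p.1 q.1 q.2 =
    \sum_(r <- t) \sum_(p <- hcop f) \sum_(q <- hcop p.2) (ev r.2 q.2 * T p.1 q.1 r.1).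
  rewrite [RHS]exchange_big /= big_seq [RHS]big_seq; apply: eq_bigr => p pf.
  rewrite [RHS]exchange_big /= big_seq [RHS]big_seq; apply: eq_bigr => q qp.
  rewrite {1}(tP q.2).
    exact: (linf_sum t xpredT (fun r => ev r.2 q.2) _ (T3 p.1 q.1)).
  rewrite mem_cat; apply/orP; right; apply/allpairsPdep; exists p, q; split=> //.
apply: eq_bigr => r _.
pose s1 := [seq (ev r.2 p.2 *: q.1, q.2) | p <- hcop f, q <- hcop p.1].
pose s2 := [seq (ev r.2 q.2 *: p.1, q.1) | p <- hcop f, q <- hcop p.2].
have E : forall (c : k) a b, T (c *: a) b r.1 = c * T a b r.1.
  by move=> c a b; exact: (linfZ _ _ (T1 b r.1)).
transitivity (\sum_(p <- s1) T p.1 p.2 r.1).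
  rewrite /s1 big_allpairs_dep; apply: eq_bigr => p _; apply: eq_bigr => q _.
  by rewrite -E.
transitivity (\sum_(p <- s2) T p.1 p.2 r.1); last first.
  rewrite /s2 big_allpairs_dep; apply: eq_bigr => p _; apply: eq_bigr => q _.
  by rewrite -E.
apply: (@bilinear_eq _ _ _ (fun a b => T a b r.1) s1 s2 (bT3 r.1)).
move=> x y; rewrite /s1 /s2 !big_allpairs_dep /=.
transitivity (ev (x * y * r.2)%g f).
  rewrite hcop_spec; apply: eq_bigr => p _; rewrite hcop_spec mulr_suml.
  by apply: eq_bigr => q _; rewrite evZ; ring.
rewrite -mulgA hcop_spec; apply: eq_bigr => p _; rewrite hcop_spec mulr_sumr.
by apply: eq_bigr => q _; rewrite evZ; ring.
Qed.

Definition coord_antipode_subproof f : (fun x => ev (x^-1)%g f : k^o) \in reg_pred G.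
Proof. by rewrite inE; apply: (ag_inv (ag_axioms G)); apply: (set_mem (valP f)). Qed.

Lemma is_hopf_coord : is_hopf H.
Proof.
split.
- by split=> [b t a a'|a t b b']; [apply: hmul_linl | apply: hmul_linr].
- exact: hmul_assoc.
- exact: hmul1l.
- exact: hmul1r.
- exact: hcop_scalar.
- exact: heps_scalar.
- by move=> T tT a; apply: hcop_assoc.
- exact: hcop_epsl.
- exact: hcop_epsr.
- by move=> J bJ a b; apply: hcop_mul.
- exact: hcop_one.
- exact: heps_mul.
- exact: heps_one.
- exists (fun f => RegFun (coord_antipode_subproof f)); split.
  + by move=> t f g; apply: regP => x.
  + move=> f; apply: regP => x; rewrite ev_sum evZ ev_one mulr1 -ev1 -(mulVg x).
    by rewrite hcop_spec; apply: eq_bigr => p _.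
  + move=> f; apply: regP => x; rewrite ev_sum evZ ev_one mulr1 -ev1 -(mulgV x).
    by rewrite hcop_spec; apply: eq_bigr => p _.
Qed.

End Coproduct.

(** * Monomial coordinates *)

Section Coords.
Variables (k : fieldType) (G : affine_group k) (X : nmodType) (I : eqType).
Local Notation H := (coord_alg G).

Definition monomial (ch : X -> H) (u : I -> H) (t : X) (w : seq I) : H :=
  foldr (fun i => hmul (u i)) (ch t) w.

Lemma ev_monomial ch u t w (x : G) :
  ev x (monomial ch u t w) = ev x (ch t) * \prod_(i <- w) ev x (u i).
Proof.
elim: w => [|i w IH]; first by rewrite big_nil mulr1.
by rewrite -[monomial _ _ _ _]/(hmul (u i) _) evM IH big_cons mulrCA.
Qed.

Lemma monomial_perm ch u t w w' : perm_eq w w' -> monomial ch u t w = monomial ch u t w'.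
Proof. by move=> p; apply: regP => x; rewrite !ev_monomial (perm_big _ p). Qed.

(* The monomials cch t * cvar i1 * ... * cvar in, taken up to the order of the
   letters, form a basis of O(G).  The trivial group of characters is 'I_1. *)
Record coords := Coords {
  cch : X -> H;
  cvar : I -> H;
  cch0 : cch 0 = hone H;
  cchD : forall s t, cch (s + t) = hmul (cch s) (cch t);
  cch_eps : forall t, heps (cch t) = 1;
  cch_mul : forall t (x y : G), ev (x * y)%g (cch t) = ev x (cch t) * ev y (cch t);
  cvar_add : forall i (x y : G), ev (x * y)%g (cvar i) = ev x (cvar i) + ev y (cvar i);
  c_span : forall f : H, exists s : seq (k * (X * seq I)),
    f = \sum_(p <- s) p.1 *: monomial cch cvar p.2.1 p.2.2;
  c_ext : forall F : ser k X I, symser F ->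
    exists2 phi : H -> k, scalar phi & forall t w, phi (monomial cch cvar t w) = F t w }.

End Coords.

Section Bilinear.
Variables (k : fieldType) (G : affine_group k).
Local Notation H := (coord_alg G).
Implicit Types (J K : H -> H -> k).

Lemma biform_conv J K : biform J -> biform K -> biform (conv J K).
Proof.
move=> [Jl Jr] [Kl Kr]; split=> [b|a].
  apply: (@hcop_scalar _ _ (fun p1 p2 => \sum_(q <- hcop b) J p1 q.1 * K p2 q.2)).
  split=> [p2|p1]; apply: scalar_bigsum => q t u v.
    by rewrite Jl mulrDl mulrA.
  by rewrite Kl mulrDr mulrCA.
apply: scalar_bigsum => p.
apply: (@hcop_scalar _ _ (fun q1 q2 => J p.1 q1 * K p.2 q2)).
split=> [q2|q1] t u v /=; first by rewrite Jr mulrDl mulrA.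
by rewrite Kr mulrDr mulrCA.
Qed.

Lemma biform_one : biform (conv_one H).
Proof.
split=> [b|a] t u v; rewrite /conv_one heps_scalar /=.
  by rewrite mulrDl mulrA.
by rewrite mulrDr mulrCA.
Qed.

Lemma biform_prod (phi psi : H -> k) : scalar phi -> scalar psi ->
  biform (fun a b => phi a * psi b).
Proof.
move=> lp lq; split=> [b|a] t u v /=; first by rewrite lp mulrDl mulrA.
by rewrite lq mulrDr mulrCA.
Qed.

Lemma biform_mul (phi : H -> k) : scalar phi -> biform (fun a b => phi (hmul a b)).
Proof.
move=> lp; split=> [b|a]; apply: scalar_comp => //; first exact: hmul_linl.
exact: hmul_linr.
Qed.

Lemma biform_flip J : biform J -> biform (flip2 J).
Proof. by move=> [Jl Jr]; split=> [b|a]; [apply: Jr | apply: Jl]. Qed.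

Lemma biformD J K : biform J -> biform K -> biform (fun a b => J a b + K a b).
Proof. by move=> [Jl Jr] [Kl Kr]; split=> [b|a]; apply: scalar_add. Qed.

Lemma biformN J : biform J -> biform (fun a b => - J a b).
Proof. by move=> [Jl Jr]; split=> [b|a]; apply: scalar_opp. Qed.

Lemma biformZ c J : biform J -> biform (fun a b => c * J a b).
Proof. by move=> [Jl Jr]; split=> [b|a]; apply: scalar_scale. Qed.

Lemma biform_sum (T : Type) (s : seq T) (F : T -> H -> H -> k) :
  (forall i, biform (F i)) -> biform (fun a b => \sum_(i <- s) F i a b).
Proof. by move=> bF; split=> [b|a]; apply: scalar_bigsum => i; have [] := bF i. Qed.

Lemma conv1_scalar (x y : H -> k) : scalar x -> scalar y -> scalar (conv1 x y).
Proof. by move=> lx ly; apply: (@hcop_scalar _ _ (fun a b => x a * y b)); apply: biform_prod. Qed.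

Definition conv3 (S T : H -> H -> H -> k) a b c :=
  \sum_(p <- hcop a) \sum_(q <- hcop b) \sum_(r <- hcop c)
    S p.1 q.1 r.1 * T p.2 q.2 r.2.

Lemma triform_conv3 S T : triform S -> triform T -> triform (conv3 S T).
Proof.
move=> [S1 S2 S3] [T1 T2 T3]; split.
- move=> b c; apply: (@hcop_scalar _ _ (fun p1 p2 => \sum_(q <- hcop b)
     \sum_(r <- hcop c) S p1 q.1 r.1 * T p2 q.2 r.2)).
  split=> [p2|p1]; do 2 apply: scalar_bigsum => ?; move=> t u v.
    by rewrite S1 mulrDl mulrA.
  by rewrite T1 mulrDr mulrCA.
- move=> a c; apply: scalar_bigsum => p.
  apply: (@hcop_scalar _ _ (fun q1 q2 =>
     \sum_(r <- hcop c) S p.1 q1 r.1 * T p.2 q2 r.2)).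
  split=> [p2|p1]; apply: scalar_bigsum => ?; move=> t u v.
    by rewrite S2 mulrDl mulrA.
  by rewrite T2 mulrDr mulrCA.
- move=> a b; apply: scalar_bigsum => p; apply: scalar_bigsum => q.
  apply: (@hcop_scalar _ _ (fun r1 r2 => S p.1 q.1 r1 * T p.2 q.2 r2)).
  split=> [p2|p1] t u v /=; first by rewrite S3 mulrDl mulrA.
  by rewrite T3 mulrDr mulrCA.
Qed.

(** In these names the underscore separates the two arguments of J, and adjacent digits are
    multiplied. A leg that does not occur is fed to the counit. *)
Definition on12_3 J : H -> H -> H -> k := fun a b c => J (hmul a b) c.
Definition on1_23 J : H -> H -> H -> k := fun a b c => J a (hmul b c).
Definition on2_13 J : H -> H -> H -> k := fun a b c => J b (hmul a c).
Definition on1_2 J : H -> H -> H -> k := fun a b c => J a b * heps c.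
Definition on2_3 J : H -> H -> H -> k := fun a b c => heps a * J b c.
Definition on1_3 J : H -> H -> H -> k := fun a b c => J a c * heps b.

Lemma triform_on J : biform J ->
  [/\ triform (on12_3 J), triform (on1_23 J) & triform (on2_13 J)] /\
  [/\ triform (on1_2 J), triform (on2_3 J) & triform (on1_3 J)].
Proof.
move=> [Jl Jr]; have El := @hmul_linl _ G; have Er := @hmul_linr _ G.
have D (f g : H -> k) : scalar f -> (scalar (fun a => f a * heps (hone H))).
  by move=> lf; rewrite heps_one; under eq_fun do rewrite mulr1.
split; split; split=> u v; rewrite /on12_3 /on1_23 /on2_13 /on1_2 /on2_3 /on1_3;
  try (exact: (scalar_comp (Jl _) (El _)));
  try (exact: (scalar_comp (Jl _) (Er _)));
  try (exact: (scalar_comp (Jr _) (El _)));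
  try (exact: (scalar_comp (Jr _) (Er _)));
  try (exact: Jl); try (exact: Jr);
  move=> t a b; rewrite ?Jl ?Jr ?heps_scalar ?mulrDl ?mulrDr ?mulrA //;
  by congr (_ + _); rewrite [t * _]mulrC ?mulrA // -!mulrA mulrCA.
Qed.

End Bilinear.

(** * From multilinear forms to series *)

Section Dictionary.
Variables (k : fieldType) (G : affine_group k) (X : nmodType) (I : eqType).
Variable C : coords G X I.
Local Notation H := (coord_alg G).
Local Notation X2 := (X * X)%type.
Local Notation X3 := (X * X * X)%type.
Local Notation I2 := (I + I)%type.
Local Notation I3 := (I + I + I)%type.
Implicit Types (a b c : H) (phi psi : H -> k) (J K : H -> H -> k) (S T : H -> H -> H -> k).

Definition mon t w : H := monomial (cch C) (cvar C) t w.

Lemma heps_cvar i : heps (cvar C i) = 0.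
Proof.
have := cvar_add C i 1%g 1%g; rewrite mulg1 !ev1 => /eqP.
by rewrite -subr_eq subrr eq_sym => /eqP.
Qed.

Lemma heps_mon t w : heps (mon t w) = (nilp w)%:R.
Proof. by case: w => [|i w]; [apply: cch_eps | rewrite [LHS]heps_mul heps_cvar mul0r]. Qed.

Lemma mon_cons t i w : mon t (i :: w) = hmul (cvar C i) (mon t w). Proof. by []. Qed.

Lemma mon_mul s t u v : hmul (mon s u) (mon t v) = mon (s + t) (u ++ v).
Proof.
elim: u => [|i u IH]; last by rewrite cat_cons !mon_cons -IH hmul_assoc.
elim: v => [|i v IH]; first by rewrite [RHS]cchD.
by rewrite !mon_cons -IH hmulCA.
Qed.

Lemma mon0 : mon 0 [::] = hone H. Proof. exact: cch0. Qed.

Lemma mon_perm t w w' : perm_eq w w' -> mon t w = mon t w'.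
Proof. exact: monomial_perm. Qed.

Lemma mon_span_ind (P : H -> Prop) :
  (forall t a b, P a -> P b -> P (t *: a + b)) -> P 0 ->
  (forall t w, P (mon t w)) -> forall a, P a.
Proof.
move=> PD P0 Pm a; have [s ->] := c_span C a.
by elim: s => [|p s IH]; rewrite ?big_nil // big_cons; apply: PD => //; apply: Pm.
Qed.

Lemma scalar_eq phi psi : scalar phi -> scalar psi ->
  (forall t w, phi (mon t w) = psi (mon t w)) -> forall a, phi a = psi a.
Proof.
move=> lp lq pq; apply: mon_span_ind => //; last by rewrite (linf0 lp) (linf0 lq).
by move=> t a b pa pb; rewrite lp lq /= pa pb.
Qed.

Definition hat1 phi : ser k X I := fun t w => phi (mon t w).

Definition lft (l : I2) := if l is inl i then Some i else None.
Definition rgt (l : I2) := if l is inr i then Some i else None.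

(** A monomial of O(G) (x) O(G) is a word in the disjoint union of two alphabets, whose letters
    commute. Interleavings are redundant, but they make convolution the shuffle product over a
    single alphabet. *)
Definition hat2 J : ser k X2 I2 := fun t w =>
  J (mon t.1 (pmap lft w)) (mon t.2 (pmap rgt w)).

Definition slot1 (l : I3) := if l is inl (inl i) then Some i else None.
Definition slot2 (l : I3) := if l is inl (inr i) then Some i else None.
Definition slot3 (l : I3) := if l is inr i then Some i else None.

Definition hat3 T : ser k X3 I3 := fun t w =>
  T (mon t.1.1 (pmap slot1 w)) (mon t.1.2 (pmap slot2 w)) (mon t.2 (pmap slot3 w)).

Lemma hat1_inj phi psi : scalar phi -> scalar psi -> hat1 phi = hat1 psi -> phi = psi.
Proof.
move=> lp lq e; apply/funext; apply: scalar_eq => // t w.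
exact: (congr1 (fun F => F t w) e).
Qed.

Lemma pmap_id (A B : Type) (f : A -> option B) (g : B -> A) : pcancel g f ->
  forall s, pmap f (map g s) = s.
Proof. by move=> gf; elim=> //= i s ->; rewrite gf. Qed.

Lemma pmap_none (A B D : Type) (f : A -> option B) (g : D -> A) :
  (forall i, f (g i) = None) -> forall s, pmap f (map g s) = [::].
Proof. by move=> gf; elim=> //= i s ->; rewrite gf. Qed.

Lemma hat2_mon J s u t v :
  hat2 J (s, t) (map inl u ++ map inr v) = J (mon s u) (mon t v).
Proof.
rewrite /hat2 !pmap_cat !(@pmap_id _ _ lft inl, @pmap_id _ _ rgt inr) //.
by rewrite !(@pmap_none _ _ _ lft inr, @pmap_none _ _ _ rgt inl) // cats0.
Qed.

Lemma hat3_mon T s u t v r w :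
  hat3 T (s, t, r) (map (inl \o inl) u ++ map (inl \o inr) v ++ map inr w) =
  T (mon s u) (mon t v) (mon r w).
Proof.
rewrite /hat3 !pmap_cat.
rewrite (@pmap_id _ _ slot1 (inl \o inl)) // (@pmap_id _ _ slot2 (inl \o inr)) //.
rewrite (@pmap_id _ _ slot3 inr) //.
rewrite (@pmap_none _ _ _ slot1 (inl \o inr)) // (@pmap_none _ _ _ slot1 inr) //.
rewrite (@pmap_none _ _ _ slot2 (inl \o inl)) // (@pmap_none _ _ _ slot2 inr) //.
rewrite (@pmap_none _ _ _ slot3 (inl \o inl)) // (@pmap_none _ _ _ slot3 (inl \o inr)) //.
by rewrite !cats0.
Qed.

Lemma biform_eq J K : biform J -> biform K ->
  (forall s u t v, J (mon s u) (mon t v) = K (mon s u) (mon t v)) -> J = K.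
Proof.
move=> [Jl Jr] [Kl Kr] JK; apply/funext => a; apply/funext => b.
apply: (scalar_eq (Jl b) (Kl b)) => s u.
exact: (scalar_eq (Jr _) (Kr _)).
Qed.

Lemma hat2_inj J K : biform J -> biform K -> hat2 J = hat2 K -> J = K.
Proof.
by move=> bJ bK e; apply: biform_eq => // s u t v; rewrite -!hat2_mon e.
Qed.

Lemma hat3_inj S T : triform S -> triform T -> hat3 S = hat3 T -> S = T.
Proof.
move=> [S1 S2 S3] [T1 T2 T3] e.
apply/funext => a; apply/funext => b; apply/funext => c.
apply: (scalar_eq (S1 b c) (T1 b c)) => s u.
apply: (scalar_eq (S2 _ c) (T2 _ c)) => t v.
apply: (scalar_eq (S3 _ _) (T3 _ _)) => r w.
by rewrite -!hat3_mon e.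
Qed.

Lemma hat1_eps : hat1 (@heps k H) = 1.
Proof. by apply: serP => t w; rewrite /hat1 heps_mon. Qed.

(** Characters are grouplike and variables primitive; their coproducts give the two clauses of
    [shuf]. *)
Lemma hat1_conv phi psi : scalar phi -> scalar psi ->
  hat1 (conv1 phi psi) = hat1 phi * hat1 psi.
Proof.
move=> lp lq; apply: serP => t w; rewrite serM /hat1.
elim: w phi psi lp lq => [|i w IH] phi psi lp lq.
  apply: (@hcop_group _ _ (fun a b => phi a * psi b)); last exact: cch_mul.
  exact: biform_prod.
rewrite /conv1 (@hcop_prim _ _ (fun a b => phi a * psi b)) //.
- by congr (_ + _); [apply: (IH (phi \o hmul (cvar C i))) | apply: (IH _ (psi \o hmul (cvar C i)))] => //;
    apply: scalar_comp => //; exact: hmul_linr.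
- exact: biform_prod.
- exact: cvar_add.
Qed.

Lemma hat2_one : hat2 (conv_one H) = 1.
Proof.
apply: serP => t w; rewrite /hat2 /conv_one !heps_mon ser1.
by case: w => [|[i|i] w] /=; rewrite ?mul0r ?mulr0 ?mul1r.
Qed.

Lemma biform_shl i J : biform J -> biform (fun a b => J (hmul (cvar C i) a) b).
Proof.
move=> [Jl Jr]; split=> [b|a]; last exact: Jr.
exact: (scalar_comp (Jl b) (@hmul_linr _ _ _)).
Qed.

Lemma biform_shr i J : biform J -> biform (fun a b => J a (hmul (cvar C i) b)).
Proof.
move=> [Jl Jr]; split=> [b|a]; first exact: Jl.
exact: (scalar_comp (Jr a) (@hmul_linr _ _ _)).
Qed.

Lemma biform_inner J K b : biform J -> biform K ->
  biform (fun p1 p2 => \sum_(q <- hcop b) J p1 q.1 * K p2 q.2).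
Proof.
move=> [Jl Jr] [Kl Kr]; apply: biform_sum => q.
exact: (biform_prod (Jl q.1) (Kl q.2)).
Qed.

Lemma conv_swap J K a b : conv J K a b =
  \sum_(q <- hcop b) \sum_(p <- hcop a) J p.1 q.1 * K p.2 q.2.
Proof. exact: exchange_big. Qed.

Lemma hat2_conv J K : biform J -> biform K ->
  hat2 (conv J K) = hat2 J * hat2 K.
Proof.
move=> bJ bK; apply: serP => -[s t] w; rewrite serM.
elim: w J K bJ bK => [|[i|i] w IH] J K bJ bK.
- rewrite /hat2 /= /conv (hcop_group (biform_inner _ bJ bK)); last exact: cch_mul.
  apply: (@hcop_group _ _ (fun a b => J _ a * K _ b)); last exact: cch_mul.
  by have [_ Jr] := bJ; have [_ Kr] := bK; apply: biform_prod.
- rewrite /hat2 [pmap _ _]/= [pmap rgt _]/= /conv.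
  rewrite (hcop_prim _ (biform_inner _ bJ bK) (cvar_add C i)).
  congr (_ + _).
    by apply: (IH (fun a b => J (hmul (cvar C i) a) b) K) => //; apply: biform_shl.
  by apply: (IH J (fun a b => K (hmul (cvar C i) a) b)) => //; apply: biform_shl.
- rewrite /hat2 [pmap _ _]/= [pmap rgt _]/= conv_swap.
  have bB a : biform (fun q1 q2 => \sum_(p <- hcop a) J p.1 q1 * K p.2 q2).
    apply: biform_sum => p; have [_ Jr] := bJ; have [_ Kr] := bK.
    exact: (biform_prod (Jr p.1) (Kr p.2)).
  rewrite (hcop_prim _ (bB _) (cvar_add C i)); congr (_ + _).
    rewrite -(@conv_swap (fun a b => J a (hmul (cvar C i) b)) K).
    by apply: (IH (fun a b => J a (hmul (cvar C i) b)) K) => //; apply: biform_shr.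
  rewrite -(@conv_swap J (fun a b => K a (hmul (cvar C i) b))).
  by apply: (IH J (fun a b => K a (hmul (cvar C i) b))) => //; apply: biform_shr.
Qed.

End Dictionary.
Arguments mon : simpl never.

Section Dictionary3.
Variables (k : fieldType) (G : affine_group k) (X : nmodType) (I : eqType).
Variable C : coords G X I.
Local Notation H := (coord_alg G).
Local Notation X2 := (X * X)%type.
Local Notation X3 := (X * X * X)%type.
Local Notation I2 := (I + I)%type.
Local Notation I3 := (I + I + I)%type.
Local Notation mon := (mon C).
Local Notation x_ := (cvar C).
Local Notation hat1 := (hat1 C).
Local Notation hat2 := (hat2 C).
Local Notation hat3 := (hat3 C).
Implicit Types (a b c : H) (phi psi : H -> k) (J K : H -> H -> k) (S T : H -> H -> H -> k).

Lemma triform_sh i T : triform T ->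
  [/\ triform (fun a b c => T (hmul (x_ i) a) b c),
      triform (fun a b c => T a (hmul (x_ i) b) c)
    & triform (fun a b c => T a b (hmul (x_ i) c))].
Proof.
by move=> [T1 T2 T3]; split; split=> u v; try (exact: T1); try (exact: T2);
  try (exact: T3); [exact: (scalar_comp (T1 u v) (@hmul_linr _ _ _))
  |exact: (scalar_comp (T2 u v) (@hmul_linr _ _ _))
  |exact: (scalar_comp (T3 u v) (@hmul_linr _ _ _))].
Qed.

Lemma hat3_conv S T : triform S -> triform T -> hat3 (conv3 S T) = hat3 S * hat3 T.
Proof.
move=> tS tT; apply: serP => -[[r s] t] w; rewrite serM.
have B3 (S' T' : H -> H -> H -> k) p q : triform S' -> triform T' -> forall u v,
    biform (fun r1 r2 => S' p u r1 * T' q v r2).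
  by move=> [_ _ S3] [_ _ T3] u v; apply: (biform_prod (S3 p u) (T3 q v)).
have B2 (S' T' : H -> H -> H -> k) p q c : triform S' -> triform T' ->
    biform (fun q1 q2 => \sum_(r <- hcop c) S' p q1 r.1 * T' q q2 r.2).
  by move=> [_ S2 _] [_ T2 _]; apply: biform_sum => u; apply: (biform_prod (S2 p u.1) (T2 q u.2)).
have B1 (S' T' : H -> H -> H -> k) b c : triform S' -> triform T' ->
    biform (fun p1 p2 => \sum_(q <- hcop b) \sum_(r <- hcop c) S' p1 q.1 r.1 * T' p2 q.2 r.2).
  move=> [S1 _ _] [T1 _ _]; do 2 apply: biform_sum => ?.
  exact: (biform_prod (S1 _ _) (T1 _ _)).
elim: w S T tS tT => [|[[i|i]|i] w IH] S T tS tT.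
- rewrite /hat3 /= /conv3 (hcop_group (B1 _ _ _ _ tS tT)); last exact: cch_mul.
  rewrite (hcop_group (B2 _ _ _ _ _ tS tT)); last exact: cch_mul.
  by rewrite (hcop_group (B3 _ _ _ _ tS tT _ _)) //; exact: cch_mul.
- rewrite /hat3 [pmap _ _]/= [pmap (@slot2 _) _]/= [pmap (@slot3 _) _]/= /conv3.
  rewrite (hcop_prim _ (B1 _ _ _ _ tS tT) (cvar_add C i)); congr (_ + _).
    by apply: (IH (fun a b c => S (hmul (x_ i) a) b c) T) => //; have [] := triform_sh i tS.
  by apply: (IH S (fun a b c => T (hmul (x_ i) a) b c)) => //; have [] := triform_sh i tT.
- rewrite /hat3 [pmap _ _]/= [pmap (@slot2 _) _]/= [pmap (@slot3 _) _]/= /conv3.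
  under eq_bigr do rewrite (hcop_prim _ (B2 _ _ _ _ _ tS tT) (cvar_add C i)).
  rewrite big_split; congr (_ + _).
    by apply: (IH (fun a b c => S a (hmul (x_ i) b) c) T) => //; have [] := triform_sh i tS.
  by apply: (IH S (fun a b c => T a (hmul (x_ i) b) c)) => //; have [] := triform_sh i tT.
- rewrite /hat3 [pmap _ _]/= [pmap (@slot2 _) _]/= [pmap (@slot3 _) _]/= /conv3.
  under eq_bigr do under eq_bigr do rewrite (hcop_prim _ (B3 _ _ _ _ tS tT _ _) (cvar_add C i)).
  under eq_bigr do rewrite big_split.
  rewrite big_split; congr (_ + _).
    by apply: (IH (fun a b c => S a b (hmul (x_ i) c)) T) => //; have [] := triform_sh i tS.
  by apply: (IH S (fun a b c => T a b (hmul (x_ i) c))) => //; have [] := triform_sh i tT.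
Qed.

(** Precomposition with the product of O(G), with a counit on one factor, and with the flip. Being
    instances of [pull], these are ring morphisms that commute with exp and log. *)
Definition pullmul : ser k X I -> ser k X2 I2 :=
  pull (fun t => t.1 + t.2) (fun l => Some (match l with inl i => i | inr i => i end)).
Definition pull1 : ser k X I -> ser k X2 I2 := pull fst (@lft I).
Definition pull2 : ser k X I -> ser k X2 I2 := pull snd (@rgt I).
Definition pullflip : ser k X2 I2 -> ser k X2 I2 :=
  pull (fun t => (t.2, t.1)) (fun l => Some (match l with inl i => inr i | inr i => inl i end)).

Lemma hat2_mul phi : hat2 (fun a b => phi (hmul a b)) = pullmul (hat1 phi).
Proof.
apply: serP => -[s t] w; rewrite /pullmul /pull.
elim: w phi => [|[i|i] w IH] phi.
- by rewrite /hat2 mon_mul.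
- rewrite -[RHS](IH (fun a => phi (hmul (x_ i) a))) /hat2 /= !mon_cons hmul_assoc //.
- by rewrite -[RHS](IH (fun a => phi (hmul (x_ i) a))) /hat2 /= !mon_cons hmulCA.
Qed.

Lemma hat2_pull1 phi : hat2 (fun a b => phi a * heps b) = pull1 (hat1 phi).
Proof.
apply: serP => -[s t] w; rewrite /pull1 /pull.
elim: w phi => [|[i|i] w IH] phi.
- by rewrite /hat2 /= heps_mon mulr1.
- by rewrite -[RHS](IH (fun a => phi (hmul (x_ i) a))).
- by rewrite /hat2 [pmap (@rgt _) _]/= mon_cons [heps _]heps_mul heps_cvar mul0r mulr0.
Qed.

Lemma hat2_pull2 phi : hat2 (fun a b => heps a * phi b) = pull2 (hat1 phi).
Proof.
apply: serP => -[s t] w; rewrite /pull2 /pull.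
elim: w phi => [|[i|i] w IH] phi.
- by rewrite /hat2 /= heps_mon mul1r.
- by rewrite /hat2 [pmap (@lft _) _]/= mon_cons [heps _]heps_mul heps_cvar !mul0r.
- by rewrite -[RHS](IH (fun a => phi (hmul (x_ i) a))).
Qed.

Lemma hat2_prod phi psi : scalar phi -> scalar psi ->
  hat2 (fun a b => phi a * psi b) = pull1 (hat1 phi) * pull2 (hat1 psi).
Proof.
move=> lp lq; rewrite -hat2_pull1 -hat2_pull2 -hat2_conv; first last.
- exact: (biform_prod (@heps_scalar _ _) lq).
- exact: (biform_prod lp (@heps_scalar _ _)).
congr hat2; apply/funext => a; apply/funext => b.
rewrite /conv -[LHS]/(phi a * psi b) -(hcop_epsr_form a lp) mulr_suml; apply: eq_bigr => p _.
rewrite -(hcop_epsl_form b lq) mulr_sumr; apply: eq_bigr => q _; ring.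
Qed.

Lemma hat2_flip J : hat2 (flip2 J) = pullflip (hat2 J).
Proof.
apply: serP => -[s t] w; rewrite /pullflip /pull /flip2.
elim: w J => [|[i|i] w IH] J; first by [].
- by rewrite -[RHS](IH (fun a b => J a (hmul (x_ i) b))).
- by rewrite -[RHS](IH (fun a b => J (hmul (x_ i) a) b)).
Qed.

Definition pull12_3 : ser k X2 I2 -> ser k X3 I3 :=
  pull (fun t => (t.1.1 + t.1.2, t.2))
    (fun l => Some (match l with inl (inl i) => inl i | inl (inr i) => inl i | inr i => inr i end)).
Definition pull1_23 : ser k X2 I2 -> ser k X3 I3 :=
  pull (fun t => (t.1.1, t.1.2 + t.2))
    (fun l => Some (match l with inl (inl i) => inl i | inl (inr i) => inr i | inr i => inr i end)).
Definition pull2_13 : ser k X2 I2 -> ser k X3 I3 :=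
  pull (fun t => (t.1.2, t.1.1 + t.2))
    (fun l => Some (match l with inl (inl i) => inr i | inl (inr i) => inl i | inr i => inr i end)).
Definition pull1_2 : ser k X2 I2 -> ser k X3 I3 :=
  pull (fun t => (t.1.1, t.1.2))
    (fun l => match l with inl (inl i) => Some (inl i) | inl (inr i) => Some (inr i) | inr i => None end).
Definition pull2_3 : ser k X2 I2 -> ser k X3 I3 :=
  pull (fun t => (t.1.2, t.2))
    (fun l => match l with inl (inl i) => None | inl (inr i) => Some (inl i) | inr i => Some (inr i) end).
Definition pull1_3 : ser k X2 I2 -> ser k X3 I3 :=
  pull (fun t => (t.1.1, t.2))
    (fun l => match l with inl (inl i) => Some (inl i) | inl (inr i) => None | inr i => Some (inr i) end).

Lemma hat3_12_3 J : hat3 (on12_3 J) = pull12_3 (hat2 J).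
Proof.
apply: serP => -[[r s] t] w; rewrite /pull12_3 /pull /on12_3.
elim: w J => [|[[i|i]|i] w IH] J.
- by rewrite /hat3 mon_mul.
- by rewrite -[RHS](IH (fun a b => J (hmul (x_ i) a) b)) /hat3 /= !mon_cons hmul_assoc.
- by rewrite -[RHS](IH (fun a b => J (hmul (x_ i) a) b)) /hat3 /= !mon_cons hmulCA.
- by rewrite -[RHS](IH (fun a b => J a (hmul (x_ i) b))).
Qed.

Lemma hat3_1_23 J : hat3 (on1_23 J) = pull1_23 (hat2 J).
Proof.
apply: serP => -[[r s] t] w; rewrite /pull1_23 /pull /on1_23.
elim: w J => [|[[i|i]|i] w IH] J.
- by rewrite /hat3 mon_mul.
- by rewrite -[RHS](IH (fun a b => J (hmul (x_ i) a) b)).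
- by rewrite -[RHS](IH (fun a b => J a (hmul (x_ i) b))) /hat3 /= !mon_cons hmul_assoc.
- by rewrite -[RHS](IH (fun a b => J a (hmul (x_ i) b))) /hat3 /= !mon_cons hmulCA.
Qed.

Lemma hat3_2_13 J : hat3 (on2_13 J) = pull2_13 (hat2 J).
Proof.
apply: serP => -[[r s] t] w; rewrite /pull2_13 /pull /on2_13.
elim: w J => [|[[i|i]|i] w IH] J.
- by rewrite /hat3 mon_mul.
- by rewrite -[RHS](IH (fun a b => J a (hmul (x_ i) b))) /hat3 /= !mon_cons hmul_assoc.
- by rewrite -[RHS](IH (fun a b => J (hmul (x_ i) a) b)).
- by rewrite -[RHS](IH (fun a b => J a (hmul (x_ i) b))) /hat3 /= !mon_cons hmulCA.
Qed.

Lemma hat3_1_2 J : hat3 (on1_2 J) = pull1_2 (hat2 J).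
Proof.
apply: serP => -[[r s] t] w; rewrite /pull1_2 /pull /on1_2.
elim: w J => [|[[i|i]|i] w IH] J.
- by rewrite /hat3 /= heps_mon mulr1.
- by rewrite -[RHS](IH (fun a b => J (hmul (x_ i) a) b)).
- by rewrite -[RHS](IH (fun a b => J a (hmul (x_ i) b))).
- by rewrite /hat3 [pmap (@slot3 _) _]/= mon_cons [heps _]heps_mul heps_cvar mul0r mulr0.
Qed.

Lemma hat3_2_3 J : hat3 (on2_3 J) = pull2_3 (hat2 J).
Proof.
apply: serP => -[[r s] t] w; rewrite /pull2_3 /pull /on2_3.
elim: w J => [|[[i|i]|i] w IH] J.
- by rewrite /hat3 /= heps_mon mul1r.
- by rewrite /hat3 [pmap (@slot1 _) _]/= mon_cons [heps _]heps_mul heps_cvar !mul0r.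
- by rewrite -[RHS](IH (fun a b => J (hmul (x_ i) a) b)).
- by rewrite -[RHS](IH (fun a b => J a (hmul (x_ i) b))).
Qed.

Lemma hat3_1_3 J : hat3 (on1_3 J) = pull1_3 (hat2 J).
Proof.
apply: serP => -[[r s] t] w; rewrite /pull1_3 /pull /on1_3.
elim: w J => [|[[i|i]|i] w IH] J.
- by rewrite /hat3 /= heps_mon mulr1.
- by rewrite -[RHS](IH (fun a b => J (hmul (x_ i) a) b)).
- by rewrite /hat3 [pmap (@slot2 _) _]/= mon_cons [heps _]heps_mul heps_cvar mul0r mulr0.
- by rewrite -[RHS](IH (fun a b => J a (hmul (x_ i) b))).
Qed.

(** The counit in the third leg of [on1_2 K] absorbs the coproduct of c. The cocycle identity thus
    becomes an equation in the convolution algebra of the triple tensor product. *)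
Lemma cocycle_lhs J K a b c : biform J -> biform K ->
  conv3 (on12_3 J) (on1_2 K) a b c =
  \sum_(p <- hcop a) \sum_(q <- hcop b) J (hmul p.1 q.1) c * K p.2 q.2.
Proof.
move=> [_ Jr] bK; apply: eq_bigr => p _; apply: eq_bigr => q _.
rewrite -(hcop_epsr_form c (Jr (hmul p.1 q.1))) mulr_suml; apply: eq_bigr => r _.
by rewrite /on12_3 /on1_2; ring.
Qed.

Lemma cocycle_rhs J K a b c : biform J -> biform K ->
  conv3 (on1_23 J) (on2_3 K) a b c =
  \sum_(q <- hcop b) \sum_(r <- hcop c) J a (hmul q.1 r.1) * K q.2 r.2.
Proof.
move=> [Jl _] bK; rewrite /conv3 exchange_big; apply: eq_bigr => q _.
rewrite exchange_big; apply: eq_bigr => r _ /=.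
rewrite -(hcop_epsr_form a (Jl (hmul q.1 r.1))) mulr_suml; apply: eq_bigr => p _.
by rewrite /on1_23 /on2_3; ring.
Qed.

Definition cocycle_ser (F : ser k X2 I2) :=
  pull12_3 F * pull1_2 F = pull1_23 F * pull2_3 F.

Lemma cocycle_hat2 J : biform J ->
  (forall a b c,
    \sum_(p <- hcop a) \sum_(q <- hcop b) J (hmul p.1 q.1) c * J p.2 q.2 =
    \sum_(q <- hcop b) \sum_(r <- hcop c) J a (hmul q.1 r.1) * J q.2 r.2) <->
  cocycle_ser (hat2 J).
Proof.
move=> bJ; have [[t1 t2 _] [t3 t4 _]] := triform_on bJ.
rewrite /cocycle_ser -hat3_12_3 -hat3_1_2 -hat3_1_23 -hat3_2_3 -!hat3_conv //.
split=> [e|/hat3_inj e a b c].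
  congr hat3; apply/funext => a; apply/funext => b; apply/funext => c.
  by rewrite cocycle_lhs // cocycle_rhs.
rewrite -cocycle_lhs // -cocycle_rhs // e //; exact: triform_conv3.
Qed.

Definition restr1 : ser k X2 I2 -> ser k X I := pull (fun t => (t, 0)) (fun i => Some (inl i)).
Definition restr2 : ser k X2 I2 -> ser k X I := pull (fun t => (0, t)) (fun i => Some (inr i)).

Lemma hat1_restr1 J : hat1 (fun a => J a (hone H)) = restr1 (hat2 J).
Proof.
apply: serP => t w; rewrite /restr1 /pull; elim: w J => [|i w IH] J.
  by rewrite /hat1 /hat2 -(mon0 C).
by rewrite -[RHS](IH (fun a b => J (hmul (x_ i) a) b)).
Qed.

Lemma hat1_restr2 J : hat1 (fun a => J (hone H) a) = restr2 (hat2 J).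
Proof.
apply: serP => t w; rewrite /restr2 /pull; elim: w J => [|i w IH] J.
  by rewrite /hat1 /hat2 -(mon0 C).
by rewrite -[RHS](IH (fun a b => J a (hmul (x_ i) b))).
Qed.

End Dictionary3.

(** * Invariant cocycles and their logarithms *)

Section Cocycles.
Variables (k : fieldType) (G : affine_group k) (X : nmodType) (I : eqType).
Variable C : coords G X I.
Local Notation H := (coord_alg G).
Local Notation mon := (mon C).
Local Notation hat1 := (hat1 C).
Local Notation hat2 := (hat2 C).
Local Notation hat3 := (hat3 C).
Implicit Types (a b c : H) (phi psi x y : H -> k) (J K : H -> H -> k).

Lemma convC J K : biform J -> biform K -> conv J K = conv K J.
Proof.
move=> bJ bK; apply: (hat2_inj (C := C)); try exact: biform_conv.
by rewrite !hat2_conv // mulrC.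
Qed.

Lemma convA J K L : biform J -> biform K -> biform L ->
  conv J (conv K L) = conv (conv J K) L.
Proof.
move=> bJ bK bL; apply: (hat2_inj (C := C)); try by do ?apply: biform_conv.
by rewrite !hat2_conv ?mulrA //; apply: biform_conv.
Qed.

Lemma conv1l J : biform J -> conv (conv_one H) J = J.
Proof.
move=> bJ; have b1 := @biform_one _ G; apply: (hat2_inj (C := C)) => //.
  exact: biform_conv.
by rewrite hat2_conv // hat2_one mul1r.
Qed.

Lemma conv1C x y : scalar x -> scalar y -> conv1 x y = conv1 y x.
Proof.
move=> lx ly; apply: (hat1_inj (C := C)); try exact: conv1_scalar.
by rewrite !hat1_conv // mulrC.
Qed.

Lemma is_inv2E J K : biform J -> is_inv2 J K <-> biform K /\ hat2 J * hat2 K = 1.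
Proof.
move=> bJ; split=> [[bK JK _]|[bK JK]].
  by split=> //; rewrite -hat2_conv // JK hat2_one.
have E : conv J K = conv_one H.
  apply: (hat2_inj (C := C)); [exact: biform_conv | exact: biform_one |].
  by rewrite hat2_conv // JK hat2_one.
by split=> //; rewrite convC.
Qed.

Lemma is_inv1E x y : scalar x -> is_inv1 x y <-> scalar y /\ hat1 x * hat1 y = 1.
Proof.
move=> lx; split=> [[ly xy _]|[ly xy]].
  by split=> //; rewrite -hat1_conv // xy hat1_eps.
have E : conv1 x y = @heps k H.
  apply: (hat1_inj (C := C)); [exact: conv1_scalar | exact: heps_scalar |].
  by rewrite hat1_conv // xy hat1_eps.
by split=> //; rewrite conv1C.
Qed.

Lemma inv2P J : biform J -> (exists K, is_inv2 J K) ->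
  biform (inv2 J) /\ hat2 J * hat2 (inv2 J) = 1.
Proof. by move=> bJ ex; apply/is_inv2E => //; exact: (xgetPex 0 ex). Qed.

Lemma inv1P x : scalar x -> (exists y, is_inv1 x y) ->
  scalar (inv1 x) /\ hat1 x * hat1 (inv1 x) = 1.
Proof. by move=> lx ex; apply/is_inv1E => //; exact: (xgetPex 0 ex). Qed.

(** At a point z the product of O(G) becomes the form [ev z a * ev z b], and convolution of forms is
    commutative because shuffles are. *)
Lemma invariant_form J : biform J -> Defs.invariant J.
Proof.
move=> bJ; apply/funext => a; apply/funext => b; apply: regP => z.
have bz : biform (fun a b : H => ev z a * ev z b) by apply: biform_prod.
rewrite /convl /convr !ev_sum.
transitivity (conv J (fun a b => ev z a * ev z b) a b).
  by apply: eq_bigr => p _; rewrite ev_sum; apply: eq_bigr => q _; rewrite evZ.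
rewrite convC //; apply: eq_bigr => p _; rewrite ev_sum; apply: eq_bigr => q _.
by rewrite evZ mulrC.
Qed.

Definition zseries (F : ser k (X * X) (I + I)) :=
  [/\ cocycle_ser F, restr1 F = 1 & restr2 F = 1].

Lemma Z2invE J : @Z2inv k H J <->
  [/\ biform J, exists2 K, biform K & hat2 J * hat2 K = 1 & zseries (hat2 J)].
Proof.
split=> [[[bJ [K KP] cJ rJ lJ] _]|[bJ [K bK JK] [cJ r1 r2]]].
  split=> //; first by exists K; have /is_inv2E[] := KP.
  split; first exact/cocycle_hat2.
    rewrite -hat1_restr1 -(hat1_eps C); congr hat1; exact/funext.
  rewrite -hat1_restr2 -(hat1_eps C); congr hat1; exact/funext.
split; last exact: invariant_form.
have [Jl Jr] := bJ; split=> //; first by exists K; apply/is_inv2E.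
- exact: (cocycle_hat2 C bJ).2 cJ.
- suff e : (fun a => J a (hone H)) = @heps k H by move=> a; rewrite -e.
  by apply: (hat1_inj (C := C)); [exact: Jl | exact: heps_scalar | rewrite hat1_restr1 hat1_eps].
- suff e : (fun a => J (hone H) a) = @heps k H by move=> a; rewrite -e.
  by apply: (hat1_inj (C := C)); [exact: Jr | exact: heps_scalar | rewrite hat1_restr2 hat1_eps].
Qed.

Lemma hopf_2cocycle_Z2inv J : hopf_2cocycle H J -> @Z2inv k H J.
Proof. by move=> cJ; split=> //; apply: invariant_form; case: cJ. Qed.

Lemma zseriesM F F' : zseries F -> zseries F' -> zseries (F * F').
Proof.
move=> [c r1 r2] [c' r1' r2']; split.
- by rewrite /cocycle_ser /pull12_3 /pull1_2 /pull1_23 /pull2_3 !pullM mulrACA [RHS]mulrACA; congr (_ * _).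
- by rewrite /restr1 pullM; rewrite /restr1 in r1 r1'; rewrite r1 r1' mulr1.
- by rewrite /restr2 pullM; rewrite /restr2 in r2 r2'; rewrite r2 r2' mulr1.
Qed.

Lemma zseriesV F F' : F * F' = 1 -> zseries F -> zseries F'.
Proof.
move=> FF' [c r1 r2].
have pV (Y : Type) (L : Type) g h : @pull k Y _ L _ g h F * @pull k Y _ L _ g h F' = 1.
  by rewrite -pullM FF' pull_one.
split.
- have := c; rewrite /cocycle_ser => /(congr1 (fun Z => Z * (pull12_3 F' * pull1_2 F') * (pull1_23 F' * pull2_3 F'))).
  have -> : pull12_3 F * pull1_2 F * (pull12_3 F' * pull1_2 F') = 1.
    by rewrite mulrACA !pV mulr1.
  rewrite [X in _ = X -> _]mulrAC.
  have -> : pull1_23 F * pull2_3 F * (pull1_23 F' * pull2_3 F') = 1.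
    by rewrite mulrACA !pV mulr1.
  by rewrite !mul1r => ->.
- by have := pV X I (fun t => (t, 0)) (fun i => Some (inl i)); rewrite -/(restr1 F) r1 mul1r.
- by have := pV X I (fun t => (0, t)) (fun i => Some (inr i)); rewrite -/(restr2 F) r2 mul1r.
Qed.

Lemma zseries1 : zseries 1.
Proof. by split; rewrite /cocycle_ser /restr1 /restr2 /pull12_3 /pull1_2 /pull1_23 /pull2_3 !pull_one. Qed.

(** The coboundary of x, with y in the role of its inverse. *)
Definition cobs (x y : ser k X I) := pullmul x * (pull1 y * pull2 y).

Lemma cobs_M (x y x' y' : ser k X I) : cobs (x * x') (y * y') = cobs x y * cobs x' y'.
Proof. by rewrite /cobs /pullmul /pull1 /pull2 !pullM; ring. Qed.

Lemma cobs1 : cobs 1 1 = 1.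
Proof. by rewrite /cobs /pullmul /pull1 /pull2 !pull_one !mulr1. Qed.

Lemma hat2_cobound x : scalar x -> (exists y, is_inv1 x y) ->
  biform (cobound x) /\ hat2 (cobound x) = cobs (hat1 x) (hat1 (inv1 x)).
Proof.
move=> lx ex; have [ly xy] := inv1P lx ex; set y := inv1 x in ly xy *.
have -> : cobound x = conv (fun a b => x (hmul a b)) (fun a b => y a * y b).
  apply/funext => a; apply/funext => b; apply: eq_bigr => p _; apply: eq_bigr => q _.
  by rewrite -/y mulrA.
have bx := biform_mul lx; have by_ := biform_prod ly ly.
by split; [apply: biform_conv | rewrite hat2_conv // hat2_mul hat2_prod].
Qed.

Lemma restr1M (u v : ser k (X * X) (I + I)) : restr1 (u * v) = restr1 u * restr1 v.
Proof. exact: pullM. Qed.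

Lemma restr2M (u v : ser k (X * X) (I + I)) : restr2 (u * v) = restr2 u * restr2 v.
Proof. exact: pullM. Qed.

Lemma zseries_cobs x y : scalar x -> scalar y -> hat1 x * hat1 y = 1 ->
  x (hone H) = 1 -> zseries (cobs (hat1 x) (hat1 y)).
Proof.
move=> lx ly xy x1.
have y1 : y (hone H) = 1.
  have := congr1 (fun F => F 0 [::]) xy; rewrite serM0 /hat1 -/(mon) mon0 x1 mul1r => ->.
  by rewrite ser1.
(* The cocycle identity reads x(abc) y(ab) y(c) x(ab) y(a) y(b) = x(abc) y(a) y(bc) x(bc) y(b) y(c).
   The facts [e1] to [e6] identify equal factors; [i1] and [i2] cancel x(ab) y(ab) and x(bc)
   y(bc). *)
have e1 : pull12_3 (pullmul (hat1 x)) = pull1_23 (pullmul (hat1 x)).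
  rewrite -hat2_mul -hat3_12_3 -hat3_1_23; congr hat3.
  by apply/funext => a; apply/funext => b; apply/funext => c; rewrite /on12_3 /on1_23 hmul_assoc.
have e2 : pull12_3 (pull1 (hat1 y)) = pull1_2 (pullmul (hat1 y)).
  by rewrite -hat2_mul -hat2_pull1 -hat3_12_3 -hat3_1_2.
have e3 : pull12_3 (pull2 (hat1 y)) = pull2_3 (pull2 (hat1 y)).
  rewrite -hat2_pull2 -hat3_12_3 -hat3_2_3; congr hat3.
  by apply/funext => a; apply/funext => b; apply/funext => c; rewrite /on12_3 /on2_3 heps_mul mulrA.
have e4 : pull1_2 (pull1 (hat1 y)) = pull1_23 (pull1 (hat1 y)).
  rewrite -hat2_pull1 -hat3_1_23 -hat3_1_2; congr hat3.
  by apply/funext => a; apply/funext => b; apply/funext => c; rewrite /on1_2 /on1_23 heps_mul mulrA.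
have e5 : pull1_2 (pull2 (hat1 y)) = pull2_3 (pull1 (hat1 y)).
  rewrite -hat2_pull1 -hat2_pull2 -hat3_2_3 -hat3_1_2; congr hat3.
  by apply/funext => a; apply/funext => b; apply/funext => c; rewrite /on1_2 /on2_3 mulrA.
have e6 : pull1_23 (pull2 (hat1 y)) = pull2_3 (pullmul (hat1 y)).
  by rewrite -hat2_mul -hat2_pull2 -hat3_1_23 -hat3_2_3.
have i1 : pull1_2 (pullmul (hat1 x)) * pull1_2 (pullmul (hat1 y)) = 1.
  by rewrite /pull1_2 /pullmul -!pullM xy !pull_one.
have i2 : pull2_3 (pullmul (hat1 x)) * pull2_3 (pullmul (hat1 y)) = 1.
  by rewrite /pull2_3 /pullmul -!pullM xy !pull_one.
split.
- rewrite /cocycle_ser /cobs.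
  have M (P : ser k (X * X) (I + I) -> ser k (X * X * X) (I + I + I)) u v w :
    (forall u v, P (u * v) = P u * P v) -> P (u * (v * w)) = P u * (P v * P w).
    by move=> PM; rewrite !PM.
  rewrite !M; try (by move=> *; exact: pullM).
  rewrite e1 e2 e3 e4 e5 e6.
  transitivity (pull1_23 (pullmul (hat1 x)) * pull1_23 (pull1 (hat1 y)) *
    pull2_3 (pull1 (hat1 y)) * pull2_3 (pull2 (hat1 y)) *
    (pull1_2 (pullmul (hat1 x)) * pull1_2 (pullmul (hat1 y)))); first by ring.
  by rewrite i1 -i2; ring.
- rewrite /cobs !restr1M -hat2_mul -hat2_pull1 -hat2_pull2 -!hat1_restr1.
  rewrite -[RHS]xy; congr (_ * _).
    by congr hat1; apply/funext => a; rewrite hmul1r.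
  have -> : (fun a => heps a * y (hone H)) = @heps k H by apply/funext => a; rewrite y1 mulr1.
  rewrite hat1_eps mulr1; congr hat1; apply/funext => a.
  by rewrite heps_one mulr1.
- rewrite /cobs !restr2M -hat2_mul -hat2_pull1 -hat2_pull2 -!hat1_restr2.
  rewrite -[RHS]xy; congr (_ * _).
    by congr hat1; apply/funext => a; rewrite hmul1l.
  have -> : (fun a => y (hone H) * heps a) = @heps k H by apply/funext => a; rewrite y1 mul1r.
  rewrite hat1_eps mul1r; congr hat1; apply/funext => a.
  by rewrite heps_one mul1r.
Qed.

Lemma hat2_inv_biform J K : biform J -> biform K -> hat2 J * hat2 K = 1 ->
  conv J K = conv_one H.
Proof. by move=> bJ bK JK; have /(_ (conj bK JK))[] := (is_inv2E K bJ).2. Qed.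

(** Commutativity of convolution supplies centrality. The condition x(1) = 1 matches the
    normalization of J, since J(1,1) = x(1) y(1)^2 and x(1) y(1) = 1. *)
Lemma B2invE J : @B2inv k H J <-> biform J /\ exists x y,
  [/\ scalar x, scalar y, hat1 x * hat1 y = 1, x (hone H) = 1 &
      hat2 J = cobs (hat1 x) (hat1 y)].
Proof.
split=> [[ZJ [x [lx ex _ JE]]]|[bJ [x [y [lx ly xy x1 JE]]]]].
  have [bJ _ _] := (Z2invE J).1 ZJ; split=> //.
  have [ly xy] := inv1P lx ex; exists x, (inv1 x); split=> //; last first.
    by have [_ <-] := hat2_cobound lx ex; rewrite JE.
  have xy1 : x (hone H) * inv1 x (hone H) = 1.
    by have := congr1 (fun F => F 0 [::]) xy; rewrite serM0 /hat1 mon0.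
  have := h2_normr ZJ.1 (hone H); rewrite heps_one -(mon0 C) => e.
  have : hat2 J (0, 0) [::] = 1 by rewrite -[LHS]/(J (mon 0 [::]) (mon 0 [::])) e.
  have [_ E] := hat2_cobound lx ex; rewrite JE E /cobs !serM0 /pullmul /pull1 /pull2 !pull0 /= addr0 /hat1 mon0.
  by rewrite mulrA xy1 mul1r => iy; rewrite iy mulr1 in xy1.
have ex : exists y, is_inv1 x y by exists y; apply/is_inv1E.
have [bc cE] := hat2_cobound lx ex.
have iE : hat1 (inv1 x) = hat1 y.
  have [li xi] := inv1P lx ex.
  by rewrite -[LHS]mulr1 -xy mulrA [hat1 (inv1 x) * _]mulrC xi mul1r.
have JcE : J = cobound x by apply: (hat2_inj (C := C) bJ bc); rewrite cE JE iE.
split.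
  apply/Z2invE; split=> //; last by rewrite JE; apply: zseries_cobs.
  exists (conv (fun a b => y (hmul a b)) (fun a b => x a * x b)).
    by apply: biform_conv; [apply: biform_mul | apply: biform_prod].
  rewrite hat2_conv; [|exact: biform_mul|exact: biform_prod].
  by rewrite hat2_mul hat2_prod // JE -/(cobs _ _) -cobs_M xy mulrC xy cobs1.
exists x; split=> //; move=> z lz; exact: conv1C.
Qed.

Lemma Z2invM J K : @Z2inv k H J -> @Z2inv k H K -> @Z2inv k H (conv J K).
Proof.
move=> /Z2invE[bJ [J' bJ' JJ'] zJ] /Z2invE[bK [K' bK' KK'] zK].
apply/Z2invE; split; first exact: biform_conv.
  exists (conv J' K'); first exact: biform_conv.
  by rewrite !hat2_conv // mulrACA JJ' KK' mulr1.
by rewrite hat2_conv //; apply: zseriesM.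
Qed.

Lemma B2invM J K : @B2inv k H J -> @B2inv k H K -> @B2inv k H (conv J K).
Proof.
move=> /B2invE[bJ [x [y [lx ly xy x1 JE]]]] /B2invE[bK [x' [y' [lx' ly' xy' x1' KE]]]].
apply/B2invE; split; first exact: biform_conv.
exists (conv1 x x'), (conv1 y y'); split; try exact: conv1_scalar.
- by rewrite !hat1_conv // mulrACA xy xy' mulr1.
- rewrite /conv1 (hcop_one (biform_prod lx lx')) x1 x1' mulr1 //.
- by rewrite hat2_conv // !hat1_conv // JE KE cobs_M.
Qed.

Lemma Z2inv1 : @Z2inv k H (conv_one H).
Proof.
have b1 := @biform_one _ G.
apply/Z2invE; split=> //; last by rewrite hat2_one; apply: zseries1.
by exists (conv_one H); rewrite // hat2_one mulr1.
Qed.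

Lemma B2inv1 : @B2inv k H (conv_one H).
Proof.
apply/B2invE; split; first exact: biform_one.
by exists (@heps k H), (@heps k H); rewrite hat1_eps hat2_one cobs1 mulr1; split.
Qed.

Lemma Z2inv_inv J : @Z2inv k H J -> exists K,
  [/\ @Z2inv k H K, conv J K = conv_one H, conv K J = conv_one H & hat2 J * hat2 K = 1].
Proof.
move=> /Z2invE[bJ [K bK JK] zJ]; exists K.
have e := hat2_inv_biform bJ bK JK; split=> //; last by rewrite convC.
apply/Z2invE; split=> //; first by exists J; rewrite // mulrC.
exact: zseriesV JK zJ.
Qed.

Lemma H2inv_group : is_quot_group (H2inv H).
Proof.
have b (J : H -> H -> k) : @Z2inv k H J -> biform J by move=> /Z2invE[].
split=> //=.
- exact: Z2inv1.
- exact: Z2invM.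
- by move=> x y z zx zy zz; apply: convA; apply: b.
- by move=> x zx; apply: conv1l; apply: b.
- by move=> x zx; rewrite convC; [apply: conv1l | exact: b | exact: biform_one]; exact: b.
- move=> J zJ; have [K [zK JK KJ JKh]] := Z2inv_inv zJ; exists K; split=> //.
  move=> /B2invE[bJ [x [y [lx ly xy x1 JE]]]]; apply/B2invE; split; first exact: b.
  exists y, x; split=> //; first by rewrite mulrC.
    have := congr1 (fun F => F 0 [::]) xy; rewrite serM0 /hat1 mon0 x1 mul1r => ->.
    by rewrite ser1.
  have e1 : cobs (hat1 y) (hat1 x) * hat2 J = 1.
    by rewrite JE -cobs_M [hat1 y * _]mulrC xy cobs1.
  by rewrite -[LHS]mul1r -e1 -mulrA JKh mulr1.
- by move=> J [].
- exact: B2inv1.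
- exact: B2invM.
- move=> x n zx bn; exists n => //; apply: convC; [apply: b | exact: b].
  by case: bn.
Qed.

End Cocycles.

(** * Exponentials and logarithms of bilinear forms *)

Section ExpLogForms.
Variables (k : fieldType) (char0 : [pchar k] =i pred0).
Variables (G : affine_group k) (X : nmodType) (I : eqType).
Variable C : coords G X I.
Local Notation H := (coord_alg G).
Local Notation mon := (mon C).
Local Notation hat1 := (hat1 C).
Local Notation hat2 := (hat2 C).
Local Notation hat3 := (hat3 C).
Implicit Types (a b c : H) (phi psi x y : H -> k) (J K f z : H -> H -> k).

Lemma fin_seriesE (u : nat -> k) N : (forall n, (N <= n)%N -> u n = 0) ->
  fin_series u = \sum_(n < N) u n.
Proof.
move=> uN.
have sE M : (N <= M)%N -> \sum_(n < M) u n = \sum_(n < N) u n.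
  move=> le; rewrite -!(big_mkord xpredT u) (big_cat_nat (n := N)) //=.
  by rewrite [X in _ + X]big_nat [X in _ + X]big1 ?addr0 // => n /andP[/uN].
have ex : exists v, exists N, forall M, (N <= M)%N -> \sum_(n < M) u n = v.
  by exists (\sum_(n < N) u n), N.
have /= [M MP] := xgetPex 0 ex.
by rewrite -(sE (maxn N M)) ?leq_maxl // [RHS](MP _ (leq_maxr N M)).
Qed.

Section Series.
Variable u : nat -> H -> H -> k.
Hypotheses (bu : forall n, biform (u n)) (ou : forall n, ordge (hat2 (u n)) n).

(** On two monomials the terms vanish beyond their total length, and each pair of elements involves
    finitely many monomials. *)
Lemma series_locally_finite a b :
  exists N, forall n, (N <= n)%N -> u n a b = 0.
Proof.
move: a b; apply: (mon_span_ind (C := C)).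
- move=> t a a' Pa Pa' b; have [N NP] := Pa b; have [N' NP'] := Pa' b.
  exists (maxn N N') => n; rewrite geq_max => /andP[le le'].
  by have [ul _] := bu n; rewrite ul NP // NP' //= mulr0 addr0.
- by move=> b; exists 0%N => n _; have [ul _] := bu n; rewrite (linf0 (ul b)).
- move=> s w; apply: (mon_span_ind (C := C)).
  + move=> t a a' [N NP] [N' NP'].
    exists (maxn N N') => n; rewrite geq_max => /andP[le le'].
    by have [_ ur] := bu n; rewrite ur NP // NP' //= mulr0 addr0.
  + by exists 0%N => n _; have [_ ur] := bu n; rewrite (linf0 (ur _)).
  + move=> t v; exists (size w + size v).+1 => n lt.
    by rewrite -hat2_mon ou // size_cat !size_map.
Qed.

Definition series_form a b := fin_series (fun n => u n a b).

Lemma biform_series : biform series_form.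
Proof.
have D a b a' b' a'' b'' (t : k) :
   (forall n, u n a b = t * u n a' b' + u n a'' b'') ->
   series_form a b = t * series_form a' b' + series_form a'' b''.
  move=> uE; have [N NP] := series_locally_finite a' b'.
  have [N' NP'] := series_locally_finite a'' b''.
  have E n : (maxn N N' <= n)%N -> u n a' b' = 0 /\ u n a'' b'' = 0.
    by rewrite geq_max => /andP[le le']; rewrite NP ?NP'.
  rewrite /series_form !(@fin_seriesE _ (maxn N N')); try by move=> n /E[].
    by rewrite mulr_sumr -big_split; apply: eq_bigr => n _.
  by move=> n /E[e e']; rewrite uE e e' mulr0 addr0.
split=> [b|a] t v w /=; apply: D => n; have [ul ur] := bu n.
  exact: ul.
exact: ur.
Qed.

Lemma hat2_series : hat2 series_form = ser_lim (fun n => hat2 (u n)).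
Proof.
apply: serP => t w; apply: (@fin_seriesE (fun n => hat2 (u n) t w)) => n lt.
exact: (@ou n t w lt).
Qed.

End Series.

Lemma conv_powE z n : biform z -> biform (conv_pow z n) /\ hat2 (conv_pow z n) = hat2 z ^+ n.
Proof.
move=> bz; elim: n => [|n [IH IHe]] /=; first by rewrite hat2_one; split=> //; apply: biform_one.
by split; [apply: biform_conv | rewrite hat2_conv // IHe exprS].
Qed.

(** The values on pairs of characters are the constant terms of [hat2 f]; without them the
    exponential series is locally finite. *)
Definition vanish f := forall s t, f (cch C s) (cch C t) = 0.

Lemma vanishP f : vanish f <-> ordge (hat2 f) 1.
Proof.
split=> [fv|fv s t]; first by apply: ordge1 => -[s t]; apply: fv.
exact: (fv (s, t) [::]).
Qed.

Lemma hat2Z t f : hat2 (fun a b => t * f a b) = scale_ser t (hat2 f). Proof. by []. Qed.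
Lemma hat2D f g : hat2 (fun a b => f a b + g a b) = hat2 f + hat2 g. Proof. by []. Qed.
Lemma hat2N f : hat2 (fun a b => - f a b) = - hat2 f. Proof. by []. Qed.
Lemma hat2B f g : hat2 (fun a b => f a b - g a b) = hat2 f - hat2 g. Proof. by []. Qed.

Lemma conv_expE z : biform z -> vanish z ->
  biform (conv_exp H z) /\ hat2 (conv_exp H z) = ser_exp (hat2 z).
Proof.
move=> bz /vanishP z1; pose u n := fun a b => (n`!%:R)^-1 * conv_pow z n a b.
have bu n : biform (u n) by apply/biformZ; have [] := conv_powE n bz.
have uE n : hat2 (u n) = scale_ser (n`!%:R)^-1 (hat2 z ^+ n).
  by rewrite hat2Z; have [_ ->] := conv_powE n bz.
have ou n : ordge (hat2 (u n)) n by rewrite uE; apply/ordgeZ/ordgeX.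
split; first exact: (biform_series bu ou).
by rewrite [LHS](hat2_series ou); congr ser_lim; apply/funext => n.
Qed.

Lemma conv_logE J : biform J -> (forall t, hat2 J t [::] = 1) ->
  biform (conv_log J) /\ hat2 (conv_log J) = ser_log (hat2 J).
Proof.
move=> bJ J1; pose u n := fun a b => (-1) ^+ n / n.+1%:R * conv_pow (J - conv_one H) n.+1 a b.
have bJ1 : biform (J - conv_one H) by apply: (biformD bJ (biformN (@biform_one _ G))).
have J1E : hat2 (J - conv_one H) = hat2 J - 1 by rewrite [LHS]hat2B hat2_one.
have bu n : biform (u n) by apply/biformZ; have [] := conv_powE n.+1 bJ1.
have uE n : hat2 (u n) = scale_ser ((-1) ^+ n / n.+1%:R) ((hat2 J - 1) ^+ n.+1).
  by rewrite hat2Z; have [_ ->] := conv_powE n.+1 bJ1; rewrite J1E.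
have ou n : ordge (hat2 (u n)) n.
  rewrite uE; apply/ordgeZ/(ordge_le (leqnSn n))/ordgeX/ordge1 => t.
  by rewrite serB J1 ser1 subrr.
split; first exact: (biform_series bu ou).
by rewrite [LHS](hat2_series ou); congr ser_lim; apply/funext => n.
Qed.

(** A Hochschild 2-cocycle of the algebra O(G) with values in k, on which both actions are through
    the counit. This is the multiplicative cocycle identity after taking logarithms. *)
Definition addcocycle f := forall a b c,
  f (hmul a b) c + f a b * heps c = f a (hmul b c) + heps a * f b c.

Lemma triformD (S T : H -> H -> H -> k) : triform S -> triform T ->
  triform (fun a b c => S a b c + T a b c).
Proof. by move=> [S1 S2 S3] [T1 T2 T3]; split=> u v; apply: scalar_add. Qed.

Lemma addcocycleE f : biform f -> addcocycle f <->
  pull12_3 (hat2 f) + pull1_2 (hat2 f) = pull1_23 (hat2 f) + pull2_3 (hat2 f).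
Proof.
move=> bf; have [[t1 t2 _] [t3 t4 _]] := triform_on bf.
rewrite -hat3_12_3 -hat3_1_2 -hat3_1_23 -hat3_2_3.
have hD S T : hat3 S + hat3 T = hat3 (fun a b c => S a b c + T a b c) by [].
rewrite !hD; split=> [e|/hat3_inj e a b c].
  congr hat3; apply/funext => a; apply/funext => b; apply/funext => c.
  exact: e.
have := e (triformD t1 t3) (triformD t2 t4).
by move=> /(congr1 (fun F => F a b c)).
Qed.

Lemma addcocycle_norm f : vanish f -> addcocycle f ->
  (forall a, f a (hone H) = 0) /\ (forall a, f (hone H) a = 0).
Proof.
move=> fv fc; have f11 : f (hone H) (hone H) = 0 by rewrite -(cch0 C).
split=> a.
  have := fc a (hone H) (hone H); rewrite !hmul1r heps_one mulr1 f11 mulr0.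
  by move/addrI.
have := fc (hone H) (hone H) a; rewrite !hmul1l heps_one mul1r f11 mul0r addr0.
by rewrite -{1}[f _ a]addr0 => /addrI.
Qed.

(** Exp commutes with the pullbacks and turns their sums into products. Normalization holds because
    an additive cocycle that vanishes on characters vanishes when one argument is the unit. *)
Lemma exp_Z2inv f : biform f -> vanish f -> addcocycle f -> @Z2inv k H (conv_exp H f).
Proof.
move=> bf fv fc; have [be eE] := conv_expE bf fv; have f1 := (vanishP f).1 fv.
have fvN : vanish (fun a b => - f a b) by move=> s t; rewrite fv oppr0.
have [beN eNE] := conv_expE (biformN bf) fvN.
have [r1 r2] := addcocycle_norm fv fc.
apply: (Z2invE C _).2; split=> //.
  by exists (conv_exp H (fun a b => - f a b)); rewrite // eE eNE hat2N ser_expV.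
rewrite eE; split.
- have fc' := (addcocycleE bf).1 fc; rewrite /cocycle_ser.
  rewrite /pull12_3 /pull1_2 /pull1_23 /pull2_3 !pull_exp // -!ser_expD //; try exact: ordge_pull1.
  by congr ser_exp.
- rewrite /restr1 pull_exp // -/(restr1 _) -hat1_restr1.
  rewrite (_ : hat1 _ = 0) ?ser_exp_0 //; apply: serP => t w; exact: r1.
- rewrite /restr2 pull_exp // -/(restr2 _) -hat1_restr2.
  rewrite (_ : hat1 _ = 0) ?ser_exp_0 //; apply: serP => t w; exact: r2.
Qed.

Definition normal_on_chars J := forall s t, J (cch C s) (cch C t) = 1.

Lemma log_addcocycle J : @Z2inv k H J -> normal_on_chars J ->
  [/\ biform (conv_log J), vanish (conv_log J), addcocycle (conv_log J),
      hat2 (conv_log J) = ser_log (hat2 J) & conv_exp H (conv_log J) = J].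
Proof.
move=> /(Z2invE C)[bJ _ [cJ _ _]] J1.
have J1' t : hat2 J t [::] = 1 by case: t => s t; exact: J1.
have [bl lE] := conv_logE bJ J1'.
have lv : vanish (conv_log J) by apply/vanishP; rewrite lE; apply: ordge_log.
have [be eE] := conv_expE bl lv.
split=> //.
  apply/addcocycleE => //; rewrite lE /pull12_3 /pull1_2 /pull1_23 /pull2_3 !pull_log //.
  by rewrite -!ser_logM //; try (by move=> t; rewrite pull0); congr ser_log.
by apply: (hat2_inj (C := C)) => //; rewrite eE lE ser_logK.
Qed.

End ExpLogForms.

(** * The two invariants of a cocycle: values on characters and alternation *)

Section Invariants.
Variables (k : fieldType) (char0 : [pchar k] =i pred0).
Variables (G : affine_group k) (X : nmodType) (I : eqType).
Variable C : coords G X I.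
Local Notation H := (coord_alg G).
Local Notation mon := (mon C).
Local Notation x_ := (cvar C).
Local Notation hat1 := (hat1 C).
Local Notation hat2 := (hat2 C).
Local Notation vanish := (vanish C).
Local Notation normal_on_chars := (normal_on_chars C).
Implicit Types (a b : H) (phi psi x y : H -> k) (J K f r : H -> H -> k).

(* If f were an ordinary additive 2-cocycle, a |-> f a (x_ i) would be the i-th
   partial derivative of a primitive g; symmetry of f makes it closed. *)
Lemma symmetric_addcocycle f : biform f -> vanish f -> addcocycle f ->
  (forall a b, f a b = f b a) ->
  exists g, [/\ scalar g, forall t, g (cch C t) = 0 &
    forall a b, f a b = g (hmul a b) - g a * heps b - heps a * g b].
Proof.
move=> bf fv fc fC; have [fl fr] := bf.
have key a b i : f a (hmul (x_ i) b) = f (hmul a b) (x_ i) - heps a * f b (x_ i).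
  have := fc a b (x_ i); rewrite heps_cvar mulr0 addr0 => ->.
  by rewrite addrK hmulC.
have closed i j a : f (hmul (x_ j) a) (x_ i) = f (hmul (x_ i) a) (x_ j).
  have := key a (x_ i) j; rewrite hmulC key.
  by rewrite (fC (x_ i) (x_ j)) => /addIr; rewrite ![hmul a _]hmulC.
pose g0 : ser k X I := fun t w => if w is i :: v then f (mon t v) (x_ i) else 0.
have sg : symser g0.
  move=> t; apply: symw_ind => [i w w' /= p|i j w] /=; first by rewrite (mon_perm _ _ p).
  by rewrite !mon_cons closed.
have [g lg gE] := c_ext C sg.
have gx i a : g (hmul (x_ i) a) = f a (x_ i).
  apply: (scalar_eq (C := C) (phi := fun a => g (hmul (x_ i) a)) (psi := f^~ (x_ i))).
  - exact: (scalar_comp lg (@hmul_linr _ _ _)).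
  - exact: fl.
  - by move=> t w; rewrite -mon_cons [LHS]gE.
exists g; split=> // [t|]; first exact: (gE t [::]).
pose h a b := g (hmul a b) - g a * heps b - heps a * g b.
have bh : biform h.
  apply: biformD; [apply: biformD|].
  - exact: biform_mul.
  - by apply/biformN/biform_prod.
  - by apply/biformN/biform_prod.
have hC a b : h a b = h b a by rewrite /h hmulC; ring.
have fx a b i : f a (hmul (x_ i) b) = h a (hmul (x_ i) b).
  by rewrite key /h heps_mul heps_cvar mul0r mulr0 subr0 hmulCA !gx.
(* By [fx] the forms agree if the second argument contains a variable, by symmetry if the first
   does. On two characters both are 0. *)
suff fh : f = h by move=> a b; rewrite fh.
apply: (biform_eq (C := C)) => // s u t [|i v]; last by rewrite !mon_cons fx.
case: u => [|i u]; last by rewrite fC hC !mon_cons fx.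
rewrite [LHS]fv /h mon_mul !(gE _ [::]) /=.
by rewrite mul0r mulr0 !subr0.
Qed.

(** The form exp f is the coboundary of exp g, with inverse exp(-g). These exponentials are built as
    series and return to linear forms by [c_ext], since exp preserves symmetry. *)
Lemma exp_coboundary f g : biform f -> vanish f -> scalar g -> (forall t, g (cch C t) = 0) ->
  (forall a b, f a b = g (hmul a b) - g a * heps b - heps a * g b) ->
  @B2inv k H (conv_exp H f).
Proof.
move=> bf fv lg g0 fE; have [be eE] := conv_expE bf fv.
have g1 : ordge (hat1 g) 1 by apply: ordge1.
have sg : symser (hat1 g) by move=> t w w' p; rewrite /hat1 (mon_perm _ _ p).
have [x lx xE] := c_ext C (symser_exp sg).
have [y ly yE] := c_ext C (symser_exp (symserN sg)).
have hx : hat1 x = ser_exp (hat1 g) by apply: serP => t w; apply: xE.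
have hy : hat1 y = ser_exp (- hat1 g) by apply: serP => t w; apply: yE.
apply: (B2invE C _).2; split=> //; exists x, y; split=> //.
- by rewrite hx hy ser_expV.
- by rewrite -(mon0 C) xE ser_exp0.
rewrite eE hx hy /cobs /pullmul /pull1 /pull2 !pull_exp //; try exact: ordgeN.
have fh : hat2 f = pullmul (hat1 g) - pull1 (hat1 g) - pull2 (hat1 g).
  rewrite -hat2_mul -hat2_pull1 -hat2_pull2 -!hat2B; congr hat2.
  by apply/funext => a; apply/funext => b; rewrite fE.
rewrite fh -!ser_expD //; try (by apply: ordge_pull1 => //; apply: ordgeN).
  by congr ser_exp; rewrite !pullN addrA.
by apply: ordgeD; apply: ordge_pull1; apply: ordgeN.
Qed.

Lemma B2inv_sym J : @B2inv k H J -> flip2 J = J.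
Proof.
move=> /(B2invE C)[bJ [x [y [lx ly xy x1 JE]]]].
apply: (hat2_inj (C := C)) => //; first exact: biform_flip.
rewrite hat2_flip JE /cobs /pullflip !pullM -!/(pullflip _).
rewrite -hat2_mul -hat2_pull1 -hat2_pull2 -!hat2_flip.
congr (_ * _); first by congr hat2; apply/funext => a; apply/funext => b; rewrite /flip2 hmulC.
rewrite [RHS]mulrC; congr (_ * _); congr hat2.
  by apply/funext => a; apply/funext => b; rewrite /flip2 mulrC.
by apply/funext => a; apply/funext => b; rewrite /flip2 mulrC.
Qed.

Definition antisym r := forall a b, r a b = - r b a.
Definition biderivation r := forall a b c : H,
  r (hmul a b) c = heps a * r b c + heps b * r a c.

(* The forms r arising as f - f_21 for an additive cocycle f vanishing on
   characters, i.e. (see alternator_wedge) the elements of a /\ a_u. *)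
Definition alternator r := [/\ biform r, vanish r, antisym r & biderivation r].

Lemma alternator_addcocycle f : biform f -> vanish f -> addcocycle f ->
  alternator (fun a b => f a b - f b a).
Proof.
move=> bf fv fc; split.
- exact: (biformD bf (biformN (biform_flip bf))).
- by move=> s t; rewrite !fv subrr.
- by move=> a b; rewrite opprB.
move=> a b c; have e1 := fc c a b; have e2 := fc a c b; have e3 := fc a b c.
rewrite [hmul c a]hmulC in e1; rewrite [hmul c b]hmulC in e2.
apply/eqP; rewrite -subr_eq0; apply/eqP.
(* The defect of the biderivation rule is the cocycle identity at (a, b, c), plus the one at (c, a,
   b), minus the one at (a, c, b). *)
transitivity
 ((f (hmul a b) c + f a b * heps c - (f a (hmul b c) + heps a * f b c))
  + (f (hmul a c) b + f c a * heps b - (f c (hmul a b) + heps c * f a b))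
  - (f (hmul a c) b + f a c * heps b - (f a (hmul b c) + heps a * f c b))).
  ring.
by rewrite e1 e2 e3; ring.
Qed.

(** The biderivation rule in both arguments gives the cocycle identity term by term; the factor 1/2
    is chosen so that the antisymmetrization of r/2 is r. *)
Lemma addcocycle_alternator r : alternator r -> addcocycle (fun a b => r a b / 2%:R).
Proof.
move=> [br _ ra rd] a b c; rewrite rd (ra a (hmul b c)) rd (ra b a) (ra c a).
by ring.
Qed.

Lemma derivation_eq phi psi : scalar phi -> scalar psi ->
  (forall a b, phi (hmul a b) = heps a * phi b + heps b * phi a) ->
  (forall a b, psi (hmul a b) = heps a * psi b + heps b * psi a) ->
  (forall t, phi (cch C t) = psi (cch C t)) ->
  (forall i, phi (x_ i) = psi (x_ i)) -> forall a, phi a = psi a.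
Proof.
move=> lp lq dp dq e0 e1; apply: (scalar_eq (C := C)) => // t [|i w]; first exact: e0.
by rewrite mon_cons dp dq heps_cvar !mul0r e1.
Qed.

Lemma biderivation_r r : antisym r -> biderivation r -> forall a b c : H,
  r a (hmul b c) = heps b * r a c + heps c * r a b.
Proof. by move=> ra rd a b c; rewrite ra rd (ra b a) (ra c a); ring. Qed.

Lemma alternator_eq r r' : alternator r -> alternator r' ->
  (forall t i, r (cch C t) (x_ i) = r' (cch C t) (x_ i)) ->
  (forall i j, r (x_ i) (x_ j) = r' (x_ i) (x_ j)) -> r = r'.
Proof.
move=> [[rl rr] rv ra rd] [[rl' rr'] rv' ra' rd'] e0 e1.
have drr := biderivation_r ra rd; have drr' := biderivation_r ra' rd'.
have ex i a : r a (x_ i) = r' a (x_ i).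
  by apply: (derivation_eq (rl _) (rl' _)) => [? ?|? ?|t|j]; rewrite ?rd ?rd'.
apply/funext => a; apply/funext => b.
apply: (derivation_eq (rl _) (rl' _)) => [? ?|? ?|t|i]; rewrite ?rd ?rd' //;
  last by rewrite ra ra' ex.
apply: (derivation_eq (rr _) (rr' _)) => [? ?|? ?|s|i]; rewrite ?drr ?drr' //.
by rewrite rv rv'.
Qed.

(** Concentrated on the empty word: the series of a form that vanishes on every monomial containing
    a variable. Such series multiply pointwise ([concM]). *)
Definition conc (Y L : Type) (u : Y -> k) : ser k Y L := fun t w => u t * (nilp w)%:R.

Lemma conc_scale (Y L : Type) (u : Y -> k) t : conc (L := L) u t = scale_ser (u t) 1 t.
Proof. by []. Qed.

Lemma concM (Y L : Type) (u v : Y -> k) :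
  conc (L := L) u * conc v = conc (fun t => u t * v t).
Proof.
apply: serP => t w; rewrite serM conc_scale.
rewrite -[LHS]/((scale_ser (u t) 1 * conc v) t w).
by rewrite scale_serAl mul1r /scale_ser /conc mulrA.
Qed.

Lemma conc1 (Y L : Type) : conc (fun _ : Y => 1) = 1 :> ser k Y L.
Proof. by apply: serP => t w; rewrite /conc mul1r. Qed.

Lemma pull_conc (Y Y' L L' : Type) (g : Y -> Y') (h : L -> option L') u :
  pull g h (conc u) = conc (u \o g).
Proof.
have -> : conc u = conc u * (1 : ser k Y' L') by rewrite mulr1.
apply: serP => t w; rewrite /pull.
have -> : (conc u * (1 : ser k Y' L')) (g t) = (scale_ser (u (g t)) 1 : ser k Y' L') (g t).
  by rewrite mulr1 conc_scale.
rewrite -[LHS]/(pull g h (scale_ser (u (g t)) 1) t w) pullZ pull_one.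
by [].
Qed.

Lemma symw_nilp (c : k) : symw (fun w : seq I => c * (nilp w)%:R).
Proof. by move=> w w' p; rewrite /nilp (perm_size p). Qed.

Lemma tilde1_ex (u : X -> k) : exists2 phi, scalar phi & hat1 phi = conc u.
Proof.
have [phi lp pE] := c_ext C (fun t => @symw_nilp (u t) : symw (conc u t)).
by exists phi => //; apply: serP.
Qed.

(** [c_ext] extends linear forms only, so c is extended one argument at a time. Linearity in the
    argument frozen by the second choice follows from uniqueness on monomials. *)
Lemma tilde_ex (c : X -> X -> k) : exists J, biform J /\
  hat2 J = conc (fun t => c t.1 t.2).
Proof.
have /choice[phi phiP] t : exists phi, scalar phi /\ hat1 phi = conc (c^~ t).
  by have [phi lp pE] := tilde1_ex (c^~ t); exists phi.
have /choice[J JP] a : exists psi, scalar psi /\ hat1 psi = conc (fun t => phi t a).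
  by have [psi lp pE] := tilde1_ex (fun t => phi t a); exists psi.
have JE a t w : J a (mon t w) = phi t a * (nilp w)%:R.
  by have [_ /(congr1 (fun F => F t w))] := JP a.
exists J; split.
  split=> [b u a a'|a]; last by have [] := JP a.
  have [l1 _] := JP (u *: a + a'); have [l2 _] := JP a; have [l3 _] := JP a'.
  apply: (scalar_eq (C := C) l1 (scalar_add (scalar_scale u l2) l3)) => t w.
  by rewrite !JE; have [pl _] := phiP t; rewrite pl mulrDl mulrA.
apply: serP => -[s t] w; rewrite /hat2 JE.
have [_ /(congr1 (fun F => F s (pmap (@lft I) w)))] := phiP t; rewrite /hat1 /conc /= => ->.
by case: w => [|[i|i] w] /=; rewrite ?mulr1 ?mulr0 ?mul0r.
Qed.

(* c on the characters, 0 on the monomials with a primitive factor. *)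
Definition tilde (c : X -> X -> k) : H -> H -> k :=
  xget 0 [set J | biform J /\ hat2 J = conc (fun t => c t.1 t.2)].

Lemma tildeE c : biform (tilde c) /\ hat2 (tilde c) = conc (fun t => c t.1 t.2).
Proof. exact: (xgetPex 0 (tilde_ex c)). Qed.

Lemma tilde_char c s t : tilde c (cch C s) (cch C t) = c s t.
Proof.
have [_ /(congr1 (fun F => F (s, t) [::]))] := tildeE c.
by rewrite /conc mulr1.
Qed.

Definition cocX (c : X -> X -> k) := (forall s t, c s t != 0) /\
  forall s t u, c (s + t) u * c s t = c s (t + u) * c t u.

Lemma cocX_norm c : cocX c -> c 0 0 = 1 -> (forall s, c s 0 = 1) /\ (forall s, c 0 s = 1).
Proof.
move=> [c0 cc] c1; split=> s.
  have := cc s 0 0; rewrite !addr0 c1 mulr1 => e.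
  by apply: (mulIf (c0 s 0)); rewrite e mul1r.
have := cc 0 0 s; rewrite !add0r c1 mulr1 => e.
by apply: (mulIf (c0 0 s)); rewrite -e mul1r.
Qed.

Lemma cocXV c : cocX c -> cocX (fun s t => (c s t)^-1).
Proof.
move=> [c0 cc]; split=> [s t|s t u]; first by rewrite invr_eq0.
by rewrite -!invfM cc.
Qed.

Lemma tilde_Z2inv c : cocX c -> c 0 0 = 1 -> @Z2inv k H (tilde c).
Proof.
move=> cP c1; have [c0 cc] := cP; have [bt tE] := tildeE c.
have [bt' tE'] := tildeE (fun s t => (c s t)^-1); have [n1 n2] := cocX_norm cP c1.
apply: (Z2invE C _).2; split=> //.
  exists (tilde (fun s t => (c s t)^-1)) => //.
  rewrite tE tE' concM -conc1; congr conc; apply/funext => t; exact: mulfV.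
rewrite tE; split; rewrite /cocycle_ser /pull12_3 /pull1_23 /pull1_2 /pull2_3 /restr1 /restr2 !pull_conc.
- by rewrite !concM; congr conc; apply/funext => -[[s t] u] /=; apply: cc.
- by rewrite -conc1; congr conc; apply/funext => t /=; apply: n1.
- by rewrite -conc1; congr conc; apply/funext => t /=; apply: n2.
Qed.

Definition onX J : X -> X -> k := fun s t => J (cch C s) (cch C t).

Lemma onX_conv J K : biform J -> biform K -> onX (conv J K) = fun s t => onX J s t * onX K s t.
Proof.
move=> bJ bK; apply/funext => s; apply/funext => t.
rewrite -[LHS]/(hat2 (conv J K) (s, t) [::]) hat2_conv //.
Qed.

Lemma onX_cocX J : @Z2inv k H J -> cocX (onX J) /\ onX J 0 0 = 1.
Proof.
move=> ZJ; have [bJ [K bK JK] [cJ _ _]] := (Z2invE C J).1 ZJ; split; last first.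
  by rewrite /onX cch0; apply: (h2_normr ZJ.1).
split=> [s t|s t u].
  have := congr1 (fun F => F (s, t) [::]) JK; rewrite serM0 ser1 => e.
  apply/eqP => e0; move: e; rewrite -[hat2 J _ _]/(onX J s t) e0 mul0r => /eqP.
  by rewrite eq_sym oner_eq0.
exact: (congr1 (fun F => F (s, t, u) [::]) cJ).
Qed.

(** Dividing by the values on characters makes all constant terms 1, where the logarithm is
    defined. *)
Definition unipart J := conv (tilde (fun s t => (onX J s t)^-1)) J.
Definition logpart J := conv_log (unipart J).
Definition alt J := fun a b => logpart J a b - logpart J b a.

Lemma unipartP J : @Z2inv k H J -> [/\ @Z2inv k H (unipart J),
  normal_on_chars (unipart J) & conv (tilde (onX J)) (unipart J) = J].
Proof.
move=> ZJ; have [cP c1] := onX_cocX ZJ; have [bJ _ _] := (Z2invE C J).1 ZJ.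
have [bt tE] := tildeE (onX J); have [bt' tE'] := tildeE (fun s t => (onX J s t)^-1).
have Zt' : @Z2inv k H (tilde (fun s t => (onX J s t)^-1)).
  by apply: tilde_Z2inv; [apply: cocXV | rewrite c1 invr1].
split; first exact: (Z2invM C).
  move=> s t; rewrite -[LHS]/(onX (unipart J) s t) onX_conv //.
  by rewrite {1}/onX tilde_char mulVf //; apply: cP.1.
apply: (hat2_inj (C := C)) => //; first by do 2 apply: biform_conv => //.
rewrite !hat2_conv //; last exact: biform_conv.
rewrite mulrA tE tE' concM (_ : conc _ = 1) ?mul1r // -conc1; congr conc.
apply/funext => t; exact: (mulfV (cP.1 _ _)).
Qed.

Lemma logpartP J : @Z2inv k H J ->
  [/\ biform (logpart J), vanish (logpart J), addcocycle (logpart J),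
    hat2 (logpart J) = ser_log (hat2 (unipart J)) & conv_exp H (logpart J) = unipart J].
Proof. by move=> ZJ; have [Zu nu _] := unipartP ZJ; apply: log_addcocycle. Qed.

Lemma alt_alternator J : @Z2inv k H J -> alternator (alt J).
Proof. by move=> ZJ; have [bl lv lc _ _] := logpartP ZJ; apply: alternator_addcocycle. Qed.

Lemma normal_constant_term J : normal_on_chars J -> forall t, hat2 J t [::] = 1.
Proof. by move=> nJ [s t]; apply: nJ. Qed.

Lemma unipart_conv J K : @Z2inv k H J -> @Z2inv k H K ->
  hat2 (unipart (conv J K)) = hat2 (unipart J) * hat2 (unipart K).
Proof.
move=> ZJ ZK; have [bJ _ _] := (Z2invE C J).1 ZJ; have [bK _ _] := (Z2invE C K).1 ZK.
have b c := (tildeE c).1; have E c := (tildeE c).2.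
rewrite !hat2_conv //; try exact: biform_conv.
rewrite !E [RHS]mulrACA concM; congr (conc _ * _); apply/funext => t.
by rewrite onX_conv // invfM.
Qed.

Lemma logpart_conv J K : @Z2inv k H J -> @Z2inv k H K ->
  logpart (conv J K) = fun a b => logpart J a b + logpart K a b.
Proof.
move=> ZJ ZK; have [bJ _ _ lJ _] := logpartP ZJ; have [bK _ _ lK _] := logpartP ZK.
have [bJK _ _ lJK _] := logpartP (Z2invM C ZJ ZK).
apply: (hat2_inj (C := C)) => //; first exact: biformD.
rewrite hat2D lJ lK lJK unipart_conv // ser_logM //; apply: normal_constant_term; first by have [] := unipartP ZJ.
by have [] := unipartP ZK.
Qed.

Lemma alt_conv J K : @Z2inv k H J -> @Z2inv k H K ->
  alt (conv J K) = fun a b => alt J a b + alt K a b.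
Proof.
move=> ZJ ZK; apply/funext => a; apply/funext => b.
by rewrite /alt logpart_conv //; ring.
Qed.

Lemma onX_B2inv J : @B2inv k H J -> exists2 u : X -> k, forall t, u t != 0 &
  forall s t, onX J s t = u s * u t / u (s + t).
Proof.
move=> /(B2invE C)[bJ [x [y [lx ly xy x1 JE]]]].
have xyt t : x (cch C t) * y (cch C t) = 1 by exact: (congr1 (fun F => F t [::]) xy).
have y0 t : y (cch C t) != 0.
  by apply: contra_eq_neq (xyt t) => ->; rewrite mulr0 eq_sym oner_eq0.
exists (fun t => y (cch C t)) => // s t.
have := congr1 (fun F => F (s, t) [::]) JE; rewrite -[hat2 J _ _]/(onX J s t) => ->.
rewrite /cobs /= -[LHS]/(x (cch C (s + t)) * (y (cch C s) * y (cch C t))).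
by rewrite mulrC; congr (_ * _); apply: (mulIf (y0 (s + t))); rewrite xyt mulVf.
Qed.

(** Coboundaries are symmetric, O(G) being commutative; division by the character part and log both
    commute with the flip. *)
Lemma alt_B2inv J : @B2inv k H J -> alt J = fun _ _ => 0.
Proof.
move=> BJ; have ZJ := BJ.1; have [bl _ _ lE _] := logpartP ZJ.
have [Zu nu _] := unipartP ZJ; have [bJ _ _] := (Z2invE C J).1 ZJ.
have fJ := B2inv_sym BJ.
have [bt tE] := tildeE (fun s t => (onX J s t)^-1).
suff fl : flip2 (logpart J) = logpart J.
  by apply/funext => a; apply/funext => b; rewrite /alt -{1}fl subrr.
apply: (hat2_inj (C := C)) => //; first exact: biform_flip.
rewrite hat2_flip lE /pullflip pull_log //; last exact: normal_constant_term.
congr ser_log; rewrite -/(pullflip _) hat2_conv // tE /pullflip pullM pull_conc.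
rewrite -/(pullflip _) -hat2_flip fJ; congr (conc _ * _).
by apply/funext => -[s t] /=; rewrite -[onX J t s]/(onX (flip2 J) s t) fJ.
Qed.

Lemma tilde_B2inv (c : X -> X -> k) (u : X -> k) : (forall t, u t != 0) -> c 0 0 = 1 ->
  (forall s t, c s t = u s * u t / u (s + t)) -> @B2inv k H (tilde c).
Proof.
move=> u0 c1 cE; have [bt tE] := tildeE c.
have [y ly yE] := tilde1_ex u; have [x lx xE] := tilde1_ex (fun t => (u t)^-1).
apply: (B2invE C _).2; split=> //; exists x, y; split=> //.
- by rewrite xE yE concM -conc1; congr conc; apply/funext => t; rewrite mulVf.
- rewrite -(mon0 C) -[LHS]/(hat1 x 0 [::]) xE /conc mulr1.
  by move: c1; rewrite cE addr0 mulfK // => ->; rewrite invr1.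
rewrite tE xE yE /cobs /pullmul /pull1 /pull2 !pull_conc !concM; congr conc.
by apply/funext => -[s t] /=; rewrite cE mulrC.
Qed.

Lemma exp_sym_B2inv f : biform f -> vanish f -> addcocycle f ->
  (forall a b, f a b = f b a) -> @B2inv k H (conv_exp H f).
Proof.
move=> bf fv fc fC; have [g [lg g0 fE]] := symmetric_addcocycle bf fv fc fC.
exact: exp_coboundary fE.
Qed.

(** Completeness of the two invariants: J is the product of a coboundary concentrated on the
    characters and of the exponential of a symmetric additive cocycle. *)
Lemma trivial_B2inv J u : @Z2inv k H J -> (forall t, u t != 0) ->
  (forall s t, onX J s t = u s * u t / u (s + t)) -> alt J = (fun _ _ => 0) ->
  @B2inv k H J.
Proof.
move=> ZJ u0 cE aJ; have [_ _ <-] := unipartP ZJ.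
have [bl lv lc _ <-] := logpartP ZJ; have [_ c1] := onX_cocX ZJ.
apply: (B2invM C); first exact: (tilde_B2inv u0).
apply: exp_sym_B2inv => // a b; apply/eqP; rewrite -subr_eq0; apply/eqP.
exact: (congr1 (fun F => F a b) aJ).
Qed.

(** Both invariants can be prescribed at once, which will give surjectivity of the
    classification. *)
Lemma twist_ex (c : X -> X -> k) r : cocX c -> c 0 0 = 1 -> alternator r ->
  let J := conv (tilde c) (conv_exp H (fun a b => r a b / 2%:R)) in
  [/\ @Z2inv k H J, onX J = c & alt J = r].
Proof.
move=> cP c1 rP J; have [br rv ra rd] := rP.
have bf : biform (fun a b => r a b / 2%:R).
  by have := biformZ (2%:R^-1) br; under eq_fun do under eq_fun do rewrite mulrC.
have fv : vanish (fun a b => r a b / 2%:R) by move=> s t; rewrite rv mul0r.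
have Ze := exp_Z2inv char0 bf fv (addcocycle_alternator rP).
have [be eE] := conv_expE bf fv.
have ZJ : @Z2inv k H J by apply: (Z2invM C) => //; apply: tilde_Z2inv.
have [bt tE] := tildeE c.
have cE : onX J = c.
  rewrite onX_conv //; apply/funext => s; apply/funext => t.
  rewrite {1}/onX tilde_char -[onX _ s t]/(hat2 (conv_exp H _) (s, t) [::]) eE.
  by rewrite ser_exp0 mulr1.
split=> //.
have [bl lv lc lE _] := logpartP ZJ.
have lf : logpart J = fun a b => r a b / 2%:R.
  apply: (hat2_inj (C := C)) => //; rewrite lE hat2_conv; [|exact: (tildeE _).1|by case: ((Z2invE C J).1 ZJ)].
  rewrite cE hat2_conv // mulrA (tildeE _).2 tE concM (_ : conc _ = 1).
    by rewrite mul1r eE ser_expK //; apply/vanishP.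
  by rewrite -conc1; congr conc; apply/funext => t; rewrite mulVf //; apply: cP.1.
apply/funext => a; apply/funext => b; rewrite /alt lf (ra b a) mulNr opprK -mulr2n.
have n2 := natS_neq0 char0 1.
by rewrite -[LHS]mulr_natr divfK.
Qed.

End Invariants.

(** * Symmetric cocycles and alternating bicharacters *)

Section Divisible.
Variables (k : closedFieldType) (E : zmodType).
Implicit Types (D : set (E * k)).

(* D is the graph of a character of a subgroup of E. *)
Definition char_graph D := [/\ D (0, 1),
  forall p q, D p -> D q -> D (p.1 - q.1, p.2 / q.2),
  forall a, D (0, a) -> a = 1 & forall p, D p -> p.2 != 0].

Section Graph.
Variables (D : set (E * k)) (Dg : char_graph D).

Lemma graphN x a : D (x, a) -> D (- x, a^-1).
Proof.
by have [D0 DB _ _] := Dg => Dx; have := DB _ _ D0 Dx; rewrite /= sub0r mul1r.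
Qed.

Lemma graphD x y a b : D (x, a) -> D (y, b) -> D (x + y, a * b).
Proof.
by have [_ DB _ _] := Dg => Dx /graphN Dy; have := DB _ _ Dx Dy; rewrite /= opprK invrK.
Qed.

Lemma graph_uniq x a b : D (x, a) -> D (x, b) -> a = b.
Proof.
have [_ DB D1 Dn] := Dg => Dx Dx'; have := DB _ _ Dx Dx'; rewrite /= subrr => /D1 e.
by rewrite -[a](divfK (Dn _ Dx')) /= e mul1r.
Qed.

Lemma graphZ x a (z : int) : D (x, a) -> D (x *~ z, a ^ z).
Proof.
move=> Dx; have Dn n : D (x *+ n, a ^+ n).
  elim: n => [|n IH]; first by case: Dg.
  by rewrite mulrS exprS; apply: graphD.
by case: z => n; [apply: Dn | apply: (graphN (Dn n.+1))].
Qed.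

Lemma graph_extend g : (forall a, ~ D (g, a)) ->
  exists D', [/\ char_graph D', D `<=` D' & exists a, D' (g, a)].
Proof.
move=> gD; have [D0 DB D1 Dn] := Dg.
(* [l] is the value to be given at g. If no positive multiple of g lies in the domain, 1 is
   consistent; otherwise [l] is a d-th root of the value at d g, with d minimal. *)
have [l [l0 lP]] : exists l : k, l != 0 /\ forall z a, D (g *~ z, a) -> a = l ^ z.
  have [[n [a [n0 Da]]]|no] := pselect (exists n, exists a, (0 < n)%N /\ D (g *+ n, a)); last first.
    exists 1; split; first exact: oner_neq0.
    move=> z a Da; have [z0|z0] := eqVneq z 0.
      by move: Da; rewrite z0 mulr0z expr0z => /D1.
    case: no; case: z Da z0 => n Da n0; first by exists n, a; rewrite lt0n.
    by exists n.+1, a^-1; split=> //; have := graphN Da; rewrite NegzE mulrNz opprK.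
  have ex : exists n, (0 < n)%N && `[< exists a, D (g *+ n, a) >].
    by exists n; rewrite n0; apply/asboolP; exists a.
  case: (ex_minnP ex) => d /andP[d0 /asboolP[ad Dd]] dmin.
  have [l lE] := @solve_monicpoly k d (fun i => if i is 0%N then ad else 0) d0.
  have {}lE : l ^+ d = ad.
    rewrite lE; case: d d0 {Dd dmin lE} => // d _; rewrite big_ord_recl expr0 mulr1.
    by rewrite big1 ?addr0 // => i _; rewrite mul0r.
  have ad0 := Dn _ Dd; exists l; split.
    by apply: contraNneq ad0 => l0; rewrite -lE l0 expr0n (gtn_eqF d0).
  move=> z b Db.
  have zE : z = (z %/ d)%Z * d + (z %% d)%Z by rewrite -divz_eq.
  have [r rE] : exists r : nat, (z %% d)%Z = r.
    by exists `|(z %% d)%Z|%N; rewrite gez0_abs // modz_ge0 //; case: (d) d0.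
  have Dq : D (g *~ ((z %/ d)%Z * d), ad ^ (z %/ d)%Z).
    by have := graphZ (z %/ d)%Z Dd; rewrite pmulrn -mulrzA [d%:Z * _]mulrC.
  have Dr : D (g *+ r, b / ad ^ (z %/ d)%Z).
    have := graphD Db (graphN Dq); rewrite {1}zE rE mulrzDr addrAC subrr add0r.
    by [].
  (* The remainder of z modulo d is again a multiple of g in the domain, hence 0 by minimality of
     d. *)
  have r0 : r = 0%N.
    apply/eqP; rewrite -leqn0 leqNgt; apply/negP => rpos.
    have rd : (r < d)%N by have := ltz_pmod z (d := d); rewrite rE; apply.
    have : (d <= r)%N by apply: dmin; rewrite rpos; apply/asboolP; exists (b / ad ^ (z %/ d)%Z).
    by rewrite leqNgt rd.
  have := Dr; rewrite r0 mulr0n => /D1 e.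
  rewrite -[b](divfK (_ : ad ^ (z %/ d)%Z != 0)) ?expfz_neq0 // e mul1r.
  by rewrite {2}zE rE r0 addr0 -lE exprnP exprz_exp mulrC.
pose D' := [set p | exists x a z, D (x, a) /\ p = (x + g *~ z, a * l ^ z)].
exists D'; split; last first.
- by exists l, 0, 1, 1; rewrite add0r mul1r.
- by move=> [x a] Dx; exists x, a, 0; rewrite mulr0z addr0 expr0z mulr1.
split.
- by exists 0, 1, 0; rewrite mulr0z addr0 expr0z mulr1.
- move=> _ _ [x [a [z [Dx ->]]]] [y [b [z' [Dy ->]]]] /=.
  exists (x - y), (a / b), (z - z'); split; first exact: (DB _ _ Dx Dy).
  rewrite mulrzBr opprD addrACA; congr (_, _).
  by rewrite expfzDr // -invr_expz invfM mulrACA.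
- move=> a [x [b [z [Dx [xE ->]]]]].
  have /graphN := Dx; have -> : - x = g *~ z by apply/eqP; rewrite eq_sym -addr_eq0 addrC -xE.
  move/lP => <-; rewrite divff //; exact: (Dn _ Dx).
- move=> _ [x [b [z [Dx ->]]]] /=; rewrite mulf_neq0 ?expfz_neq0 //.
  exact: (Dn _ Dx).
Qed.

End Graph.

(* k^x is divisible, hence injective. *)
Lemma char_extension D : char_graph D -> exists u : E -> k,
  [/\ forall x, u x != 0, forall x y, u (x + y) = u x * u y &
      forall x a, D (x, a) -> u x = a].
Proof.
move=> Dg.
(* Zorn is applied to the sets A whose union with D is a graph, so that the empty chain, with union
   D, needs no separate treatment. *)
have [A [PA Amax]] : exists A, char_graph (A `|` D) /\
    forall B, A `<` B -> ~ char_graph (B `|` D).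
  apply: (@Zorn_bigcup _ (fun A => char_graph (A `|` D))) => F FP Ftot.
  have key p q : (\bigcup_(A in F) A `|` D) p -> (\bigcup_(A in F) A `|` D) q ->
    exists A, [/\ char_graph (A `|` D), A `<=` \bigcup_(A in F) A, (A `|` D) p & (A `|` D) q].
    move=> [[A FA Ap]|Dp] [[B FB Bq]|Dq].
    - have [AB|BA] := Ftot _ _ FA FB.
        by exists B; split; [exact: FP|exact: bigcup_sup|left; apply: AB|left].
      by exists A; split; [exact: FP|exact: bigcup_sup|left|left; apply: BA].
    - by exists A; split; [exact: FP|exact: bigcup_sup|left|right].
    - by exists B; split; [exact: FP|exact: bigcup_sup|right|left].
    - by exists set0; rewrite set0U; split.
  split.
  - by right; case: Dg.
  - move=> p q /key h /h[A [[_ AB _ _] sA Ap Aq]].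
    by have [?|?] := AB _ _ Ap Aq; [left; apply: sA|right].
  - by move=> a Fa; have [A [[_ _ A1 _] _ Aa _]] := key _ _ Fa Fa; apply: A1.
  - by move=> p Fp; have [A [[_ _ _ An] _ Ap _]] := key _ _ Fp Fp; apply: An.
have total x : exists a, (A `|` D) (x, a).
  apply: contrapT => nx; have [|B [Bg sB [a Ba]]] := graph_extend PA (g := x).
    by move=> a Aa; apply: nx; exists a.
  apply: (Amax B).
    split; first by apply: subset_trans sB; apply: subsetUl.
    by move=> BA; apply: nx; exists a; left; apply: BA.
  have -> : B `|` D = B by apply/setUidPl; apply: subset_trans sB; apply: subsetUr.
  exact: Bg.
have [u uP] := choice total.
exists u; split=> [x|x y|x a Da].
- by have [_ _ _ An] := PA; exact: (An _ (uP x)).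
- exact: (graph_uniq PA (uP _) (graphD PA (uP x) (uP y))).
- by apply: (graph_uniq PA (uP x)); right.
Qed.

End Divisible.

Section Twisted.
Variables (k : closedFieldType) (P : zmodType) (S : set P) (c : P -> P -> k).

Record symmetric_cocycle := SymmetricCocycle {
  sc_S0 : S 0;
  sc_SB : forall x y, S x -> S y -> S (x - y);
  sc_neq0 : forall x y, S x -> S y -> c x y != 0;
  sc_coc : forall x y z, S x -> S y -> S z -> c (x + y) z * c x y = c x (y + z) * c y z;
  sc_sym : forall x y, S x -> S y -> c x y = c y x;
  sc_norm : c 0 0 = 1 }.

(* The abelian extension of S by k^x with cocycle c. *)
Definition twisted (h : symmetric_cocycle) :=
  {p : k * P | `[< p.1 != 0 /\ S p.2 >]}.

Variable h : symmetric_cocycle.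
Local Notation E := (twisted h).

Lemma sc_SN x : S x -> S (- x).
Proof. by move=> Sx; rewrite -sub0r; apply: sc_SB => //; apply: sc_S0. Qed.
Lemma sc_SD x y : S x -> S y -> S (x + y).
Proof. by move=> Sx Sy; rewrite -[y]opprK; apply: sc_SB => //; apply: sc_SN. Qed.
Lemma sc_0x x : S x -> c 0 x = 1.
Proof.
move=> Sx; have S0 := sc_S0 h; have := sc_coc h S0 S0 Sx; rewrite !add0r sc_norm // mulr1 => e.
by apply: (mulIf (sc_neq0 h S0 Sx)); rewrite -e mul1r.
Qed.

Definition tw_mk a x (p : `[< a != 0 /\ S x >]) : E := exist _ (a, x) p.

Lemma tw_add_subproof (p q : E) :
  `[< (val p).1 * (val q).1 * c (val p).2 (val q).2 != 0 /\ S ((val p).2 + (val q).2) >].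
Proof.
case: p q => [[a x] /= /asboolP[a0 Sx]] [[b y] /= /asboolP[b0 Sy]]; apply/asboolP; split.
  by rewrite !mulf_neq0 //; apply: sc_neq0.
exact: sc_SD.
Qed.
Lemma tw_zero_subproof : `[< (1 : k) != 0 /\ S 0 >].
Proof. by apply/asboolP; split; [exact: oner_neq0 | exact: sc_S0]. Qed.
Lemma tw_opp_subproof (p : E) :
  `[< ((val p).1 * c (val p).2 (- (val p).2))^-1 != 0 /\ S (- (val p).2) >].
Proof.
case: p => [[a x] /= /asboolP[a0 Sx]]; apply/asboolP; split; last exact: sc_SN.
by rewrite invr_eq0 mulf_neq0 //; apply: sc_neq0 => //; apply: sc_SN.
Qed.

Definition tw_add p q : E := tw_mk (tw_add_subproof p q).
Definition tw_zero : E := tw_mk tw_zero_subproof.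
Definition tw_opp p : E := tw_mk (tw_opp_subproof p).

Lemma tw_P (p : E) : (val p).1 != 0 /\ S (val p).2.
Proof. by case: p => [p /= /asboolP]. Qed.

Lemma tw_addA : associative tw_add.
Proof.
move=> p q r; apply: val_inj => /=; rewrite addrA; congr (_, _).
have [_ Sp] := tw_P p; have [_ Sq] := tw_P q; have [_ Sr] := tw_P r.
have := sc_coc h Sp Sq Sr; move: (c _ (_ + _)) (c (_ + _) _) => cl cr e.
transitivity ((val p).1 * (val q).1 * (val r).1 * (cl * c (val q).2 (val r).2)); first by ring.
by rewrite -e; ring.
Qed.
Lemma tw_addC : commutative tw_add.
Proof.
move=> p q; apply: val_inj => /=; rewrite addrC; congr (_, _).
have [_ Sp] := tw_P p; have [_ Sq] := tw_P q.
by rewrite [_.1 * _]mulrC (sc_sym h Sp Sq).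
Qed.
Lemma tw_add0 : left_id tw_zero tw_add.
Proof.
move=> p; apply: val_inj => /=; have [_ Sp] := tw_P p.
by rewrite sc_0x // add0r mul1r mulr1 -surjective_pairing.
Qed.
Lemma tw_addN : left_inverse tw_zero tw_opp tw_add.
Proof.
move=> p; apply: val_inj => /=; have [p0 Sp] := tw_P p; rewrite addNr; congr (_, _).
have SN := sc_SN Sp; rewrite (sc_sym h SN Sp) -mulrA mulVf //.
by rewrite mulf_neq0 //; apply: sc_neq0.
Qed.

HB.instance Definition _ := Choice.on (twisted h).
HB.instance Definition _ := GRing.isZmodule.Build (twisted h) tw_addA tw_addC tw_add0 tw_addN.

(** Divisibility extends the identity of k^x to a character of the whole extension. Its values on
    the section x |-> (1, x) split the cocycle. *)
Lemma symmetric_cocycle_trivial0 : exists u : P -> k,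
  (forall x, S x -> u x != 0) /\
  (forall x y, S x -> S y -> c x y = u x * u y / u (x + y)).
Proof.
have addE (p q : E) : sval (p + q) =
  ((sval p).1 * (sval q).1 * c (sval p).2 (sval q).2, (sval p).2 + (sval q).2) by [].
have oppE (p : E) : sval (- p) =
  (((sval p).1 * c (sval p).2 (- (sval p).2))^-1, - (sval p).2) by [].
pose D := [set p : E * k | sval p.1 = (p.2, 0)].
have Dg : char_graph D.
  split.
  - by [].
  - move=> [p a] [q b] Dp Dq.
    rewrite /D /= in Dp Dq *.
    by rewrite [LHS](addE p (- q)) oppE Dp Dq /= oppr0 sc_norm // !mulr1 addr0.
  - by move=> a /(congr1 fst).
  - by move=> [p a] Dp; have [] := tw_P p; rewrite [val p]Dp.
have [u [u0 uD uE]] := char_extension Dg.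
pose lift x : E := insubd tw_zero (1, x).
have liftE x : S x -> sval (lift x) = (1, x).
  by move=> Sx; rewrite [LHS]val_insubd ifT //; apply/asboolP; split; rewrite ?oner_neq0.
exists (fun x => u (lift x)); split=> [x _|x y Sx Sy]; first exact: u0.
have c0 := sc_neq0 h Sx Sy.
have pc : `[< c x y != 0 /\ S 0 >] by apply/asboolP; split=> //; apply: sc_S0.
have e : lift x + lift y = tw_mk pc + lift (x + y).
  have Sxy := sc_SD Sx Sy; apply: val_inj.
  by rewrite [LHS]addE [RHS]addE !liftE //= sc_0x // !mulr1 !mul1r add0r.
have e1 : u (tw_mk pc) = c x y by apply: uE.
by rewrite -uD e uD e1 mulfK.
Qed.

End Twisted.

(** Stated relative to a subgroup S, because it serves both for the kernel of a map from Z^n and for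
    the whole group of characters. *)
Lemma symmetric_cocycle_trivial (k : closedFieldType) (P : zmodType) (S : set P) (c : P -> P -> k) :
  S 0 -> (forall x y, S x -> S y -> S (x - y)) ->
  (forall x y, S x -> S y -> c x y != 0) ->
  (forall x y z, S x -> S y -> S z -> c (x + y) z * c x y = c x (y + z) * c y z) ->
  (forall x y, S x -> S y -> c x y = c y x) ->
  exists u : P -> k, (forall x, S x -> u x != 0) /\
    (forall x y, S x -> S y -> c x y = u x * u y / u (x + y)).
Proof.
move=> S0 SB c0 cc cs; have c00 := c0 _ _ S0 S0.
(* The unit (1, 0) of the extension requires c(0,0) = 1; the constant divided out here returns as a
   factor of u. *)
have h : symmetric_cocycle S (fun x y => c x y / c 0 0).
  split=> // [x y Sx Sy|x y z Sx Sy Sz|x y Sx Sy|].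
  - by rewrite mulf_neq0 ?invr_eq0 // c0.
  - by rewrite !mulf_div cc.
  - by rewrite cs.
  - exact: mulfV.
have [u [u0 uE]] := symmetric_cocycle_trivial0 h.
exists (fun x => c 0 0 * u x); split=> [x Sx|x y Sx Sy]; first by rewrite mulf_neq0 ?u0.
have Sxy : S (x + y) by rewrite -[y]opprK; apply: (SB) => //; rewrite -sub0r; apply: (SB).
have uxy := u0 _ Sxy.
by rewrite -[LHS](divfK c00) uE //; field; apply/andP.
Qed.

(** * Alternating bicharacters as alternations of cocycles *)

Section Alternating.
Variables (k : closedFieldType) (X : zmodType).

Definition bicharacter (Y : zmodType) (b : Y -> Y -> k) :=
  [/\ forall x y, b x y != 0, forall x y z, b (x + y) z = b x z * b y z
    & forall x y z, b x (y + z) = b x y * b x z].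

Section Bichar.
Variables (Y : zmodType) (b : Y -> Y -> k) (bP : bicharacter b).

Lemma bichar0l y : b 0 y = 1.
Proof.
have [b0 bl _] := bP; apply: (mulIf (b0 0 y)).
by rewrite -bl addr0 mul1r.
Qed.
Lemma bichar0r y : b y 0 = 1.
Proof.
have [b0 _ br] := bP; apply: (mulIf (b0 y 0)).
by rewrite -br addr0 mul1r.
Qed.
Lemma bicharNl x y : b (- x) y = (b x y)^-1.
Proof.
have [b0 bl _] := bP; apply: (mulIf (b0 x y)).
by rewrite -bl addNr bichar0l mulVf.
Qed.
Lemma bicharNr x y : b x (- y) = (b x y)^-1.
Proof.
have [b0 _ br] := bP; apply: (mulIf (b0 x y)).
by rewrite -br addNr bichar0r mulVf.
Qed.
Lemma bicharZl x y z : b (x *~ z) y = b x y ^ z.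
Proof.
have [b0 bl _] := bP.
have N n : b (x *+ n) y = b x y ^+ n.
  by elim: n => [|n IH]; rewrite ?mulr0n ?bichar0l // mulrS bl IH exprS.
by case: z => n; [apply: N | rewrite NegzE mulrNz bicharNl N].
Qed.
Lemma bicharZr x y z : b x (y *~ z) = b x y ^ z.
Proof.
have [b0 _ br] := bP.
have N n : b x (y *+ n) = b x y ^+ n.
  by elim: n => [|n IH]; rewrite ?mulr0n ?bichar0r // mulrS br IH exprS.
by case: z => n; [apply: N | rewrite NegzE mulrNz bicharNr N].
Qed.
Lemma bichar_suml (T : Type) (s : seq T) (F : T -> Y) y :
  b (\sum_(i <- s) F i) y = \prod_(i <- s) b (F i) y.
Proof. by have [_ bl _] := bP; apply: (big_morph (b^~ y)) => [? ?|]; rewrite ?bl ?bichar0l. Qed.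
Lemma bichar_sumr (T : Type) (s : seq T) (F : T -> Y) y :
  b y (\sum_(i <- s) F i) = \prod_(i <- s) b y (F i).
Proof. by have [_ _ br] := bP; apply: (big_morph (b y)) => [? ?|]; rewrite ?br ?bichar0r. Qed.

End Bichar.

Variables (b : X -> X -> k) (bP : bicharacter b) (balt : forall x, b x x = 1).

Lemma alt_antisym x y : b x y * b y x = 1.
Proof.
have [_ bl br] := bP; have := balt (x + y); rewrite bl !br !balt mul1r mulr1.
by rewrite mulrC.
Qed.

(** The strictly upper triangular part of b on Z^n: dividing by its transpose restores the lower
    part by antisymmetry, and the diagonal is 1 because b is alternating. *)
Lemma alternating_free_lift n (g : 'I_n -> X) :
  exists c : {ffun 'I_n -> int} -> {ffun 'I_n -> int} -> k, bicharacter c /\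
    forall p q, c p q / c q p = b (\sum_i g i *~ p i) (\sum_i g i *~ q i).
Proof.
have [b0 bl br] := bP.
pose c (p q : {ffun 'I_n -> int}) := \prod_(i < n) \prod_(j < n | (i < j)%N) b (g i) (g j) ^ (p i * q j).
have c0 p q : c p q != 0.
  by apply/prodf_neq0 => i _; apply/prodf_neq0 => j _; apply/expfz_neq0/b0.
exists c; split; first split=> //.
- move=> p q r; rewrite -big_split; apply: eq_bigr => i _.
  rewrite -big_split; apply: eq_bigr => j _.
  by rewrite ffunE mulrDl expfzDr.
- move=> p q r; rewrite -big_split; apply: eq_bigr => i _.
  rewrite -big_split; apply: eq_bigr => j _.
  by rewrite ffunE mulrDr expfzDr.
move=> p q; rewrite (bichar_suml bP).
transitivity (\prod_i \prod_j b (g i) (g j) ^ (p i * q j)); last first.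
  apply: eq_bigr => i _; rewrite (bichar_sumr bP); apply: eq_bigr => j _.
  by rewrite (bicharZl bP) (bicharZr bP) exprz_exp mulrC.
have -> : (c q p)^-1 = \prod_(i < n) \prod_(j < n | (j < i)%N) b (g i) (g j) ^ (p i * q j).
  rewrite /c [RHS](exchange_big_dep xpredT) //= -prodfV; apply: eq_bigr => i _.
  rewrite -prodfV; apply: eq_bigr => j _.
  rewrite invr_expz -[b (g j) (g i)]mulr1 -(mulfV (b0 (g i) (g j))) mulrA [b (g j) _ * _]mulrC.
  by rewrite alt_antisym mul1r exprz_inv mulrC.
rewrite -big_split; apply: eq_bigr => i _ /=.
rewrite [RHS](bigID (fun j : 'I_n => (i < j)%N)) /=; congr (_ * _).
rewrite [RHS](bigD1 i) ?ltnn //= balt exp1rz mul1r; apply: eq_bigl => j.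
by rewrite -leqNgt ltn_neqAle andbC.
Qed.

(** The bicharacter t on Z^n does not descend to X, but on the kernel S it is symmetric against
    everything, hence a coboundary of some u on S. A section of Z^n -> X, corrected by u, turns t
    into a cocycle on X. *)
Lemma alternating_lift n (g : 'I_n -> X) :
  (forall x, exists p : {ffun 'I_n -> int}, x = \sum_i g i *~ p i) ->
  exists c : X -> X -> k, [/\ forall x y, c x y != 0,
    forall x y z, c (x + y) z * c x y = c x (y + z) * c y z &
    forall x y, c x y / c y x = b x y].
Proof.
move=> /choice[s sE]; pose pi_ (p : {ffun 'I_n -> int}) := \sum_i g i *~ p i.
have sK x : pi_ (s x) = x by rewrite /pi_ -sE.
have piB p q : pi_ (p - q) = pi_ p - pi_ q.
  by rewrite /pi_ -sumrB; apply: eq_bigr => i _; rewrite !ffunE mulrzBr.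
have piD p q : pi_ (p + q) = pi_ p + pi_ q.
  by rewrite /pi_ -big_split; apply: eq_bigr => i _; rewrite !ffunE mulrzDr.
have [t [tP tE]] := alternating_free_lift g; have [t0 tl tr] := tP.
have tC p q : pi_ p = 0 -> t p q = t q p.
  move=> p0; apply: (mulIf (_ : (t q p)^-1 != 0)); first by rewrite invr_eq0.
  by rewrite tE -!/(pi_ _) p0 (bichar0l bP) mulfV.
pose S := [set p | pi_ p = 0].
have [u [u0 uE]] : exists u : {ffun 'I_n -> int} -> k, (forall x, S x -> u x != 0) /\
    (forall x y, S x -> S y -> t x y = u x * u y / u (x + y)).
  apply: symmetric_cocycle_trivial.
  - by rewrite /S /= -[0](subrr 0) piB subrr.
  - by move=> x y Sx Sy; rewrite /S /= piB Sx Sy subrr.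
  - by [].
  - by move=> x y z _ _ _; rewrite tl tr; ring.
  - by move=> x y Sx _; apply: tC.
pose r x y := s x + s y - s (x + y).
have Sr x y : S (r x y) by rewrite /S /= piB piD !sK subrr.
have uM p q : S p -> S q -> u p * u q = u (p + q) * t p q.
  move=> Sp Sq; have Spq : S (p + q) by rewrite /S /= piD Sp Sq addr0.
  by rewrite uE // [RHS]mulrC divfK // u0.
(* In the central extension of Z^n by k^x with cocycle t, the elements (1/u(p), p) with p in S form
   a central subgroup. The witness is the cocycle of the quotient, an extension of X, for the
   section x |-> (1, s x). *)
exists (fun x y => t (s x) (s y) / t (s (x + y)) (r x y) * u (r x y)); split.
- by move=> x y; rewrite !mulf_neq0 ?invr_eq0 ?u0.
- move=> x y z.
  have ce : r (x + y) z + r x y = r x (y + z) + r y z.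
    rewrite /r; set w := s (x + y + z); have -> : s (x + (y + z)) = w by rewrite /w addrA.
    rewrite [LHS]addrC addrA addrA subrK [s x + _ - w]addrAC [RHS]addrACA subrr addr0.
    by rewrite [RHS]addrAC addrA.
  set p := s x; set q := s y; set v := s z.
  set z1 := s (x + y); set z2 := s (y + z); set w := s (x + y + z).
  rewrite -[s (x + (y + z))]/(s _) addrA -/w.
  have w1 : z1 + v = w + r (x + y) z by rewrite /r [RHS]addrC subrK.
  have w2 : p + z2 = w + r x (y + z) by rewrite /r [x + (y + z)]addrA -/w [RHS]addrC subrK.
  have w3 : p + q = z1 + r x y by rewrite /r [RHS]addrC subrK.
  have w4 : q + v = z2 + r y z by rewrite /r [RHS]addrC subrK.
  have S1 := Sr x y; have S2 := Sr (x + y) z; have S3 := Sr y z; have S4 := Sr x (y + z).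
  set r1 := r x y in ce w3 S1 *; set r2 := r (x + y) z in ce w1 S2 *.
  set r3 := r y z in ce w4 S3 *; set r4 := r x (y + z) in ce w2 S4 *.
  (* [L] and [R] bring the two sides to one shape, where only [r2 + r1] and [r4 + r3] differ; these
     agree by [ce]. *)
  have L : t z1 v / t w r2 * u r2 * (t p q / t z1 r1 * u r1) =
     t p v * t q v * t p q / t w (r2 + r1) * u (r2 + r1).
    have e1 : t z1 v = t p v * t q v / t r1 v by rewrite -tl w3 tl mulfK.
    have e2 : t z1 r1 = t r2 r1 * t w r1 / t r1 v.
      by rewrite [t r1 v]tC // [t r2 r1 * _]mulrC -tl -w1 tl mulfK.
    rewrite e1 e2 (tr w r2 r1); have := uM _ _ S2 S1 => e3.
    have -> : u (r2 + r1) = u r2 * u r1 / t r2 r1 by rewrite e3 mulfK.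
    by field; rewrite !t0.
  have R : t p z2 / t w r4 * u r4 * (t q v / t z2 r3 * u r3) =
     t p v * t q v * t p q / t w (r4 + r3) * u (r4 + r3).
    have e1 : t p z2 = t p q * t p v / t p r3 by rewrite -tr w4 tr mulfK.
    have e2 : t z2 r3 = t r4 r3 * t w r3 / t p r3.
      by rewrite [t r4 r3 * _]mulrC -tl -w2 tl mulrC mulKf.
    rewrite e1 e2 (tr w r4 r3); have := uM _ _ S4 S3 => e3.
    have -> : u (r4 + r3) = u r4 * u r3 / t r4 r3 by rewrite e3 mulfK.
    by field; rewrite !t0.
  by rewrite L R ce.
- move=> x y; have rC : r y x = r x y by rewrite /r [y + x]addrC [s y + s x]addrC.
  rewrite -[x in RHS]sK -[y in RHS]sK -tE rC [y + x]addrC.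
  have ur := u0 _ (Sr x y).
  by field; rewrite !t0 ur.
Qed.

End Alternating.

(** The relation translated by y, minus [f j y] times the relation, no longer involves [f j]. By
    induction each other coefficient times [f q y - f j y] is 0, and this difference is nonzero for
    some y. *)
Lemma dedekind_independence (k : fieldType) (T : Type) (mul : T -> T -> T) (e : T)
    (J : eqType) (f : J -> T -> k) (s : seq (k * J)) :
  (forall j x y, f j (mul x y) = f j x * f j y) -> (forall j, f j e = 1) ->
  injective f -> uniq [seq p.2 | p <- s] ->
  (forall x, \sum_(p <- s) p.1 * f p.2 x = 0) -> forall p, p \in s -> p.1 = 0.
Proof.
move=> fM f1 finj; have [n] := ubnP (size s).
elim: n s => // n IH [|[c j] s] lt us s0 p //.
have ss y q : q \in s -> q.1 * (f q.2 y - f j y) = 0.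
  move=> qs; pose s' := [seq (q.1 * (f q.2 y - f j y), q.2) | q <- s].
  apply: (IH s' _ _ _ (q.1 * (f q.2 y - f j y), q.2)).
  - by rewrite size_map.
  - by rewrite -map_comp; case/andP: us.
  - move=> x; rewrite big_map /=.
    have := s0 (mul y x); rewrite big_cons /= fM => e1.
    have := s0 x; rewrite big_cons /= => /(congr1 ( *%R (f j y))); rewrite mulr0 => e2.
    transitivity ((c * (f j y * f j x) + \sum_(p <- s) p.1 * f p.2 (mul y x)) -
       (f j y * (c * f j x + \sum_(p <- s) p.1 * f p.2 x))); last by rewrite e1 e2 subr0.
    rewrite mulrDr opprD addrACA mulrCA [f j y * (c * _)]mulrCA.
    rewrite [c * _]mulrCA subrr add0r mulr_sumr -sumrB; apply: eq_bigr => q' _.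
    by rewrite fM; ring.
  - exact: (map_f (fun q => (q.1 * (f q.2 y - f j y), q.2))).
have sz q : q \in s -> q.1 = 0.
  move=> qs; have qj : q.2 != j.
    by apply: contraTneq us => <-; rewrite /= map_f.
  have [y yq] : exists y, f q.2 y != f j y.
    apply: contrapT => ny; move/eqP: qj; apply; apply: finj; apply/funext => y.
    by apply: contrapT => /eqP yq; apply: ny; exists y.
  by have /eqP := ss y q qs; rewrite mulf_eq0 subr_eq0 (negPf yq) orbF => /eqP.
rewrite inE => /orP[/eqP->|/sz//] /=.
have := s0 e; rewrite big_cons /= f1 mulr1 big_seq big1 ?addr0 // => q qs.
by rewrite sz // mul0r.
Qed.

(** * Coordinates of diagonalizable and vector groups *)

Section BasisExtension.
Variables (k : fieldType) (V : lmodType k) (J : eqType) (e : J -> V).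
Hypothesis span : forall v, exists s : seq (k * J), v = \sum_(p <- s) p.1 *: e p.2.
Hypothesis indep : forall s : seq (k * J), uniq [seq p.2 | p <- s] ->
  \sum_(p <- s) p.1 *: e p.2 = 0 -> forall p, p \in s -> p.1 = 0.

(** Expansions may repeat an index, while [indep] speaks of distinct ones; collecting equal indices
    bridges the two. *)
Lemma big_group (W : lmodType k) (F : J -> W) (s : seq (k * J)) :
  \sum_(p <- s) p.1 *: F p.2 =
  \sum_(j <- undup [seq p.2 | p <- s]) (\sum_(p <- s | p.2 == j) p.1) *: F j.
Proof.
under [RHS]eq_bigr do rewrite scaler_suml.
rewrite (exchange_big_dep xpredT) //= big_seq [RHS]big_seq; apply: eq_bigr => p ps.
rewrite big_mkcond (bigD1_seq p.2) ?undup_uniq ?mem_undup ?map_f //= eqxx.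
by rewrite big1 ?addr0 // => j jp; rewrite eq_sym (negPf jp).
Qed.

Lemma relation_vanish (F : J -> k) (s : seq (k * J)) :
  \sum_(p <- s) p.1 *: e p.2 = 0 -> \sum_(p <- s) p.1 * F p.2 = 0.
Proof.
move=> s0; rewrite -[LHS]/(\sum_(p <- s) p.1 *: (F p.2 : k^o)) big_group.
pose s' := [seq (\sum_(p <- s | p.2 == j) p.1, j) | j <- undup [seq p.2 | p <- s]].
have u' : uniq [seq p.2 | p <- s'] by rewrite -map_comp map_id undup_uniq.
have s'0 : \sum_(p <- s') p.1 *: e p.2 = 0 by rewrite big_map -big_group.
rewrite big_seq big1 // => j js; have := indep u' s'0 (map_f _ js).
by rewrite /= => ->; rewrite scale0r.
Qed.

Lemma basis_extension (F : J -> k) : exists2 phi : V -> k, scalar phi & forall j, phi (e j) = F j.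
Proof.
have [s sE] := choice span.
have phiE v t : v = \sum_(p <- t) p.1 *: e p.2 -> \sum_(p <- s v) p.1 * F p.2 = \sum_(p <- t) p.1 * F p.2.
  move=> vE; apply/eqP; rewrite -subr_eq0; apply/eqP.
  have := @relation_vanish F (s v ++ [seq (- p.1, p.2) | p <- t]).
  rewrite !big_cat !big_map /= -sE.
  under eq_bigr do rewrite scaleNr.
  rewrite sumrN -vE subrr => /(_ erefl).
  by under [X in _ + X]eq_bigr do rewrite mulNr; rewrite sumrN.
exists (fun v => \sum_(p <- s v) p.1 * F p.2) => [c u v|j].
  rewrite (phiE _ ([seq (c * p.1, p.2) | p <- s u] ++ s v)); last first.
    rewrite big_cat big_map /= -sE; congr (_ + _); rewrite [u in LHS]sE scaler_sumr.
    by apply: eq_bigr => p _; rewrite scalerA.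
  rewrite big_cat big_map /=; congr (_ + _); rewrite mulr_sumr.
  by apply: eq_bigr => p _; rewrite mulrA.
by rewrite (phiE _ [:: (1, j)]) ?big_seq1 ?mul1r ?scale1r.
Qed.

End BasisExtension.

Section BuildCoords.
Variables (k : fieldType) (char0 : [pchar k] =i pred0).
Variables (G : affine_group k) (X : nmodType) (m : nat).
Local Notation H := (coord_alg G).
Variables (ch : X -> H) (u : 'I_m -> H).
Hypotheses (ch0 : ch 0 = hone H) (chD : forall s t, ch (s + t) = hmul (ch s) (ch t)).
Hypothesis ch_mul : forall t (x y : G), ev (x * y)%g (ch t) = ev x (ch t) * ev y (ch t).
Hypothesis ch_eps : forall t, heps (ch t) = 1.
Hypothesis u_add : forall i (x y : G), ev (x * y)%g (u i) = ev x (u i) + ev y (u i).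

Local Notation expo := {ffun 'I_m -> nat}.
(** One sorted word for each permutation class, so that monomials are indexed without repetition. *)
Definition word (al : expo) : seq 'I_m := flatten [seq nseq (al i) i | i <- enum 'I_m].

Lemma count_word (al : expo) i : count_mem i (word al) = al i.
Proof.
rewrite count_flatten -map_comp sumnE big_map big_enum /= (bigD1 i) //=.
rewrite count_nseq /= eqxx mul1n big1 ?addn0 // => j ji.
by rewrite count_nseq /= (negPf ji).
Qed.

Lemma perm_word w : perm_eq w (word [ffun i => count_mem i w]).
Proof. by apply/allP => i _ /=; rewrite count_word ffunE. Qed.

Hypothesis spanG : forall f : H, exists s : seq (k * (X * expo)),
  f = \sum_(p <- s) p.1 *: monomial ch u p.2.1 (word p.2.2).

(* Points of G are parametrised by Q x k^m, in such a way that the monomials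
   become multiplicative functions on this monoid; Dedekind's lemma then gives
   their independence. *)
Variables (Q : Type) (mulQ : Q -> Q -> Q) (oneQ : Q) (chi : X -> Q -> k).
Hypotheses (chiM : forall t x y, chi t (mulQ x y) = chi t x * chi t y)
  (chi1 : forall t, chi t oneQ = 1) (chi_inj : injective chi).
Variable (point : Q -> ('I_m -> k) -> G).
Hypotheses (ch_point : forall t q v, ev (point q v) (ch t) = chi t q)
  (u_point : forall i q v, ev (point q v) (u i) = v i).

Lemma monomial_indep (s : seq (k * (X * expo))) : uniq [seq p.2 | p <- s] ->
  \sum_(p <- s) p.1 *: monomial ch u p.2.1 (word p.2.2) = 0 -> forall p, p \in s -> p.1 = 0.
Proof.
move=> us s0.
pose f (j : X * expo) (x : Q * ('I_m -> k)) := chi j.1 x.1 * \prod_i x.2 i ^+ j.2 i.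
have evE j x : ev (point x.1 x.2) (monomial ch u j.1 (word j.2)) = f j x.
  rewrite ev_monomial ch_point /f; congr (_ * _).
  under eq_bigr do rewrite u_point.
  rewrite /word big_flatten big_map big_enum /=; apply: eq_bigr => i _.
  by rewrite big_nseq iter_mulr_1.
apply: (@dedekind_independence k (Q * ('I_m -> k)) (fun x y => (mulQ x.1 y.1, fun i => x.2 i * y.2 i))
   (oneQ, fun=> 1) _ f) => //.
- move=> j x y; rewrite /f /= chiM mulrACA -big_split; congr (_ * _).
  by apply: eq_bigr => i _; rewrite exprMn.
- by move=> j; rewrite /f /= chi1 mul1r big1 // => i _; rewrite expr1n.
- move=> [t al] [t' al'] fE; congr (_, _).
    apply: chi_inj; apply/funext => q; have := congr1 (fun g => g (q, fun=> 1)) fE.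
    by rewrite /f /= !big1 ?mulr1 // => i _; rewrite expr1n.
  (* At the point with i-th coordinate 2 and the others 1, the monomial takes the value 2 to its
     i-th exponent, which determines the exponent in characteristic 0. *)
  apply/ffunP => i; have := congr1 (fun g => g (oneQ, fun j => if j == i then 2%:R else 1)) fE.
  have pE (be : expo) : \prod_j (if j == i then 2%:R else 1 : k) ^+ be j = 2%:R ^+ be i.
    rewrite (bigD1 i) //= eqxx big1 ?mulr1 // => j /negPf->; exact: expr1n.
  rewrite /f /= !chi1 !mul1r !pE -!natrX => /eqP.
  have inj a b : (a <= b)%N -> (a%:R == b%:R :> k) -> a = b.
    move=> ab; rewrite eq_sym -subr_eq0 -natrB // (pcharf0P k).1 // subn_eq0 => ba.
    by apply/eqP; rewrite eqn_leq ab.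
  move=> e; apply/eqP; rewrite -(eqn_exp2l _ _ (isT : (1 < 2)%N)); apply/eqP.
  by case/orP: (leq_total (2 ^ al i) (2 ^ al' i)) => h; [apply: inj | apply/esym/inj; rewrite // eq_sym].
- move=> x; rewrite -[RHS]/(ev (point x.1 x.2) (0 : H)) -s0 ev_sum.
  by apply: eq_bigr => p _; rewrite evZ evE.
Qed.

Lemma build_coords : exists C : coords G X 'I_m, cch C = ch /\ cvar C = u.
Proof.
have sp (f : H) : exists s : seq (k * (X * seq 'I_m)),
    f = \sum_(p <- s) p.1 *: monomial ch u p.2.1 p.2.2.
  have [s ->] := spanG f; exists [seq (p.1, (p.2.1, word p.2.2)) | p <- s].
  by rewrite big_map.
have ext (F : ser k X 'I_m) : symser F ->
    exists2 phi : H -> k, scalar phi & forall t w, phi (monomial ch u t w) = F t w.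
  move=> sF; have [phi lp pE] := basis_extension (e := fun j : X * expo => monomial ch u j.1 (word j.2))
    spanG monomial_indep (fun j => F j.1 (word j.2)).
  exists phi => // t w; rewrite (monomial_perm _ _ _ (perm_word w)) (sF _ _ _ (perm_word w)).
  exact: (pE (t, _)).
by exists (Coords ch0 chD ch_eps ch_mul u_add sp ext).
Qed.

End BuildCoords.

Section CharacterGroup.
Variables (k : fieldType) (G : affine_group k).
Local Notation H := (coord_alg G).

Lemma char_eqP (chi psi : character G) : (forall x, sval chi x = sval psi x) -> chi = psi.
Proof.
case: chi psi => [f pf] [g pg] /= fg; have e : f = g by apply/funext.
by rewrite e in pf *; congr exist; apply: Prop_irrelevance.
Qed.

Lemma char_inv_subproof (chi : character G) : is_character (fun x => sval chi x^-1%g).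
Proof.
case: chi => [f [rf f1 fM]] /=; split; first exact: (ag_inv (ag_axioms G)).
  by rewrite invg1.
by move=> x y; rewrite invgM fM mulrC.
Qed.
Definition char_inv (chi : character G) : character G := exist _ _ (char_inv_subproof chi).

Lemma char_mulA : associative (@char_mul k G).
Proof. by move=> f g h; apply: char_eqP => x /=; rewrite mulrA. Qed.
Lemma char_mulC : commutative (@char_mul k G).
Proof. by move=> f g; apply: char_eqP => x /=; rewrite mulrC. Qed.
Lemma char_mul1 : left_id (@char_one k G) (@char_mul k G).
Proof. by move=> f; apply: char_eqP => x /=; rewrite mul1r. Qed.
Lemma char_mulV : left_inverse (@char_one k G) char_inv (@char_mul k G).
Proof.
move=> f; apply: char_eqP => x /=; have [_ f1 fM] := svalP f.
by rewrite -fM mulVg f1.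
Qed.

HB.instance Definition _ := gen_eqMixin (character G).
HB.instance Definition _ := gen_choiceMixin (character G).
HB.instance Definition _ := GRing.isZmodule.Build (character G)
  char_mulA char_mulC char_mul1 char_mulV.

Lemma char_reg0 : char_reg (0 : character G) = hone H.
Proof. exact: regP. Qed.
Lemma char_regD (s t : character G) : char_reg (s + t) = hmul (char_reg s) (char_reg t).
Proof. exact: regP. Qed.
Lemma char_reg_mul (t : character G) x y :
  ev (x * y)%g (char_reg t) = ev x (char_reg t) * ev y (char_reg t).
Proof. by have [_ _ tM] := svalP t; apply: tM. Qed.
Lemma char_reg_eps (t : character G) : heps (char_reg t) = 1.
Proof. by have [_ t1 _] := svalP t. Qed.

Hypothesis Gdiag : diagonalizable_group G.

Lemma diag_span (f : H) : exists s : seq (k * character G),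
  f = \sum_(p <- s) p.1 *: char_reg p.2.
Proof.
have [s sE] := Gdiag (set_mem (valP f)); exists s; apply: regP => x.
by rewrite ev_sum; exact: sE.
Qed.

Hypothesis char0 : [pchar k] =i pred0.

Lemma diag_coords : exists C : coords G (character G) 'I_0, cch C = @char_reg k G.
Proof.
have no (i : 'I_0) : False by case: i.
pose u0 (i : 'I_0) : H := match no i with end.
suff [C [CE _]] : exists C : coords G (character G) 'I_0, cch C = @char_reg k G /\ cvar C = u0.
  by exists C.
apply: (@build_coords k char0 G (character G) 0 _ u0 _ _ _ _ _ _ G (fun x y => (x * y)%g) 1%g
  (fun t => sval t) _ _ _ (fun q _ => q)).
- exact: char_reg0.
- exact: char_regD.
- exact: char_reg_mul.
- exact: char_reg_eps.
- by move=> i; case: (no i).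
- move=> f; have [s ->] := diag_span f; exists [seq (p.1, (p.2, [ffun=> 0%N])) | p <- s].
  rewrite big_map; apply: eq_bigr => p _; congr (_ *: _).
  rewrite /word; set l := flatten _; suff -> : l = [::] by [].
  by apply/nilP; rewrite /nilp size_eq0; case: l => // i; case: (no i).
- by move=> t x y; have [_ _ tM] := svalP t; apply: tM.
- by move=> t; have [] := svalP t.
- by move=> s t st; apply: char_eqP => x; rewrite st.
- by [].
- by move=> i; case: (no i).
Qed.

(** Let M be generated by the characters occurring in finitely many algebra generators. The span of
    M is a subalgebra containing these generators, hence all of O(G), and independence of characters
    puts every character in M. *)
Lemma diag_char_fg : exists n (g : 'I_n -> character G), forall x,
  exists p : {ffun 'I_n -> int}, x = \sum_i g i *~ p i.
Proof.
have [C CE] := diag_coords.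
have [gens [gensR gensP]] := ag_fingen (ag_axioms G).
have [L LP] : exists L : seq (character G), forall f, f \in gens ->
    exists s : seq (k * character G), (forall p, p \in s -> p.2 \in L) /\
      forall x, f x = \sum_(p <- s) p.1 * sval p.2 x.
  elim: gens gensR {gensP} => [|f gens IH] gR; first by exists [::].
  have [|L LP] := IH; first by move=> h hg; apply: gR; rewrite /= inE; apply/orP; right.
  have [|s sE] := Gdiag (f := f); first by apply: gR; rewrite /= mem_head.
  exists ([seq p.2 | p <- s] ++ L) => h; rewrite inE => /orP[/eqP->|/LP[t [tL tE]]].
    by exists s; split=> // p ps; rewrite mem_cat map_f.
  by exists t; split=> // p /tL pL; rewrite mem_cat pL orbT.
pose g (i : 'I_(size L)) := nth 0 L i.
pose M := [set x | exists p : {ffun 'I_(size L) -> int}, x = \sum_i g i *~ p i].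
have M0 : M 0.
  by exists [ffun=> 0]; rewrite big1 // => i _; rewrite ffunE.
have MD x y : M x -> M y -> M (x + y).
  move=> [p ->] [q ->]; exists (p + q); rewrite -big_split; apply: eq_bigr => i _.
  by rewrite ffunE mulrzDr.
have ML x : x \in L -> M x.
  move=> xL; have xi : (index x L < size L)%N by rewrite index_mem.
  exists [ffun i => (i == Ordinal xi)%:R]; rewrite (bigD1 (Ordinal xi)) //= ffunE eqxx.
  rewrite big1 ?addr0 => [|i /negPf ii]; last by rewrite ffunE ii.
  by rewrite /g /= nth_index.
exists (size L), g => x.
pose Sub := [set f : G -> k | exists s : seq (k * character G), (forall p, p \in s -> M p.2) /\
      forall x, f x = \sum_(p <- s) p.1 * sval p.2 x].
have SubP : subalgebra Sub.
  split.
  - exists [:: (1, 0)]; split=> [p|y]; first by rewrite inE => /eqP->.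
    by rewrite big_seq1 /= mul1r.
  - move=> c f h [s [sM sE]] [t [tM tE]]; exists ([seq (c * p.1, p.2) | p <- s] ++ t); split.
      by move=> p; rewrite mem_cat => /orP[/mapP[q qs ->]|/tM//]; exact: (sM q qs).
    move=> y; rewrite big_cat big_map /= sE tE mulr_sumr; congr (_ + _).
    by apply: eq_bigr => p _; rewrite mulrA.
  - move=> f h [s [sM sE]] [t [tM tE]].
    exists [seq (p.1 * q.1, p.2 + q.2) | p <- s, q <- t]; split.
      by move=> _ /allpairsP[[p q] [/= ps qt ->]] /=; apply: MD; [apply: sM | apply: tM].
    move=> y; rewrite big_allpairs_dep /= sE tE mulr_suml; apply: eq_bigr => p _.
    rewrite mulr_sumr; apply: eq_bigr => q _.
    exact: mulrACA.
have [s [sM sE]] : Sub (sval x).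
  apply: (gensP Sub SubP); last by case: (svalP x).
  by move=> f /LP[s [sL sE]]; exists s; split=> // p /sL /ML.
(* [phi] reads off the coefficient of the character x; it would be 0 on an expansion avoiding x. *)
have [phi lp pE] := c_ext C (F := fun t w => (t == x)%:R * (nilp w)%:R)
  (fun t => @symw_nilp _ _ (t == x)%:R).
have pcE t : phi (char_reg t) = (t == x)%:R.
  by have := pE t [::]; rewrite mulr1 /monomial /= CE.
have xE : char_reg x = \sum_(p <- s) p.1 *: char_reg p.2.
  by apply: regP => y; rewrite ev_sum; apply: sE.
apply: contrapT => nM; have := pcE x; rewrite eqxx xE linf_sum // big_seq big1.
  by move/eqP; rewrite eq_sym oner_eq0.
move=> p ps; rewrite pcE; case: eqP => [e|]; last by rewrite mulr0.
by case: nM; rewrite -e; apply: sM.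
Qed.

End CharacterGroup.

Section VectorGroup.
Variables (k : fieldType) (char0 : [pchar k] =i pred0).
Variables (G : affine_group k) (m : nat).
Hypothesis Gvect : vector_group G m.
Local Notation H := (coord_alg G).

Lemma vector_functions : exists (u : 'I_m -> H) (point : ('I_m -> k) -> G),
  [/\ forall i (x y : G), ev (x * y)%g (u i) = ev x (u i) + ev y (u i),
      forall i v, ev (point v) (u i) = v i,
      point (fun=> 0) = 1%g,
      forall x, point (fun i => ev x (u i)) = x &
      forall f : H, exists s : seq (k * {ffun 'I_m -> nat}),
        f = \sum_(p <- s) p.1 *: monomial (fun _ : 'I_1 => hone H) u 0 (word p.2)].
Proof.
have [theta [[thi tK thK] thD regE]] := Gvect.
have thiD x y : thi (x * y)%g = thi x + thi y by rewrite -{1}[x]thK -{1}[y]thK -thD tK.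
have ur (i : 'I_m) : (fun x : G => thi x 0 i : k^o) \in reg_pred G.
  rewrite inE; apply/regE; exists (mpoly.mpolyX k (mpoly.mnm1 i)) => v.
  by rewrite tK mpoly.mevalXU.
exists (fun i => RegFun (ur i)), (fun v => theta (\row_i v i)); split.
- by move=> i x y; rewrite /ev /= thiD mxE.
- by move=> i v; rewrite /ev /= tK mxE.
- have -> : \row_(i < m) (fun=> 0) i = 0 :> 'rV[k]_m by apply/rowP => i; rewrite !mxE.
  by apply: (mulgI (theta 0)); rewrite mulg1 -thD addr0.
- move=> x; rewrite -[RHS]thK; congr theta; apply/rowP => i; by rewrite mxE.
move=> f; have [p pE] := (regE _).1 (set_mem (valP f)).
exists [seq (mpoly.mcoeff al p, [ffun i => mpoly.fun_of_multinom al i]) | al <- mpoly.msupp p].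
apply: regP => x; rewrite -[x]thK ev_sum big_map -[LHS]/((val f) _) [LHS]pE mpoly.mevalE.
apply: eq_bigr => al _; rewrite evZ ev_monomial ev_one mul1r; congr (_ * _).
rewrite /word big_flatten big_map big_enum /=; apply: eq_bigr => i _.
by rewrite big_nseq iter_mulr_1 ffunE /ev /= tK.
Qed.

End VectorGroup.

Section AlgHom.
Variables (k : fieldType) (G G' : affine_group k) (phi : alg_hom G G').

Lemma ah1 : phi 1%g = 1%g.
Proof. by apply: (mulgI (phi 1%g)); rewrite mulg1 -ah_mul mulg1. Qed.

Lemma ev_pullback x f : ev x (pullback phi f) = ev (phi x) f. Proof. by []. Qed.
Lemma pullbackM f g : pullback phi (hmul f g) = hmul (pullback phi f) (pullback phi g).
Proof. exact: regP. Qed.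
Lemma pullback1 : pullback phi (hone (coord_alg G')) = hone (coord_alg G).
Proof. exact: regP. Qed.
Lemma pullback_linear : linear (pullback phi).
Proof. by move=> c f g; apply: regP. Qed.
Lemma heps_pullback f : heps (pullback phi f) = heps f.
Proof. by rewrite -!ev1 ev_pullback ah1. Qed.

Lemma lie_pushforward x : lie G x -> lie G' (pushforward phi x).
Proof.
move=> [lx dx]; split; first exact: scalar_comp lx pullback_linear.
by move=> f g; rewrite /pushforward pullbackM dx !heps_pullback.
Qed.

End AlgHom.

(** * Point derivations and biderivations *)

Section Lie.
Variables (k : fieldType) (G : affine_group k).
Local Notation H := (coord_alg G).

Lemma lie_deriv (x : H -> k) : lie G x -> forall a b, x (hmul a b) = heps a * x b + heps b * x a.
Proof. by move=> [_ dx] a b; rewrite dx addrC mulrC addrC [heps b * _]mulrC addrC; congr (_ + _). Qed.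

Lemma deriv_lie (x : H -> k) : scalar x ->
  (forall a b, x (hmul a b) = heps a * x b + heps b * x a) -> lie G x.
Proof. by move=> lx dx; split=> // a b; rewrite dx addrC [heps b * _]mulrC. Qed.

Lemma lie1 (x : H -> k) : lie G x -> x (hone H) = 0.
Proof.
move=> [_ dx]; have := dx (hone H) (hone H); rewrite hmul1l heps_one mulr1 mul1r.
by rewrite -{1}[x _]addr0 => /addrI.
Qed.

Lemma lieD (x y : H -> k) : lie G x -> lie G y -> lie G (fun a => x a + y a).
Proof.
move=> [lx dx] [ly dy]; split; first exact: scalar_add.
by move=> f g; rewrite dx dy; ring.
Qed.

Lemma lieZ c (x : H -> k) : lie G x -> lie G (fun a => c * x a).
Proof.
move=> [lx dx]; split; first exact: scalar_scale.
by move=> f g; rewrite dx; ring.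
Qed.

Lemma lie0 : lie G (fun _ => 0).
Proof. by split=> [c f g|f g]; rewrite ?mulr0 ?mul0r addr0. Qed.

Lemma lie_sum (T : Type) (s : seq T) (F : T -> H -> k) :
  (forall i, lie G (F i)) -> lie G (fun a => \sum_(i <- s) F i a).
Proof.
move=> lF; elim: s => [|i s IH].
  by under eq_fun do rewrite big_nil; apply: lie0.
by under eq_fun do rewrite big_cons; apply: lieD.
Qed.

Variables (char0 : [pchar k] =i pred0) (X : nmodType) (m : nat) (C : coords G X 'I_m).

(** For the coordinates of a product this is the image of the Lie algebra of the unipotent part, see
    [lie_uni_product]. *)
Definition lie_uni : set (H -> k) := [set y | lie G y /\ forall t, y (cch C t) = 0].

Lemma symw_single (i : 'I_m) (c : k) : symw (fun w => c * (w == [:: i])%:R).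
Proof.
have E v : (v == [:: i]) = perm_eq v [:: i].
  by apply/eqP/idP => [->//|/(perm_small_eq (isT : (size [:: i] <= 1)%N))].
by move=> w w' p; rewrite !E (permPl p).
Qed.

Lemma dual_basis_ex : exists y : 'I_m -> H -> k,
  (forall i, lie_uni (y i)) /\ forall i j, y i (cvar C j) = (j == i)%:R.
Proof.
have /choice[y yP] i : exists y, lie_uni y /\ forall j, y (cvar C j) = (j == i)%:R; last first.
  by exists y; split=> i; have [] := yP i.
(* The form is 1 on x_i times any character and 0 on the other monomials. The Leibniz rule holds
   because a concatenation is the single letter i only if one word is empty and the other is i. *)
have [y ly yE] := c_ext C (F := fun _ w => 1 * (w == [:: i])%:R) (fun t => @symw_single i 1).
have {}yE t w : y (mon C t w) = (w == [:: i])%:R by rewrite [LHS]yE mul1r.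
have y1 : y (mon C 0 [::]) = 0 by rewrite yE.
exists y; split; last first.
  move=> j; have -> : cvar C j = mon C 0 [:: j] by rewrite mon_cons mon0 hmul1r.
  by rewrite yE eqseq_cons andbT.
split; last by move=> t; rewrite -[cch C t]/(mon C t [::]) yE.
apply: deriv_lie => // a b.
apply: (scalar_eq (C := C) (phi := fun a => y (hmul a b)) (psi := fun a => heps a * y b + heps b * y a)).
- exact: (scalar_comp ly (@hmul_linl _ _ _)).
- apply: scalar_add; last exact: scalar_scale.
  move=> c f g; rewrite heps_scalar /=; ring.
move=> s u.
apply: (scalar_eq (C := C) (phi := fun b => y (hmul (mon C s u) b))
  (psi := fun b => heps (mon C s u) * y b + heps b * y (mon C s u))).
- exact: (scalar_comp ly (@hmul_linr _ _ _)).
- apply: scalar_add; first exact: scalar_scale.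
  move=> c f g; rewrite heps_scalar /=; ring.
move=> t v; rewrite mon_mul !yE !heps_mon.
case: u v => [|a' u] [|a'' v] /=; rewrite ?cats0 ?(mul1r, mul0r, mulr0, addr0, add0r) //.
by rewrite eqseq_cons; case: u => [|? ?]; rewrite /= andbF.
Qed.

Definition dual_basis : 'I_m -> H -> k := xget (fun _ => 0)
  [set y | (forall i, lie_uni (y i)) /\ forall i j, y i (cvar C j) = (j == i)%:R].

Lemma dual_basisP : (forall i, lie_uni (dual_basis i)) /\
  forall i j, dual_basis i (cvar C j) = (j == i)%:R.
Proof. exact: (xgetPex (fun _ => 0) dual_basis_ex). Qed.

Lemma dual_sum (F : 'I_m -> k) j :
  \sum_i F i * dual_basis i (cvar C j) = F j.
Proof.
rewrite (bigD1 j) //= big1 => [|i ij]; rewrite dual_basisP.2.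
  by rewrite eqxx mulr1 addr0.
by rewrite eq_sym (negPf ij) mulr0.
Qed.

Lemma lie_eq (x y : H -> k) : lie G x -> lie G y ->
  (forall t, x (cch C t) = y (cch C t)) -> (forall i, x (cvar C i) = y (cvar C i)) -> x = y.
Proof.
move=> lx ly e0 e1; apply/funext.
apply: (derivation_eq (C := C) lx.1 ly.1) => //; exact: lie_deriv.
Qed.

Lemma lie_uniE y : lie_uni y -> y = fun a => \sum_i y (cvar C i) * dual_basis i a.
Proof.
move=> [ly y0]; have db := dual_basisP.1; apply: lie_eq => //.
- by apply: lie_sum => i; apply: lieZ; case: (db i).
- by move=> t; rewrite y0 big1 // => i _; have [_ ->] := db i; rewrite mulr0.
- by move=> j; rewrite dual_sum.
Qed.

Lemma wedge_alternator r : wedge (lie G) lie_uni r -> alternator C r.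
Proof.
move=> [s sP ->]; elim: s sP => [|p s IH] sP.
  split; first split.
  - by move=> b; under eq_fun do rewrite big_nil; apply: scalar_zero.
  - by move=> b; under eq_fun do rewrite big_nil; apply: scalar_zero.
  - by move=> t u; rewrite big_nil.
  - by move=> a b; rewrite !big_nil oppr0.
  - by move=> a b c; rewrite !big_nil !mulr0 addr0.
have [bs vs as_ ds] := IH (fun q qs => sP q (mem_behead (s := p :: s) qs)).
have [[l1 d1] [[l2 d2] z2]] := sP p (mem_head _ _).
under eq_fun do under eq_fun do rewrite big_cons.
split.
- apply: (biformD _ bs); exact: (biformD (biform_prod l1 l2) (biformN (biform_prod l2 l1))).
- by move=> t u; rewrite vs !z2; ring.
- by move=> a b; rewrite as_; ring.
- by move=> a b c; rewrite ds d1 d2; ring.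
Qed.

Lemma alternator_wedge r : alternator C r <-> wedge (lie G) lie_uni r.
Proof.
split; last exact: wedge_alternator.
move=> rP; have [[rl rr] rv ra rd] := rP; have [dbP dbE] := dual_basisP.
have n2 : 2%:R != 0 :> k := natS_neq0 char0 1.
(* The contraction of r with x_j, minus half of its part along the dual basis: in the sum of the z_j
   /\ y_j that part would otherwise count twice. *)
pose z j a := r a (cvar C j) - (\sum_i r (cvar C i) (cvar C j) * dual_basis i a) / 2%:R.
have lz j : lie G (z j).
  apply: lieD; first by apply: deriv_lie => [|a b]; [exact: rl | exact: rd].
  under eq_fun do rewrite mulrC -mulNr; apply: lieZ; apply: lie_sum => i; apply: lieZ.
  by case: (dbP i).
have wP : wedge (lie G) lie_uni (fun a b => \sum_(p <- [seq (z j, dual_basis j) | j <- enum 'I_m])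
    (p.1 a * p.2 b - p.2 a * p.1 b)).
  exists [seq (z j, dual_basis j) | j <- enum 'I_m] => // p /mapP[j _ ->].
  by split; [exact: lz | exact: dbP].
suff -> : r = fun a b => \sum_(p <- [seq (z j, dual_basis j) | j <- enum 'I_m])
    (p.1 a * p.2 b - p.2 a * p.1 b) by [].
apply: (alternator_eq rP (wedge_alternator wP)) => [t i|i j]; rewrite big_map big_enum /= sumrB.
  rewrite (dual_sum (fun j => z j (cch C t))) big1 => [|j _]; last first.
    by have [_ ->] := dbP j; rewrite mul0r.
  rewrite subr0 /z [X in X / _]big1 ?mul0r ?subr0 // => j _.
  by have [_ ->] := dbP j; rewrite mulr0.
rewrite (dual_sum (fun j => z j (cvar C i))).
under [X in _ - X]eq_bigr do rewrite mulrC.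
rewrite (dual_sum (fun i => z i (cvar C j))).
rewrite /z (dual_sum (fun i => r (cvar C i) (cvar C j))) (dual_sum (fun j => r (cvar C j) (cvar C i))).
by rewrite (ra (cvar C j) (cvar C i)); field.
Qed.

Lemma wedge_lie : (forall t, cch C t = hone H) ->
  wedge (lie G) (lie G) = [set r | alternator C r].
Proof.
move=> Cch; have uniE : lie_uni = lie G.
  apply/seteqP; split=> [y []//|y ly]; split=> // t.
  by rewrite Cch; apply: lie1.
by rewrite -{2}uniE; apply/seteqP; split=> r /alternator_wedge.
Qed.

End Lie.

(** * The product of the reductive and unipotent parts *)

Section Product.
Variables (k : fieldType) (char0 : [pchar k] =i pred0).
Variables (A Ar Au : affine_group k) (m : nat).
Hypothesis A_comm : forall x y : A, (x * y)%g = (y * x)%g.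
Variables (ir : alg_hom Ar A) (iu : alg_hom Au A).
Hypothesis A_prod : product_decomposition ir iu.

Record projections := Projections {
  proj_r : alg_hom A Ar;
  proj_u : alg_hom A Au;
  prE : forall x y, proj_r (ir x * iu y)%g = x;
  puE : forall x y, proj_u (ir x * iu y)%g = y;
  projE : forall z, (ir (proj_r z) * iu (proj_u z))%g = z }.

(** Commutativity of A makes the inverse of (x, y) |-> ir x * iu y a homomorphism. Its components
    are regular, since f composed with one of them corresponds to f tensored with the constant 1. *)
Lemma projections_ex : inhabited projections.
Proof.
have [[inv K1 K2] regE] := A_prod; rewrite /= in K1 K2.
have K1' x y : inv (ir x * iu y)%g = (x, y) by exact: (K1 (x, y)).
have invM z z' : inv (z * z')%g = ((inv z).1 * (inv z').1, (inv z).2 * (inv z').2)%g.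
  rewrite -K1' !ah_mul -{1}[z]K2 -{1}[z']K2 -!mulgA; congr (inv (_ * _)%g).
  by rewrite !mulgA; congr (_ * _)%g; exact: A_comm.
have [r1 _ _] := ag_subalg (ag_axioms Ar); have [u1 _ _] := ag_subalg (ag_axioms Au).
have rr f : ag_reg f -> ag_reg (f \o (fun z => (inv z).1)).
  move=> rf; apply/regE; exists [:: (f, fun=> 1)]; split.
    by move=> p; rewrite inE => /eqP->.
  by move=> x y; rewrite big_seq1 /= K1' mulr1.
have ru f : ag_reg f -> ag_reg (f \o (fun z => (inv z).2)).
  move=> rf; apply/regE; exists [:: (fun=> 1, f)]; split.
    by move=> p; rewrite inE => /eqP->.
  by move=> x y; rewrite big_seq1 /= K1' mul1r.
have m1 z z' : (inv (z * z')%g).1 = ((inv z).1 * (inv z').1)%g by rewrite invM.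
have m2 z z' : (inv (z * z')%g).2 = ((inv z).2 * (inv z').2)%g by rewrite invM.
apply: inhabits; unshelve refine (@Projections (AlgHom m1 rr) (AlgHom m2 ru) _ _ _) => //=.
- by move=> x y; rewrite K1'.
- by move=> x y; rewrite K1'.
Qed.

Variable P : projections.
Local Notation pr := (proj_r P).
Local Notation pu := (proj_u P).

Lemma pr_ir x : pr (ir x) = x. Proof. by rewrite -[RHS](prE P x 1%g) ah1 mulg1. Qed.
Lemma pu_ir x : pu (ir x) = 1%g. Proof. by rewrite -[RHS](puE P x 1%g) ah1 mulg1. Qed.
Lemma pr_iu y : pr (iu y) = 1%g. Proof. by rewrite -[RHS](prE P 1%g y) ah1 mul1g. Qed.
Lemma pu_iu y : pu (iu y) = y. Proof. by rewrite -[RHS](puE P 1%g y) ah1 mul1g. Qed.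

Lemma pb_ir_pr f : pullback ir (pullback pr f) = f.
Proof. by apply: regP => x; rewrite !ev_pullback pr_ir. Qed.
Lemma pb_iu_pu f : pullback iu (pullback pu f) = f.
Proof. by apply: regP => x; rewrite !ev_pullback pu_iu. Qed.
Lemma pb_iu_pr f : pullback iu (pullback pr f) = heps f *: hone (coord_alg Au).
Proof. by apply: regP => x; rewrite !ev_pullback pr_iu evZ ev_one mulr1. Qed.
Lemma pb_ir_pu f : pullback ir (pullback pu f) = heps f *: hone (coord_alg Ar).
Proof. by apply: regP => x; rewrite !ev_pullback pu_ir evZ ev_one mulr1. Qed.

Lemma reg_product (f : coord_alg A) : exists s : seq (coord_alg Ar * coord_alg Au),
  f = \sum_(p <- s) hmul (pullback pr p.1) (pullback pu p.2).
Proof.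
have [_ regE] := A_prod; have := (regE f).1 (set_mem (valP f)).
move=> /tensor_regfun[s sE]; exists s; apply: regP => z.
rewrite -{1}[z](projE P) ev_sum; apply: (etrans (sE (pr z) (pu z))); apply: eq_bigr => p _.
by rewrite evM !ev_pullback.
Qed.

Hypothesis Ar_diag : diagonalizable_group Ar.
Hypothesis Au_vect : vector_group Au m.

(** The coordinates of A are pulled back from the two factors. Sharing the variables with those of
    Au is what allows Lie algebras and wedges to be compared. *)
Lemma product_coords : exists (CA : coords A (character Ar) 'I_m) (CU : coords Au 'I_1 'I_m),
  [/\ forall t, cch CA t = pullback pr (char_reg t),
      forall i, cvar CA i = pullback pu (cvar CU i) &
      forall t, cch CU t = hone (coord_alg Au)].
Proof.
have [u [point [uD uP pt0 ptu sp]]] := vector_functions Au_vect.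
have [CU [CU0 CU1]] : exists C : coords Au 'I_1 'I_m, cch C = (fun=> hone (coord_alg Au)) /\ cvar C = u.
  apply: (@build_coords k char0 Au 'I_1 m _ _ _ _ _ _ _ _ unit (fun _ _ => tt) tt
    (fun _ _ => 1) _ _ _ (fun _ => point)) => //.
  - by move=> s t; rewrite hmul1l.
  - by move=> t x y; rewrite !ev_one mulr1.
  - move=> f; have [s fE] := sp f; exists [seq (p.1, (0, p.2)) | p <- s].
    rewrite big_map; apply: regP => x; rewrite {1}fE !ev_sum; apply: eq_bigr => p _.
    by rewrite !evZ !ev_monomial.
  - by move=> t x y; rewrite mulr1.
  - by move=> s t _; rewrite (ord1 s) (ord1 t).
suff [CA [CA0 CA1]] : exists C : coords A (character Ar) 'I_m,
    cch C = (fun t => pullback pr (char_reg t)) /\ cvar C = (fun i => pullback pu (u i)).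
  by exists CA, CU; split=> [t|i|t]; rewrite ?CA0 ?CA1 ?CU0 ?CU1.
apply: (@build_coords k char0 A (character Ar) m _ _ _ _ _ _ _ _ Ar (fun x y => (x * y)%g) 1%g
  (fun t => sval t) _ _ _ (fun q v => (ir q * iu (point v))%g)) => //.
- by rewrite char_reg0 pullback1.
- by move=> s t; rewrite char_regD pullbackM.
- by move=> t x y; rewrite !ev_pullback ah_mul char_reg_mul.
- by move=> t; rewrite heps_pullback char_reg_eps.
- by move=> i x y; rewrite !ev_pullback ah_mul uD.
- move=> f; have [s ->] := reg_product f; elim: s => [|[a b] s [l lE]].
    by exists [::]; rewrite !big_nil.
  rewrite big_cons lE /=; have [sa ->] := diag_span Ar_diag a; have [sb ->] := sp b.
  exists ([seq (p.1 * q.1, (p.2, q.2)) | p <- sa, q <- sb] ++ l).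
  rewrite big_cat big_allpairs_dep /=; congr (_ + _).
  apply: regP => z; rewrite evM !ev_pullback !ev_sum mulr_suml; apply: eq_bigr => p _.
  rewrite mulr_sumr ev_sum; apply: eq_bigr => q _.
  by rewrite !evZ !ev_monomial ev_one mul1r mulrACA.
- by move=> t x y; have [_ _ tM] := svalP t; apply: tM.
- by move=> t; have [] := svalP t.
- by move=> s t st; apply: char_eqP => x; rewrite st.
- by move=> t q v; rewrite ev_pullback prE.
- by move=> i q v; rewrite ev_pullback puE.
Qed.

Variables (CA : coords A (character Ar) 'I_m) (CU : coords Au 'I_1 'I_m).
Hypotheses (CAch : forall t, cch CA t = pullback pr (char_reg t))
  (CAvar : forall i, cvar CA i = pullback pu (cvar CU i))
  (CUch : forall t, cch CU t = hone (coord_alg Au)).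

Lemma lie_uni_product : lie_uni CA = [set pushforward iu y | y in lie Au].
Proof.
have dbl y : lie A y -> lie Au (pushforward pu y) by apply: lie_pushforward.
apply/seteqP; split=> [y [ly y0]|_ [y ly <-]]; last first.
  split; first exact: lie_pushforward.
  move=> t; rewrite CAch /pushforward pb_iu_pr (linfZ _ _ ly.1) lie1 //; exact: mulr0.
exists (pushforward pu y); first exact: dbl.
apply: (lie_eq (C := CA)) => //; first exact/lie_pushforward/dbl.
- move=> t; rewrite y0 CAch /pushforward pb_iu_pr.
  by rewrite [LHS](linfZ _ _ (dbl _ ly).1) (lie1 (dbl _ ly)) mulr0.
- by move=> i; rewrite CAvar /pushforward pb_iu_pu.
Qed.

Lemma wedge_product : wedge (lie A) [set pushforward iu y | y in lie Au] =
  [set r | alternator CA r].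
Proof. by rewrite -lie_uni_product; apply/seteqP; split=> r /(alternator_wedge char0). Qed.

Local Notation wedge_sum := (wedge_sum ir iu).

Lemma tensor_props t : tensor (lie Ar) (lie Au) t ->
  [/\ bilinear_for *%R *%R t, forall b, t (hone _) b = 0, forall a, t a (hone _) = 0
    & (forall b, lie Ar (t^~ b)) /\ (forall a, lie Au (t a))].
Proof.
move=> [s sP ->].
have l1 b : lie Ar ((sum_tensor s)^~ b).
  rewrite /sum_tensor; elim: s sP => [|p s IH] sP.
    by under eq_fun do rewrite big_nil; apply: lie0.
  under eq_fun do rewrite big_cons mulrC; apply: lieD.
    by apply: lieZ; case: (sP p (mem_head _ _)).
  by apply: IH => q qs; apply: sP; rewrite in_cons qs orbT.
have l2 a : lie Au (sum_tensor s a).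
  rewrite /sum_tensor; elim: s sP {l1} => [|p s IH] sP.
    by under eq_fun do rewrite big_nil; apply: lie0.
  under eq_fun do rewrite big_cons; apply: lieD.
    by apply: lieZ; case: (sP p (mem_head _ _)).
  by apply: IH => q qs; apply: sP; rewrite in_cons qs orbT.
split=> //.
- by split=> [b|a]; [case: (l1 b) | case: (l2 a)].
- by move=> b; exact: (lie1 (l1 b)).
- by move=> a; exact: (lie1 (l2 a)).
Qed.

Lemma wedge_props w : wedge (lie Au) (lie Au) w ->
  [/\ biform w, forall b, w (hone _) b = 0 & forall a, w a (hone _) = 0].
Proof.
rewrite (wedge_lie char0 CUch) => -[bw vw aw dw]; have w1 b : w (hone _) b = 0.
  apply: (@lie1 _ _ (w^~ b)); apply: deriv_lie; first by case: bw.
  by move=> a c; apply: dw.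
by split=> // a; rewrite aw w1 oppr0.
Qed.

Lemma wedge_sumP t w : tensor (lie Ar) (lie Au) t -> wedge (lie Au) (lie Au) w ->
  wedge (lie A) [set pushforward iu y | y in lie Au] (wedge_sum t w).
Proof.
move=> [s sP ->] [s' sP' ->].
exists ([seq (pushforward ir p.1, pushforward iu p.2) | p <- s] ++
        [seq (pushforward iu p.1, pushforward iu p.2) | p <- s']).
  move=> p; rewrite mem_cat => /orP[/mapP[q qs ->]|/mapP[q qs ->]] /=.
    have [q1 q2] := sP q qs; split; first exact: lie_pushforward.
    by exists q.2.
  have [q1 q2] := sP' q qs; split; first exact: lie_pushforward.
  by exists q.2.
apply/funext => f; apply/funext => g.
rewrite big_cat !big_map /= /Defs.wedge_sum /sum_tensor; congr (_ + _).
rewrite -sumrB; apply: eq_bigr => p _; rewrite /pushforward; congr (_ - _); exact: mulrC.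
Qed.

(** A function pulled back from one factor is constant on the other, and t and w vanish on
    constants; only one term survives, so t can be recovered. *)
Lemma wedge_sum_ru t w : tensor (lie Ar) (lie Au) t -> wedge (lie Au) (lie Au) w ->
  forall f g, wedge_sum t w (pullback pr f) (pullback pu g) = t f g.
Proof.
move=> /tensor_props[[tl tr] t1 t2 _] /wedge_props[[wl wr] w1 w2] f g.
rewrite /Defs.wedge_sum pb_ir_pr pb_iu_pu pb_ir_pu pb_iu_pr.
rewrite (linfZ _ _ (tl _)) (linfZ _ _ (wl _)) t1 w1.
by rewrite !mulr0 subr0 addr0.
Qed.

Lemma wedge_sum_uu t w : tensor (lie Ar) (lie Au) t -> wedge (lie Au) (lie Au) w ->
  forall f g, wedge_sum t w (pullback pu f) (pullback pu g) = w f g.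
Proof.
move=> /tensor_props[[tl tr] t1 t2 _] /wedge_props[[wl wr] w1 w2] f g.
rewrite /Defs.wedge_sum !pb_iu_pu !pb_ir_pu.
by rewrite !(linfZ _ _ (tl _)) !t1 !mulr0 subrr add0r.
Qed.

Lemma wedge_sum_surj r : wedge (lie A) [set pushforward iu y | y in lie Au] r ->
  exists t w, [/\ tensor (lie Ar) (lie Au) t, wedge (lie Au) (lie Au) w & wedge_sum t w = r].
Proof.
rewrite wedge_product => rP; have [br rv ra rd] := rP; have [rl rr] := br.
have drr := biderivation_r ra rd.
(* These two components suffice: on Ar x Ar an alternator is 0, as it vanishes on pairs of
   characters. *)
pose t f g := r (pullback pr f) (pullback pu g).
pose w f g := r (pullback pu f) (pullback pu g).
have [dbP dbE] := dual_basisP CU.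
have tP : tensor (lie Ar) (lie Au) t.
  exists [seq (t^~ (cvar CU j), dual_basis CU j) | j <- enum 'I_m].
    move=> p /mapP[j _ ->]; split; last by case: (dbP j).
    apply: deriv_lie; first exact: (scalar_comp (rl _) (@pullback_linear _ _ _ _)).
    by move=> a b; rewrite /= /t pullbackM rd !heps_pullback.
  apply/funext => f; apply: (lie_eq (C := CU)).
  - apply: deriv_lie; first exact: (scalar_comp (rr _) (@pullback_linear _ _ _ _)).
    by move=> a b; rewrite /= /t pullbackM drr !heps_pullback.
  - rewrite /sum_tensor; under eq_fun do rewrite big_map; apply: lie_sum => j.
    by apply: lieZ; case: (dbP j).
  - move=> s; rewrite /sum_tensor big_map big1 => [|j _]; last first.
      by rewrite /=; have [_ ->] := dbP j; rewrite mulr0.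
    rewrite CUch /t pullback1 ra (_ : r _ _ = 0) ?oppr0 //.
    apply: (@lie1 _ _ (r^~ (pullback pr f))); apply: deriv_lie; first exact: rl.
    by move=> a b; apply: rd.
  - move=> i; rewrite /sum_tensor big_map big_enum /= (dual_sum CU (fun j => t f (cvar CU j))) //.
have wP : wedge (lie Au) (lie Au) w.
  rewrite (wedge_lie char0 CUch); split.
  - split=> [b|a]; first exact: (scalar_comp (rl _) (@pullback_linear _ _ _ _)).
    exact: (scalar_comp (rr _) (@pullback_linear _ _ _ _)).
  - move=> s s'; rewrite !CUch /w !pullback1 -(cch0 CA); exact: rv.
  - by move=> a b; rewrite /w ra.
  - by move=> a b c; rewrite /w pullbackM rd !heps_pullback.
exists t, w; split=> //.
have := wedge_sumP tP wP; rewrite wedge_product => sP.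
apply: (alternator_eq sP rP) => [s i|i j].
  by rewrite CAch CAvar wedge_sum_ru.
by rewrite !CAvar wedge_sum_uu.
Qed.

End Product.

(** * The cotriangular form of a cocycle *)

Section RForm.
Variables (k : fieldType) (G : affine_group k) (X : nmodType) (I : eqType).
Variable C : coords G X I.
Local Notation H := (coord_alg G).
Local Notation hat2 := (hat2 C).
Local Notation hat3 := (hat3 C).
Implicit Types (a b c : H) (J K R : H -> H -> k).

Lemma twist_mul J : @Z2inv k H J -> convr (convl (inv2 J) (@hmul k H)) J = @hmul k H.
Proof.
move=> ZJ; have [bJ _ _] := (Z2invE C J).1 ZJ.
have [bK JK] := inv2P C bJ (h2_inv ZJ.1); have KJ := hat2_inv_biform bJ bK JK.
apply/funext => a; apply/funext => b; apply: regP => z.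
pose E a b := ev z a * ev z b : k.
have bE : biform E by apply: biform_prod.
have e p q : ev z (convl (inv2 J) (@hmul k H) p q) = conv (inv2 J) E p q.
  rewrite ev_sum; apply: eq_bigr => p' _; rewrite ev_sum; apply: eq_bigr => q' _.
  by rewrite evZ.
transitivity (conv J (conv (inv2 J) E) a b); last first.
  by rewrite (convA C) // KJ (conv1l C).
rewrite (convC C) //; last exact: biform_conv.
rewrite ev_sum; apply: eq_bigr => p _; rewrite ev_sum; apply: eq_bigr => q _.
by rewrite evZ e mulrC.
Qed.

Definition rform J := conv (inv2 (flip2 J)) J.

Lemma minimal_2cocycleE J : @Z2inv k H J ->
  minimal_2cocycle H J <-> cotriangular H (rform J) /\ nondegenerate_form (rform J).
Proof.
move=> ZJ; rewrite /minimal_2cocycle /twist -/(rform J).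
by move: (convr _ J) (twist_mul ZJ) => M ->.
Qed.

Lemma pullflipK (F : ser k (X * X) (I + I)) : pullflip (pullflip F) = F.
Proof.
apply: serP => -[s t] w; rewrite /pullflip /pull /=.
elim: w (F (s, t)) => //= -[i|i] w IH f; exact: IH.
Qed.

Lemma rformE J K : @Z2inv k H J -> biform K -> hat2 J * hat2 K = 1 ->
  biform (rform J) /\ hat2 (rform J) = pullflip (hat2 K) * hat2 J.
Proof.
move=> ZJ bK JK; have [bJ _ _] := (Z2invE C J).1 ZJ.
have bfJ := biform_flip bJ; have bfK := biform_flip bK.
have e : hat2 (flip2 J) * hat2 (flip2 K) = 1 by rewrite (hat2_flip C J) (hat2_flip C K) -pullM JK pull_one.
have [bi ie] := inv2P C bfJ (ex_intro _ (flip2 K) ((is_inv2E C _ bfJ).2 (conj bfK e))).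
have iK : hat2 (inv2 (flip2 J)) = pullflip (hat2 K).
  rewrite -hat2_flip -[LHS]mulr1 -e mulrA [hat2 (inv2 _) * _]mulrC ie mul1r //.
by split; [apply: biform_conv | rewrite hat2_conv // iK].
Qed.

Lemma conv3_perm12 S T a b c : conv3 (G := G) S T a b c =
  conv3 (fun a b c => S b a c) (fun a b c => T b a c) b a c.
Proof. exact: exchange_big. Qed.

Lemma conv3_perm23 S T a b c : conv3 (G := G) S T a b c =
  conv3 (fun a b c => S a c b) (fun a b c => T a c b) a c b.
Proof. by apply: eq_bigr => p _; apply: exchange_big. Qed.

(** The cocycle identity at (a, b, c), (b, a, c), (b, c, a), (a, c, b) and (c, a, b), with products
    reordered by commutativity. *)
Lemma cocycle_perms J : @Z2inv k H J -> let F := hat2 J in let f := pullflip F in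
  [/\ pull12_3 F * pull1_2 F = pull1_23 F * pull2_3 F,
      pull12_3 F * pull1_2 f = pull2_13 F * pull1_3 F,
      pull1_23 f * pull2_3 F = pull2_13 F * pull1_3 f,
      pull2_13 f * pull1_3 F = pull1_23 F * pull2_3 f &
      pull2_13 f * pull1_3 f = pull12_3 f * pull1_2 F].
Proof.
move=> ZJ F f; have [bJ _ [cJ _ _]] := (Z2invE C J).1 ZJ.
have bfJ := biform_flip bJ.
have E a b c : conv3 (on12_3 J) (on1_2 J) a b c = conv3 (on1_23 J) (on2_3 J) a b c.
  by rewrite cocycle_lhs // cocycle_rhs // (h2_cocycle ZJ.1).
have [[t1 t2 t3] [t4 t5 t6]] := triform_on bJ.
have [[s1 s2 s3] [s4 s5 s6]] := triform_on bfJ.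
have ext S S' T T' : (forall a b c, S a b c = T a b c) -> (forall a b c, S' a b c = T' a b c) ->
    forall a b c, conv3 (G := G) S S' a b c = conv3 T T' a b c.
  move=> e e' a b c; do 3 apply: eq_bigr => ? _; by rewrite e e'.
have hE S S' T T' : triform S -> triform S' -> triform T -> triform T' ->
    (forall a b c, conv3 S S' a b c = conv3 T T' a b c) ->
    hat3 S * hat3 S' = hat3 T * hat3 T'.
  move=> h1 h2 h3 h4 e; rewrite -!hat3_conv //; congr hat3.
  by apply/funext => a; apply/funext => b; apply/funext => c.
rewrite /f -hat2_flip -!hat3_12_3 -!hat3_1_2 -!hat3_1_23 -!hat3_2_3 -!hat3_2_13 -!hat3_1_3.
split; apply: hE => // a b c.
- rewrite -[RHS](_ : conv3 (on1_23 J) (on2_3 J) b a c = _).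
    rewrite -E conv3_perm12; apply: ext => ? ? ?; last by [].
    by rewrite /on12_3 hmulC.
  rewrite conv3_perm12; apply: ext => ? ? ?; first by [].
  by rewrite /on2_3 /on1_3 mulrC.
- rewrite -[LHS](_ : conv3 (on12_3 J) (on1_2 J) b c a = _); last first.
    rewrite conv3_perm23 conv3_perm12; apply: ext => ? ? ?; first by [].
    by rewrite /on2_3 /on1_2 mulrC.
  rewrite E conv3_perm23 conv3_perm12; apply: ext => ? ? ?.
    by rewrite /on1_23 /on2_13 hmulC.
  by rewrite /on2_3 /on1_3 mulrC.
- rewrite -[LHS](_ : conv3 (on12_3 J) (on1_2 J) a c b = _); last first.
    by rewrite conv3_perm23; apply: ext => ? ? ?.
  rewrite E conv3_perm23; apply: ext => ? ? ?; last by [].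
  by rewrite /on1_23 hmulC.
- rewrite -[LHS](_ : conv3 (on12_3 J) (on1_2 J) c a b = _); last first.
    rewrite conv3_perm12 conv3_perm23; apply: ext => ? ? ?; last by [].
    by rewrite /on12_3 /on2_13 /flip2 hmulC.
  rewrite E conv3_perm12 conv3_perm23; apply: ext => ? ? ?; first by [].
  by rewrite /on2_3 /on1_2 mulrC.
Qed.

(** With F the series of J and f its flip, R is F / f in a commutative ring, and each
    multiplicativity axiom is a quotient of permuted cocycle identities. *)
Lemma rform_cotriangular J : @Z2inv k H J -> cotriangular H (rform J).
Proof.
move=> ZJ; have [bJ [K bK JK] zJ] := (Z2invE C J).1 ZJ.
have [bR RE] := rformE ZJ bK JK.
have [c1 c2 c3 c4 c5] := cocycle_perms ZJ.
set F := hat2 J in JK RE c1 c2 c3 c4 c5; set F' := hat2 K in JK RE.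
have pV (Y L : Type) g h : @pull k Y _ L _ g h F * @pull k Y _ L _ g h F' = 1.
  by rewrite -pullM JK pull_one.
have pfV (Y L : Type) g h :
    @pull k Y _ L _ g h (pullflip F) * @pull k Y _ L _ g h (pullflip F') = 1.
  by rewrite -pullM -[pullflip F * _]pullM JK !pull_one.
have RfR : hat2 (rform J) * hat2 (flip2 (rform J)) = 1.
  rewrite hat2_flip RE [pullflip (_ * _)]pullM -!/(pullflip _) pullflipK.
  transitivity (F * F' * (pullflip F * pullflip F')); first by ring.
  by rewrite JK mul1r; apply: pV.
have bfR := biform_flip bR.
have [[t1 t2 t3] [t4 t5 t6]] := triform_on bR.
have [Rl Rr] := bR.
split=> //.
- exact: is_hopf_coord.
- by exists (flip2 (rform J)); apply/(is_inv2E C).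
- move=> h g; rewrite mulrC.
  by have := hat2_inv_biform bR bfR RfR => /(congr1 (fun f => f h g)).
- move=> h g l.
  have e : on1_23 (rform J) = conv3 (on1_2 (rform J)) (on1_3 (rform J)).
    apply: (hat3_inj (C := C)) => //; first exact: triform_conv3.
    rewrite hat3_conv // hat3_1_23 hat3_1_2 hat3_1_3 RE.
    rewrite [pull1_23 _]pullM [pull1_2 _]pullM [pull1_3 _]pullM.
    rewrite -/(pull1_23 F) -/(pull1_23 (pullflip F')) -/(pull1_2 F) -/(pull1_2 (pullflip F')).
    rewrite -/(pull1_3 F) -/(pull1_3 (pullflip F')).
    set Y := RHS.
    have i1 : pull1_23 (pullflip F) * pull1_23 (pullflip F') = 1 by apply: pfV.
    have i2 : pull2_3 F * pull2_3 F' = 1 by apply: pV.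
    have i3 : pull1_3 (pullflip F) * pull1_3 (pullflip F') = 1 by apply: pfV.
    have i4 : pull1_2 (pullflip F) * pull1_2 (pullflip F') = 1 by apply: pfV.
    (* The multiplier is a unit and one side of [c3]. After the substitutions [c3], [c1], [c2] the
       denominators of Y cancel. The other axiom is treated alike, with [c5], [c1], [c4]. *)
    have YE : Y * (pull1_23 (pullflip F) * pull2_3 F) = pull1_23 F * pull2_3 F.
      rewrite c3 -c1 /Y.
      transitivity (pull1_2 (pullflip F') * pull1_2 F * (pull2_13 F * pull1_3 F) *
        (pull1_3 (pullflip F) * pull1_3 (pullflip F'))); first by ring.
      rewrite i3 -c2.
      transitivity (pull12_3 F * pull1_2 F * (pull1_2 (pullflip F) * pull1_2 (pullflip F'))); first by ring.
      by rewrite i4 mulr1.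
    transitivity (pull1_23 F * pull2_3 F * (pull1_23 (pullflip F') * pull2_3 F')).
      transitivity (pull1_23 (pullflip F') * pull1_23 F * (pull2_3 F * pull2_3 F')); first by rewrite i2 mulr1.
      by ring.
    rewrite -YE.
    transitivity (Y * (pull1_23 (pullflip F) * pull1_23 (pullflip F')) * (pull2_3 F * pull2_3 F')); first by ring.
    by rewrite i1 i2 !mulr1.
  rewrite -[LHS]/(on1_23 (rform J) h g l) e; apply: eq_bigr => p _.
  rewrite -(hcop_epsr_form g (Rr p.1)) mulr_suml; apply: eq_bigr => q _.
  rewrite -(hcop_epsl_form l (Rr p.2)) mulr_sumr; apply: eq_bigr => r _.
  by rewrite /on1_2 /on1_3; ring.
- move=> h g l.
  have e : on12_3 (rform J) = conv3 (on2_3 (rform J)) (on1_3 (rform J)).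
    apply: (hat3_inj (C := C)) => //; first exact: triform_conv3.
    rewrite hat3_conv // hat3_12_3 hat3_2_3 hat3_1_3 RE.
    rewrite [pull12_3 _]pullM [pull2_3 _]pullM [pull1_3 _]pullM.
    rewrite -/(pull12_3 F) -/(pull12_3 (pullflip F')) -/(pull2_3 F) -/(pull2_3 (pullflip F')).
    rewrite -/(pull1_3 F) -/(pull1_3 (pullflip F')).
    set Y := RHS.
    have i1 : pull12_3 (pullflip F) * pull12_3 (pullflip F') = 1 by apply: pfV.
    have i2 : pull1_2 F * pull1_2 F' = 1 by apply: pV.
    have i3 : pull1_3 (pullflip F) * pull1_3 (pullflip F') = 1 by apply: pfV.
    have i4 : pull2_3 (pullflip F) * pull2_3 (pullflip F') = 1 by apply: pfV.
    have YE : Y * (pull12_3 (pullflip F) * pull1_2 F) = pull12_3 F * pull1_2 F.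
      rewrite -c5 c1 /Y.
      transitivity (pull2_3 (pullflip F') * pull2_3 F * (pull2_13 (pullflip F) * pull1_3 F) *
        (pull1_3 (pullflip F) * pull1_3 (pullflip F'))); first by ring.
      rewrite i3 c4.
      transitivity (pull1_23 F * pull2_3 F * (pull2_3 (pullflip F) * pull2_3 (pullflip F'))); first by ring.
      by rewrite i4 mulr1.
    transitivity (pull12_3 F * pull1_2 F * (pull12_3 (pullflip F') * pull1_2 F')).
      transitivity (pull12_3 (pullflip F') * pull12_3 F * (pull1_2 F * pull1_2 F')); first by rewrite i2 mulr1.
      by ring.
    rewrite -YE.
    transitivity (Y * (pull12_3 (pullflip F) * pull12_3 (pullflip F')) * (pull1_2 F * pull1_2 F')); first by ring.
    by rewrite i1 i2 !mulr1.
  rewrite -[LHS]/(on12_3 (rform J) h g l) e /conv3 exchange_big /=.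
  under eq_bigr do rewrite exchange_big /=.
  rewrite exchange_big; apply: eq_bigr => r _ /=.
  rewrite -(hcop_epsr_form g (Rl r.1)) mulr_suml; apply: eq_bigr => q _.
  rewrite -(hcop_epsl_form h (Rl r.2)) mulr_sumr; apply: eq_bigr => p _.
  by rewrite /on2_3 /on1_3; ring.
- move=> h g; apply: regP => z; rewrite !ev_sum.
  have bE : biform (fun a b : H => ev z a * ev z b) by apply: biform_prod.
  transitivity (conv (rform J) (fun a b => ev z a * ev z b) h g).
    apply: eq_bigr => p _; rewrite ev_sum; apply: eq_bigr => q _.
    by rewrite evZ evM [ev z q.2 * _]mulrC.
  rewrite (convC C) //; apply: eq_bigr => p _; rewrite ev_sum; apply: eq_bigr => q _.
  by rewrite evZ evM mulrC.
Qed.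

End RForm.

(** * Nondegeneracy on a diagonalizable group *)

Section TorusForm.
Variables (k : fieldType) (G : affine_group k) (I : eqType).
Variable C : coords G (character G) I.
Hypothesis Cch : cch C = @char_reg k G.
Hypothesis Gdiag : diagonalizable_group G.
Local Notation H := (coord_alg G).
Implicit Types (J R : H -> H -> k).

Lemma rform_char J (chi psi : character G) : @Z2inv k H J ->
  rform J (char_reg chi) (char_reg psi) = alternate (char_restrict J) chi psi.
Proof.
move=> ZJ; have [bJ [K bK JK] _] := (Z2invE C J).1 ZJ.
have [bR RE] := rformE ZJ bK JK.
have /(congr1 (fun F => F (chi, psi) [::])) := RE.
rewrite /hat2 /mon /monomial /= Cch => ->; rewrite /alternate /char_restrict -Cch.
have := congr1 (fun F => F (psi, chi) [::]) JK; rewrite serM0 ser1 => e.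
have e' : hat2 C K (psi, chi) [::] = (hat2 C J (psi, chi) [::])^-1.
  have J0 : hat2 C J (psi, chi) [::] != 0.
    by apply: contra_eq_neq e => ->; rewrite mul0r eq_sym oner_eq0.
  by apply: (mulfI J0); rewrite e mulfV.
by rewrite serM0; congr (_ * _).
Qed.

(** Multiplicative counterpart of [alternator_addcocycle]: each rule combines three permuted
    instances of the cocycle identity. *)
Lemma alternate_bichar (c : character G -> character G -> k) : cocX c ->
  alt_bichar (alternate c).
Proof.
move=> [c0 cc]; have mE (u v : character G) : char_mul u v = u + v by [].
split.
- by move=> x y; rewrite mulf_neq0 ?invr_eq0.
- move=> x y z; rewrite /alternate !mE.
  have h1 := cc x y z; have h2 := cc x z y; have h3 := cc z x y.
  rewrite [y + z]addrC in h1; rewrite [z + x]addrC in h3.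
  have e1 : c (x + y) z = c x (z + y) * c y z / c x y by rewrite -h1 mulfK.
  have e2 : c z (x + y) = c (x + z) y * c z x / c x y by rewrite h3 mulfK.
  have e3 : c (x + z) y = c x (z + y) * c z y / c x z by rewrite -h2 mulfK.
  by rewrite e1 e2 e3; field; rewrite !c0.
- move=> x y z; rewrite /alternate !mE.
  have h1 := cc x y z; have h2 := cc y x z; have h3 := cc y z x.
  have e1 : c x (y + z) = c (x + y) z * c x y / c y z by rewrite h1 mulfK.
  have e2 : c (y + z) x = c y (z + x) * c z x / c y z by rewrite -h3 mulfK.
  have e3 : c y (z + x) = c (x + y) z * c y x / c x z.
    by rewrite [z + x]addrC [x + y]addrC h2 mulfK.
  by rewrite e1 e2 e3; field; rewrite !c0.
- by move=> x; rewrite /alternate mulVf.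
Qed.

Lemma torus_nondegenerate J : @Z2inv k H J ->
  nondegenerate_form (rform J) <-> nondegenerate_bichar (alternate (char_restrict J)).
Proof.
move=> ZJ; have [cP c1] := onX_cocX C ZJ.
have [bJ [K bK JK] _] := (Z2invE C J).1 ZJ; have [[Rl Rr] _] := rformE ZJ bK JK.
have cE : onX C J = char_restrict J by rewrite /onX Cch.
rewrite cE in cP; have [b0 bl br ba] := alternate_bichar cP.
set b := alternate _ in b0 bl br ba *.
have RE x y : rform J (char_reg x) (char_reg y) = b x y by apply: rform_char.
have bN x y : b y x = (b x y)^-1.
  have := ba (char_mul x y); rewrite bl !br !ba mul1r mulr1 => e.
  by apply: (mulfI (b0 x y)); rewrite e mulfV.
have one_l y : b (char_one G) y = 1.
  apply: (mulfI (b0 (char_one G) y)); rewrite -bl mulr1; congr b.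
  exact: (add0r (0 : character G)).
split=> [[nl _] chi chi1|nd].
  (* If chi pairs trivially with all characters, then chi - 1 lies in the left radical of R. *)
  have e : char_reg chi - hone H = 0.
    apply: nl => g; have [s ->] := diag_span Gdiag g.
    rewrite (linf_sum s xpredT (fun p => p.1) _ (Rr _)) big1 // => p _.
    rewrite addrC -scaleN1r Rl /= RE chi1 -char_reg0 RE one_l.
    by rewrite mulN1r addNr mulr0.
  apply: char_eqP => x; have /(congr1 (ev x)) := e.
  by rewrite evD -scaleN1r evZ ev_one mulN1r => /eqP; rewrite subr_eq0 => /eqP.
(* Non-degeneracy of b makes the functions [b chi] pairwise distinct multiplicative functions on the
   character group, hence linearly independent. *)
have indep (s : seq (k * character G)) : uniq [seq p.2 | p <- s] ->
    \sum_(p <- s) p.1 *: (b p.2 : character G -> k^o) = 0 -> forall p, p \in s -> p.1 = 0.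
  move=> us s0; apply: (@dedekind_independence k _ (@char_mul k G) (char_one G) _ b s) => //.
  - move=> x; apply: (mulfI (b0 x (char_one G))); rewrite -br mulr1; congr b.
    exact: (add0r (0 : character G)).
  - move=> x y xy; apply/eqP; rewrite -subr_eq0; apply/eqP; apply: nd => z.
    have := bl (x - y) y z; rewrite -[char_mul _ _]/(x - y + y) subrK xy => /esym.
    by rewrite -{2}[b y z]mul1r => /(mulIf (b0 y z)).
  - move=> x; have := congr1 (fun f => f x) s0; rewrite fct_sumE => e.
    by apply: etrans e; apply: eq_bigr.
have key (s : seq (k * character G)) : (forall y, \sum_(p <- s) p.1 * b p.2 y = 0) ->
    \sum_(p <- s) p.1 *: char_reg p.2 = 0.
  move=> s0; apply: regP => x; rewrite ev_sum.
  rewrite -[RHS](relation_vanish indep (fun chi : character G => sval chi x) (s := s)) //.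
  by apply/funext => y; rewrite fct_sumE -[RHS](s0 y); apply: eq_bigr.
split=> a aP.
  have [s sE] := diag_span Gdiag a; rewrite sE; apply: key => y.
  rewrite -[RHS](aP (char_reg y)) sE (linf_sum s xpredT (fun p => p.1) _ (Rl _)).
  by apply: eq_bigr => p _; rewrite RE.
(* Evaluating at -y reduces the right radical to the left one, by antisymmetry of b. *)
have [s sE] := diag_span Gdiag a; rewrite sE; apply: key => y.
rewrite -[RHS](aP (char_reg (- y))) sE (linf_sum s xpredT (fun p => p.1) _ (Rr _)).
apply: eq_bigr => p _; rewrite RE [b _ y]bN; congr (_ * _).
apply: (mulIf (b0 y p.2)); rewrite mulVf // -bl -[char_mul _ _]/(- y + y) addNr.
by rewrite one_l.
Qed.

End TorusForm.

(** * Nondegeneracy on a vector group *)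

Section VectorForm.
Variables (k : fieldType) (char0 : [pchar k] =i pred0).
Variables (G : affine_group k) (m : nat).
Variable C : coords G 'I_1 'I_m.
Hypothesis Cch : forall t, cch C t = hone (coord_alg G).
Local Notation H := (coord_alg G).
Local Notation mon := (mon C).
Local Notation x_ := (cvar C).
Local Notation hat1 := (hat1 C).
Local Notation hat2 := (hat2 C).
Local Notation y_ := (dual_basis C).
Implicit Types (J R r : H -> H -> k).

Definition nonsingular r := forall v : 'I_m -> k,
  (forall j, \sum_i v i * r (x_ i) (x_ j) = 0) -> forall i, v i = 0.

Lemma alternator1 r : alternator C r -> (forall a, r (hone H) a = 0) /\ (forall a, r a (hone H) = 0).
Proof.
move=> [[rl rr] rv ra rd]; have r1 a : r (hone H) a = 0.
  by apply: (@lie1 _ _ (r^~ a)); apply: deriv_lie => [|b c]; [exact: rl | exact: rd].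
by split=> // a; rewrite ra r1 oppr0.
Qed.

Lemma normal_vector J : @Z2inv k H J -> normal_on_chars C J.
Proof. by move=> ZJ s t; rewrite !Cch (h2_normr ZJ.1) heps_one. Qed.

Lemma logpart_vector J : @Z2inv k H J -> logpart C J = conv_log J.
Proof.
move=> ZJ; have nJ := normal_vector ZJ; have [bJ _ _] := (Z2invE C J).1 ZJ.
rewrite /logpart (_ : unipart C J = J) //.
apply: (hat2_inj (C := C)) => //; first by apply: biform_conv => //; case: (tildeE C (fun s t => (onX C J s t)^-1)).
rewrite hat2_conv //; last by case: (tildeE C (fun s t => (onX C J s t)^-1)).
rewrite (tildeE C _).2 (_ : conc _ = 1) ?mul1r // -conc1; congr conc; apply/funext => t.
by rewrite /onX nJ invr1.
Qed.

Lemma rform_vector J : @Z2inv k H J -> rform J = conv_exp H (alt C J).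
Proof.
move=> ZJ; have nJ := normal_vector ZJ; have [bJ [K bK JK] _] := (Z2invE C J).1 ZJ.
have [bR RE] := rformE ZJ bK JK.
have aP := alt_alternator char0 C ZJ; have [ba va _ _] := aP.
have [be eE] := conv_expE ba va.
have [bl lv lc lE _] := log_addcocycle char0 ZJ nJ.
apply: (hat2_inj (C := C)) => //; rewrite RE eE.
have aE : hat2 (alt C J) = hat2 (conv_log J) - pullflip (hat2 (conv_log J)).
  by rewrite -hat2_flip -hat2B /alt logpart_vector.
have l1 : ordge (hat2 (conv_log J)) 1 by apply/vanishP.
have JE : ser_exp (hat2 (conv_log J)) = hat2 J by rewrite lE (ser_logK char0 (normal_constant_term nJ)).
have KE : hat2 K = ser_exp (- hat2 (conv_log J)).
  by rewrite -[LHS]mulr1 -(ser_expV char0 l1) JE mulrA [_ * hat2 J]mulrC JK mul1r.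
rewrite aE ser_expD //; last exact/ordgeN/ordge_pull1.
rewrite JE mulrC; congr (_ * _); rewrite KE /pullflip pull_exp ?pullN //.
exact: ordgeN.
Qed.

Lemma hcop_var i (B : H -> H -> k) : biform B ->
  \sum_(p <- hcop (x_ i)) B p.1 p.2 = B (x_ i) (hone H) + B (hone H) (x_ i).
Proof.
move=> bB; rewrite (hcop_eq (s := [:: (x_ i, hone H); (hone H, x_ i)])) //.
  by rewrite big_cons big_seq1.
by move=> x y; rewrite big_cons big_seq1 !ev_one mulr1 mul1r cvar_add.
Qed.

Section ExpForm.
Variable r : H -> H -> k.
Hypothesis rP : alternator C r.
Let R := conv_exp H r.
Hypothesis Rct : cotriangular H R.

Let bR : biform R. Proof. by have [] := Rct. Qed.

Lemma expform1 : (forall a, R a (hone H) = heps a) /\ (forall a, R (hone H) a = heps a).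
Proof.
have [br vr _ _] := rP; have [be eE] := conv_expE br vr; have [r1 r2] := alternator1 rP.
have r_1 : ordge (hat2 r) 1 by apply/vanishP.
have [Rl Rr] := bR.
split.
  move=> a; suff e : (fun a => R a (hone H)) = @heps k H by rewrite -e.
  apply: (hat1_inj (C := C)); [exact: (Rl (hone H)) | exact: heps_scalar |].
  rewrite hat1_restr1 eE /restr1 pull_exp // -/(restr1 _) -hat1_restr1 hat1_eps.
  rewrite (_ : hat1 _ = 0) ?ser_exp_0 //; apply: serP => t w; exact: r2.
move=> a; suff e : (fun a => R (hone H) a) = @heps k H by rewrite -e.
apply: (hat1_inj (C := C)); [exact: (Rr (hone H)) | exact: heps_scalar |].
rewrite hat1_restr2 eE /restr2 pull_exp // -/(restr2 _) -hat1_restr2 hat1_eps.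
rewrite (_ : hat1 _ = 0) ?ser_exp_0 //; apply: serP => t w; exact: r1.
Qed.

(** The pair has total length 2, so the series stops at n = 2. Its constant term is 0, and the
    square of r only involves values of r at the unit, which vanish. *)
Lemma expform_var i j : R (x_ i) (x_ j) = r (x_ i) (x_ j).
Proof.
have [br vr _ _] := rP; have [be eE] := conv_expE br vr; have [r1 r2] := alternator1 rP.
have xE l : x_ l = mon 0 [:: l] by rewrite mon_cons mon0 hmul1r.
rewrite {1}xE {1}[x_ j]xE -hat2_mon eE /= /ser_exp /ser_lim.
have r0 : hat2 r (0, 0) [::] = 0 by rewrite /hat2 /= mon0 r1.
have ri l : hat2 r (0, 0) [:: inl l] = 0 by rewrite /hat2 /= mon0 r2.
rewrite /= !big_ord_recl big_ord0 /= /scale_ser /bump /= expr0 expr1 expr2 ser1 mulr0 add0r.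
rewrite !factS fact0 !muln1 mulr1n invr1 mul1r serM /= !r0 !ri !(mul0r, mulr0, addr0).
by rewrite /hat2 /= !mon_cons mon0 !hmul1r.
Qed.

(** Since x_j is primitive, multiplicativity of R makes [R^~ (x_ j)] a derivation, determined by its
    values on characters and variables. *)
Lemma expform_x a j : R a (x_ j) = r a (x_ j).
Proof.
have [br vr ar dr] := rP; have [Rl Rr] := bR; have [R1 R2] := expform1.
have [rl rr] := br.
apply: (derivation_eq (C := C) (Rl _) (rl _)) => [b c|b c|t|i]; last exact: expform_var.
- rewrite (ct_mull Rct) (hcop_var j (B := fun p1 p2 => R c p1 * R b p2)); last first.
    exact: (biform_prod (Rr c) (Rr b)).
  by rewrite !R1 [_ * heps b]mulrC.
- exact: dr.
- by rewrite Cch R2 heps_cvar; have [-> _] := alternator1 rP.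
Qed.

(** Multiplying the right argument by a variable is convolution by a point derivation; the
    computation of both radicals rests on this. *)
Lemma expform_mul a j b : R a (hmul (x_ j) b) = conv1 (r^~ (x_ j)) (R^~ b) a.
Proof. by rewrite (ct_mulr Rct); apply: eq_bigr => p _; rewrite expform_x. Qed.

(** As r vanishes at the unit, pairing the primitive x_i with x_j b gives r(x_i, x_j) eps(b). A left
    kernel vector of the matrix of r thus yields an element of the left radical. *)
Lemma expform_singular v :
  (forall j, \sum_i v i * r (x_ i) (x_ j) = 0) -> forall b, R (\sum_i v i *: x_ i) b = 0.
Proof.
move=> vP; have [[rl rr] vr ar dr] := rP; have [Rl Rr] := bR; have [R1 R2] := expform1.
apply: (mon_span_ind (C := C)) => [t a b ea eb||t w].
- by rewrite Rr ea eb /= mulr0 addr0.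
- exact: (linf0 (Rr _)).
case: w => [|j w].
  rewrite -[mon t [::]]/(cch C t) Cch R1 (linf_sum (index_enum 'I_m) xpredT v x_ (@heps_scalar _ G)).
  by rewrite big1 // => i _; rewrite heps_cvar mulr0.
rewrite mon_cons expform_mul.
have lc : scalar (conv1 (r^~ (x_ j)) (R^~ (mon t w))) by apply: conv1_scalar; [exact: rl | exact: Rl].
rewrite (linf_sum (index_enum 'I_m) xpredT v x_ lc).
have e i : conv1 (r^~ (x_ j)) (R^~ (mon t w)) (x_ i) = r (x_ i) (x_ j) * heps (mon t w).
  have bi : biform (fun a b => r a (x_ j) * R b (mon t w)) by apply: biform_prod; [exact: rl | exact: Rl].
  by rewrite /conv1 (hcop_var i bi) R2; have [-> _] := alternator1 rP; rewrite mul0r addr0.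
under eq_bigr do rewrite e mulrA.
by rewrite -mulr_suml vP mul0r.
Qed.

Lemma expform_nonsingular : nondegenerate_form R -> nonsingular r.
Proof.
move=> [nl _] v vP i; have := nl _ (expform_singular vP).
have [[li _] _] := (dual_basisP C).1 i; have dbE := (dual_basisP C).2.
move/(congr1 (y_ i)); rewrite (linf0 li) (linf_sum (index_enum 'I_m) xpredT v x_ li).
rewrite (bigD1 i) //= dbE eqxx mulr1 big1 ?addr0 // => j ji.
by rewrite dbE (negPf ji) mulr0.
Qed.

End ExpForm.
End VectorForm.

Section Coefficients.
Variables (k : fieldType) (X : Type) (I : eqType).

Lemma symw_perm (w : seq I) : symw (fun v => (perm_eq v w)%:R : k).
Proof. by move=> v v' p; rewrite (permPl p). Qed.

(** Each occurrence of i in v can be the letter taken by the first factor, and symmetry of f makes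
    the contributions equal. *)
Lemma shuf_single (i : I) (f : seq I -> k) v : symw f ->
  shuf (fun u => (u == [:: i])%:R) f v = (count_mem i v)%:R * f (rem i v).
Proof.
elim: v f => [|j v IH] f sf; first by rewrite /= !mul0r.
have -> : shuf (fun u => (u == [:: i])%:R) f (j :: v) =
   (j == i)%:R * f v + shuf (fun u => (u == [:: i])%:R) (fun u => f (j :: u)) v.
  congr (_ + _); rewrite -[RHS]/(_ * _) -[f v in RHS](shuf1l f v) -shufZ.
  congr shuf; apply/funext => u; rewrite eqseq_cons.
  by case: (j == i); rewrite ?mul1r ?mul0r //; case: u.
rewrite IH; last exact: symw_shift.
rewrite /=; have [->|ji] := eqVneq j i.
  rewrite natrD mulrDl !mul1r; congr (_ + _).
  have [iv|iv] := boolP (i \in v); last by rewrite (count_memPn iv) !mul0r.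
  by congr (_ * _); apply: sf; rewrite perm_sym perm_to_rem.
by rewrite mul0r add0r add0n.
Qed.

End Coefficients.

Section VectorForm2.
Variables (k : fieldType) (char0 : [pchar k] =i pred0).
Variables (G : affine_group k) (m : nat).
Variable C : coords G 'I_1 'I_m.
Hypothesis Cch : forall t, cch C t = hone (coord_alg G).
Local Notation H := (coord_alg G).
Local Notation mon := (mon C).
Local Notation x_ := (cvar C).
Local Notation hat1 := (hat1 C).
Local Notation hat2 := (hat2 C).
Local Notation y_ := (dual_basis C).
Implicit Types (J R r : H -> H -> k).

Lemma mon_vector t w : mon t w = mon 0 w.
Proof. by rewrite (ord1 t). Qed.

Lemma coef_ex w : exists2 phi : H -> k, scalar phi & forall v, phi (mon 0 v) = (perm_eq v w)%:R.
Proof.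
have [phi lp pE] := c_ext C (F := fun _ v => (perm_eq v w)%:R) (fun _ => @symw_perm k _ w).
by exists phi => // v; apply: pE.
Qed.

(** An expansion loses one permutation class at a time: the coefficient form of its first word shows
    that this class sums to 0. *)
Lemma coef_separates a : (forall w phi, scalar phi ->
  (forall v, phi (mon 0 v) = (perm_eq v w)%:R) -> phi a = 0) -> a = 0.
Proof.
move=> ca; have [s aE] := c_span C a; have [n] := ubnP (size s).
elim: n s aE => // n IH [|[c [t w]] s] aE lt; first by rewrite aE big_nil.
have {}aE : a = c *: mon 0 w + \sum_(p <- s) p.1 *: mon 0 p.2.2.
  rewrite aE big_cons -(mon_vector t); congr (_ + _).
  by apply: eq_bigr => p _; rewrite -(mon_vector p.2.1).
have [phi lp pE] := coef_ex w.
have c0 := ca w phi lp pE; rewrite aE lp /= pE perm_refl mulr1 linf_sum //= in c0.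
apply: (IH [seq p <- s | ~~ perm_eq p.2.2 w]); last first.
  by rewrite size_filter; apply: leq_ltn_trans (count_size _ _) _.
rewrite big_filter aE (bigID (fun p : k * ('I_1 * seq 'I_m) => perm_eq p.2.2 w)) /= addrA.
rewrite [X in X + _](_ : _ = 0) ?add0r.
  by apply: eq_bigr => p _; rewrite -(mon_vector p.2.1).
rewrite (eq_bigr (fun p : k * ('I_1 * seq 'I_m) => p.1 *: mon 0 w)).
  rewrite -scaler_suml -scalerDl [X in X *: _](_ : _ = 0) ?scale0r //.
  rewrite -[RHS]c0; congr (_ + _); rewrite big_mkcond; apply: eq_bigr => p _.
  by rewrite pE; case: perm_eq; rewrite ?mulr1 ?mulr0.
by move=> p pw; rewrite (mon_perm C 0 pw).
Qed.

(** The form exp r is [rform J] for a cocycle J with [alt C J = r], so it inherits the axioms. *)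
Lemma alternator_ct r : alternator C r -> cotriangular H (conv_exp H r).
Proof.
move=> rP; have c1 : cocX (fun _ _ : 'I_1 => 1 : k).
  by split=> *; rewrite ?oner_neq0.
have [ZJ _ aJ] := twist_ex char0 c1 erefl rP.
rewrite -aJ -(rform_vector char0 Cch ZJ).
exact: (rform_cotriangular C).
Qed.

(** The set S of forms [R^~ b] contains the counit and, the matrix of r being invertible, is stable
    under convolution by the dual basis. It therefore contains all coefficient forms, which separate
    elements. *)
Lemma nonsingular_left r : alternator C r -> nonsingular C r ->
  forall a, (forall b, conv_exp H r a b = 0) -> a = 0.
Proof.
move=> rP ns a aR; set R := conv_exp H r in aR.
have Rct : cotriangular H R := alternator_ct rP.
have [Rl Rr] := ct_biform Rct; have [[rl rr] _ ra rd] := rP.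
have [dbP dbE] := dual_basisP C; have [r1 r2] := alternator1 rP.
pose M := \matrix_(i < m, j < m) r (x_ i) (x_ j).
have Mu : M \in unitmx.
  rewrite unitmxE unitfE; apply/negP => /det0P[v v0 vM].
  case/negP: v0; apply/eqP/rowP => i; rewrite mxE; apply: (ns (fun i => v 0 i)) => j.
  have /(congr1 (fun w : 'rV_m => w 0 j)) := vM; rewrite !mxE => e.
  by rewrite -[RHS]e; apply: eq_bigr => l _; rewrite !mxE.
pose w i j := invmx M j i.
have wP i l : \sum_j w i j * r (x_ l) (x_ j) = (l == i)%:R.
  have /(congr1 (fun N : 'M_m => N l i)) := mulmxV Mu; rewrite !mxE => <-.
  by apply: eq_bigr => j _; rewrite !mxE mulrC.
have yE i : y_ i = fun a => \sum_j w i j * r a (x_ j).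
  apply: (lie_eq (C := C)); first by case: (dbP i).
  - apply: lie_sum => j; apply: lieZ; apply: deriv_lie; first exact: rl.
    by move=> b c; apply: rd.
  - move=> t; have [_ ->] := dbP i; rewrite big1 // => j _.
    by rewrite Cch r1 mulr0.
  - by move=> l; rewrite dbE wP.
pose S (phi : H -> k) := exists b, forall a, phi a = R a b.
have Sy i phi : S phi -> S (conv1 (y_ i) phi).
  move=> [b pE]; exists (\sum_j w i j *: hmul (x_ j) b) => c.
  rewrite (linf_sum (index_enum 'I_m) xpredT (w i) _ (Rr c)).
  transitivity (\sum_j w i j * conv1 (r^~ (x_ j)) (R^~ b) c); last first.
    by apply: eq_bigr => j _; rewrite -(expform_mul char0 Cch rP Rct).
  rewrite /conv1; under [RHS]eq_bigr do rewrite mulr_sumr.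
  rewrite exchange_big; apply: eq_bigr => p _.
  rewrite yE mulr_suml; apply: eq_bigr => j _; by rewrite pE mulrA.
have SZ t phi : S phi -> S (fun a => t * phi a).
  by move=> [b pE]; exists (t *: b) => c; rewrite (linfZ _ _ (Rr c)) pE.
have Sc u phi : scalar phi -> (forall v, phi (mon 0 v) = (perm_eq v u)%:R) -> S phi.
  elim: u phi => [|i u IH] phi lp pE.
    exists (hone H); apply: (scalar_eq (C := C) lp (Rl (hone H))) => t v /=.
    rewrite mon_vector pE [RHS](expform1 char0 rP Rct).1 heps_mon.
    by have -> : perm_eq v [::] = nilp v by apply/perm_nilP/nilP.
  have [psi lq qE] := coef_ex u; have Sq := Sy i psi (IH _ lq qE).
  (* By [shuf_single], convolution with [y_ i] multiplies the coefficient form of [i :: u] by the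
     multiplicity of i, invertible in characteristic 0. *)
  pose n := (count_mem i (i :: u)); have n0 : n%:R != 0 :> k.
    by rewrite /n /= eqxx; apply: (natS_neq0 char0).
  suff -> : phi = fun a => n%:R^-1 * conv1 (y_ i) psi a by apply: SZ.
  have [[li _] _] := dbP i; have lc := conv1_scalar li lq.
  apply/funext; apply: (scalar_eq (C := C) lp (scalar_scale _ lc)) => t v /=.
  rewrite mon_vector pE -[conv1 _ _ _]/(hat1 (conv1 (y_ i) psi) 0 v) hat1_conv // serM.
  have -> : hat1 (y_ i) 0 = fun u => (u == [:: i])%:R.
    apply/funext => l; rewrite /hat1; elim: l => [|j l _]; first by rewrite /mon /monomial /=; have [_ ->] := dbP i.
    rewrite mon_cons (lie_deriv (dbP i).1) heps_cvar mul0r add0r dbE heps_mon eqseq_cons.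
    by rewrite -natrM mulnb andbC; case: l.
  have -> : hat1 psi 0 = fun v => (perm_eq v u)%:R by apply/funext => l; apply: qE.
  rewrite shuf_single; last exact: symw_perm.
  have [iv|iv] := boolP (i \in v).
    have -> : perm_eq (rem i v) u = perm_eq v (i :: u).
      by rewrite (permPl (perm_to_rem iv)) perm_cons.
    have [p|] := boolP (perm_eq v (i :: u)); last by rewrite !mulr0.
    by rewrite /n (permP p) mulr1 mulVf.
  rewrite (count_memPn iv) mul0r mulr0.
  by case: (boolP (perm_eq v (i :: u))) => // /perm_mem /(_ i); rewrite mem_head (negPf iv).
apply: coef_separates => u phi lp pE; have [b ->] := Sc u phi lp pE; exact: aR.
Qed.

Lemma alternator_flip r : alternator C r -> alternator C (flip2 r).
Proof.
move=> [br vr ar dr]; split; first exact: biform_flip.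
- by move=> s t; apply: vr.
- by move=> a b; apply: ar.
- by move=> a b c; apply: (biderivation_r ar dr).
Qed.

Lemma conv_exp_flip r : alternator C r -> conv_exp H (flip2 r) = flip2 (conv_exp H r).
Proof.
move=> rP; have [br vr _ _] := rP; have [bf vf _ _] := alternator_flip rP.
have [be eE] := conv_expE br vr; have [be' eE'] := conv_expE bf vf.
apply: (hat2_inj (C := C)) => //; first exact: biform_flip.
rewrite eE' (hat2_flip C r) (hat2_flip C (conv_exp H r)) eE /pullflip pull_exp //.
exact/vanishP.
Qed.

Lemma vector_nondegenerate J : @Z2inv k H J ->
  nondegenerate_form (rform J) <-> nonsingular C (alt C J).
Proof.
move=> ZJ; have rP := alt_alternator char0 C ZJ; rewrite (rform_vector char0 Cch ZJ).
split; first exact: (expform_nonsingular char0 Cch rP (alternator_ct rP)).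
move=> ns; split; first exact: nonsingular_left.
move=> b bR; apply: (nonsingular_left (alternator_flip rP)); last first.
  by move=> a; rewrite conv_exp_flip //; apply: bR.
move=> v vP; apply: ns => j; have [_ _ ar _] := rP.
under eq_bigr do rewrite ar mulrN.
by rewrite sumrN -[X in - X]/(\sum_i v i * flip2 (alt C J) (x_ i) (x_ j)) vP oppr0.
Qed.

Lemma lie_vectorE y : lie G y -> y = fun a => \sum_i y (x_ i) * y_ i a.
Proof.
by move=> ly; apply: lie_uniE; split=> // t; rewrite Cch; apply: lie1.
Qed.

Lemma linear_lie_sum (xi : (H -> k) -> k) (T : Type) (s : seq T) (c : T -> k) (F : T -> H -> k) :
  (forall c x y, lie G x -> lie G y -> xi (c \*o x \+ y) = c * xi x + xi y) ->
  (forall i, lie G (F i)) ->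
  xi (fun a => \sum_(i <- s) c i * F i a) = \sum_(i <- s) c i * xi (F i).
Proof.
move=> lx lF; elim: s => [|i s IH].
  under eq_fun do rewrite big_nil; rewrite big_nil.
  have := lx (-1) _ _ (@lie0 k G) (@lie0 k G).
  have -> : -1 \*o (fun _ : H => 0) \+ (fun _ => 0) = (fun _ => 0) :> (H -> k).
    by apply/funext => a /=; rewrite mulr0 addr0.
  by rewrite mulN1r addNr.
under eq_fun do rewrite big_cons; rewrite big_cons -IH -lx //.
by apply: lie_sum => j; apply: lieZ.
Qed.

Lemma nonsingular_tensor r : alternator C r ->
  nonsingular C r <-> nondegenerate_tensor (lie G) r.
Proof.
move=> rP; have [[rl rr] vr ar dr] := rP; have [dbP dbE] := dual_basisP C.
have [r1 r2] := alternator1 rP.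
split=> [ns xi lx s sP rE s0 y ly|nd v vP i].
  have dbl i : lie G (y_ i) by case: (dbP i).
  have xi0 i : xi (y_ i) = 0.
    apply: (ns (fun i => xi (y_ i))) => j; rewrite -[RHS](s0 (x_ j)).
    transitivity (\sum_i \sum_(p <- s) xi (y_ i) * (p.1 (x_ i) * p.2 (x_ j))).
      by apply: eq_bigr => l _; rewrite rE /sum_tensor mulr_sumr.
    rewrite exchange_big big_seq [RHS]big_seq; apply: eq_bigr => p ps /=.
    have [lp1 _] := sP p ps.
    rewrite {2}(lie_vectorE lp1) linear_lie_sum // mulr_suml; apply: eq_bigr => l _.
    by rewrite mulrA [xi _ * _]mulrC.
  by rewrite (lie_vectorE ly) linear_lie_sum // big1 // => i _; rewrite xi0 mulr0.
(* The functional on the Lie algebra with value [v i] on the i-th vector of the dual basis. *)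
pose xi (y : H -> k) := \sum_i v i * y (x_ i).
have xil c (y z : H -> k) : xi (c \*o y \+ z) = c * xi y + xi z.
  rewrite /xi mulr_sumr -big_split; apply: eq_bigr => l _ /=.
  by rewrite mulrDr mulrCA.
have [s sP rE] := (alternator_wedge char0 C r).1 rP.
(* Writes r as a sum of pure tensors: each x /\ y contributes x (x) y and (-y) (x) x. *)
pose s' := s ++ [seq ((fun a => - p.2 a), p.1) | p <- s].
have rE' : r = sum_tensor s'.
  rewrite {1}rE /s' /sum_tensor; apply/funext => a; apply/funext => b.
  rewrite big_cat big_map /= -big_split; apply: eq_bigr => p _ /=; by rewrite mulNr.
have s'P : in_pairs (lie G) (lie G) s'.
  move=> p; rewrite mem_cat => /orP[ps|/mapP[q qs ->]] /=.
    by have [? []] := sP p ps.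
  have [? [q2 _]] := sP q qs; split=> //.
  have -> : (fun a => - q.2 a) = (fun a => -1 * q.2 a) by apply/funext => a; rewrite mulN1r.
  exact: lieZ.
have s0 a : \sum_(p <- s') xi p.1 * p.2 a = 0.
  transitivity (\sum_i v i * r (x_ i) a).
    transitivity (\sum_i \sum_(p <- s') v i * (p.1 (x_ i) * p.2 a)).
      rewrite exchange_big; apply: eq_bigr => p _; rewrite /xi mulr_suml.
      by apply: eq_bigr => l _; rewrite mulrA.
    by apply: eq_bigr => l _; rewrite rE' /sum_tensor mulr_sumr.
  move: a; have l1 : lie G (fun a => \sum_i v i * r (x_ i) a).
    apply: lie_sum => l; apply: lieZ; apply: deriv_lie; first exact: rr.
    exact: biderivation_r.
  move=> a; have := lie_vectorE l1 => /(congr1 (fun f => f a)) ->.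
  by rewrite big1 // => j _; rewrite vP mul0r.
have [dl _] := dbP i; have := nd xi (fun c x y _ _ => xil c x y) s' s'P rE' s0 _ dl.
rewrite /xi (bigD1 i) //= dbE eqxx mulr1 big1 ?addr0 // => j ji.
by rewrite dbE (negPf ji) mulr0.
Qed.

(** For an antisymmetric matrix of odd size, det M = - det M, so M is singular in characteristic
    0. *)
Lemma nonsingular_even r : alternator C r -> nonsingular C r -> ~~ odd m.
Proof.
move=> [_ _ ar _] ns; apply/negP => om.
pose M := \matrix_(i < m, j < m) r (x_ i) (x_ j).
have MT : M^T = - M by apply/matrixP => i j; rewrite !mxE ar.
have dM : \det M = 0.
  have := det_tr M; rewrite MT -scaleN1r detZ -signr_odd om expr1 mulN1r => /eqP.
  rewrite eq_sym -subr_eq0 opprK -mulr2n -mulr_natr mulf_eq0.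
  by rewrite (negPf (natS_neq0 char0 1)) orbF => /eqP.
have /det0P[v v0 vM] : \det M == 0 by rewrite dM.
case/negP: v0; apply/eqP/rowP => i; rewrite mxE; apply: (ns (fun i => v 0 i)) => j.
have /(congr1 (fun w : 'rV_m => w 0 j)) := vM; rewrite !mxE => e.
by rewrite -[RHS]e; apply: eq_bigr => l _; rewrite !mxE.
Qed.

Lemma even_nonsingular : ~~ odd m -> exists r, alternator C r /\ nonsingular C r.
Proof.
move=> em; have [dbP dbE] := dual_basisP C.
(* The standard symplectic matrix in 2 x 2 blocks, pairing each even index with its successor. *)
pose N (i j : 'I_m) : k := ((j == i.+1 :> nat) && ~~ odd i)%:R - ((i == j.+1 :> nat) && ~~ odd j)%:R.
pose r a b := \sum_i \sum_j N i j * (y_ i a * y_ j b).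
have rE i j : r (x_ i) (x_ j) = N i j.
  rewrite /r; under eq_bigr => l _.
    under eq_bigr do rewrite mulrA.
    rewrite (dual_sum C (fun n => N l n * y_ l (x_ i)) j).
    over.
  by rewrite (dual_sum C (fun l => N l j) i).
exists r; split.
  split.
  - apply: biform_sum => i; apply: biform_sum => j; apply: biformZ.
    by apply: biform_prod; [have [[]] := dbP i | have [[]] := dbP j].
  - move=> s t; rewrite /r big1 // => i _; rewrite big1 // => j _.
    by have [_ ->] := dbP i; rewrite mul0r mulr0.
  - move=> a b; rewrite /r exchange_big -sumrN; apply: eq_bigr => i _.
    rewrite -sumrN; apply: eq_bigr => j _.
    by rewrite -mulNr /N opprB [y_ j a * _]mulrC.
  - move=> a b c; rewrite /r !mulr_sumr -big_split; apply: eq_bigr => i _.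
    rewrite !mulr_sumr -big_split; apply: eq_bigr => j _ /=.
    by rewrite (lie_deriv (dbP i).1); ring.
move=> v vP i.
have vP' j : \sum_l v l * N l j = 0 by rewrite -[RHS](vP j); apply: eq_bigr => l _; rewrite rE.
(* The partner of i selects the equation that isolates [v i]: column i - 1 if i is odd, column i + 1
   if i is even, which exists because m is even. *)
have [oi|ei] := boolP (odd i).
  have jm : (i.-1 < m)%N by apply: leq_ltn_trans (leq_pred _) (ltn_ord i).
  have := vP' (Ordinal jm); rewrite (bigD1 i) //= big1 ?addr0.
    have i0 : (0 < i)%N by case: (i : nat) oi.
    rewrite /N /= prednK // eqxx oi andbF /= sub0r.
    have -> : ~~ odd i.-1 by move: oi; rewrite -{1}(prednK i0) /=.
    by move/eqP; rewrite mulrN mulr1 oppr_eq0 => /eqP.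
  move=> l li; rewrite /N /=; have i0 : (0 < i)%N by case: (i : nat) oi.
  rewrite prednK //; have -> : (l == i :> nat) = false by apply: negPf.
  rewrite subr0; case: eqP => [e|]; rewrite ?mulr0 //=.
  have -> : odd l by move: oi; rewrite -(prednK i0) e /= negbK.
  by rewrite mulr0.
have jm : (i.+1 < m)%N.
  rewrite ltn_neqAle ltn_ord andbT; apply: contraNneq em => <-; by rewrite /= ei.
have := vP' (Ordinal jm); rewrite (bigD1 i) //= big1 ?addr0.
  rewrite /N /= eqxx ei /=; have -> : (i == i.+2 :> nat) = false by apply/eqP; lia.
  by rewrite subr0 mulr1.
move=> l li; rewrite /N /= eqSS; have -> : (i == l :> nat) = false by rewrite eq_sym; apply: negPf.
by rewrite ei andbF subr0 mulr0.
Qed.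

End VectorForm2.

(** * The cohomology groups *)

Section QuotientGroups.

Lemma qg_eqv_refl (Q : quot_group) (x : Q) : is_quot_group Q -> qg_num x -> qg_eqv x x.
Proof.
move=> gQ nx; exists (qg_one Q); first exact: qg_den1.
by rewrite (qg_mulx1 gQ).
Qed.

Lemma quot_prod_group (Q Q' : quot_group) :
  is_quot_group Q -> is_quot_group Q' -> is_quot_group (quot_prod Q Q').
Proof.
move=> [a1 a2 a3 a4 a5 a6 a7 a8 a9 a10] [b1 b2 b3 b4 b5 b6 b7 b8 b9 b10].
split=> //=.
- by move=> x y [] ? ? [] ? ?; split; [apply: a2 | apply: b2].
- by move=> x y z [] ? ? [] ? ? [] ? ?; rewrite a3 ?b3.
- by move=> [x y] [] ? ?; rewrite /= a4 ?b4.
- by move=> [x y] [] ? ?; rewrite /= a5 ?b5.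
- move=> [x y] [/= /a6[x' [p1 p2 p3 p4]] /b6[y' [q1 q2 q3 q4]]].
  exists (x', y'); split=> //=; rewrite ?p2 ?p3 ?q2 ?q3 //.
  by move=> [] /p4 ? /q4 ?.
- by move=> [x y] [] /a7 ? /b7 ?.
- by move=> x y [] ? ? [] ? ?; split; [apply: a9 | apply: b9].
- move=> [x y] [n n'] [/= nx ny] [/= dn dn'].
  have [u du e] := a10 _ _ nx dn; have [v dv e'] := b10 _ _ ny dn'.
  by exists (u, v) => //=; rewrite e e'.
Qed.

Lemma additive_group_group (V : zmodType) (S : set V) : S 0 ->
  (forall x y, S x -> S y -> S (x + y)) -> (forall x, S x -> S (- x)) ->
  is_quot_group (additive_group S).
Proof.
move=> S0 SD SN; split=> //=.
- by move=> x y z _ _ _; apply: addrA.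
- by move=> x _; apply: add0r.
- by move=> x _; apply: addr0.
- move=> x Sx; exists (- x); split; [exact: SN | exact: addrN | exact: addNr |].
  by move=> ->; rewrite /= oppr0.
- by move=> x ->.
- by move=> x y -> ->; rewrite /= addr0.
- by move=> x n _ ->; exists 0; rewrite //= addr0 add0r.
Qed.

End QuotientGroups.

Section CharacterCohomology.
Variables (k : closedFieldType) (G : affine_group k).
Implicit Types (c b : character G -> character G -> k).

Lemma grp_B2_Z2 c : grp_B2 c -> grp_Z2 c.
Proof.
move=> [u u0 ->]; split=> [x y|x y z].
  by rewrite !mulf_neq0 ?invr_eq0.
have -> : char_mul x (char_mul y z) = char_mul (char_mul x y) z by exact: char_mulA.
by field; rewrite !u0.
Qed.

Lemma grp_B2_const (t : k) : t != 0 -> @grp_B2 k G (fun _ _ => t).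
Proof.
move=> t0; exists (fun=> t) => //.
by apply/funext => x; apply/funext => y; rewrite mulfK.
Qed.

Lemma grp_H2_group : is_quot_group (grp_H2 G).
Proof.
have V u : u != 0 -> u * u^-1 = 1 :> k by apply: mulfV.
split=> //=.
- by split=> [x y|x y z]; rewrite ?oner_neq0.
- move=> c d [c0 cc] [d0 dc]; split=> [x y|x y z]; first exact: mulf_neq0.
  by rewrite /pmul2 mulrACA cc dc mulrACA.
- by move=> c d e _ _ _; apply/funext => x; apply/funext => y; apply: mulrA.
- by move=> c _; apply/funext => x; apply/funext => y; apply: mul1r.
- by move=> c _; apply/funext => x; apply/funext => y; apply: mulr1.
- move=> c [c0 cc]; exists (fun x y => (c x y)^-1); split.
  + exact: (cocXV (conj c0 cc)).
  + by apply/funext => x; apply/funext => y; apply: mulfV.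
  + by apply/funext => x; apply/funext => y; apply: mulVf.
  + move=> [u u0 ->]; exists (fun x => (u x)^-1) => [x|]; first by rewrite invr_eq0.
    by apply/funext => x; apply/funext => y; rewrite !invfM.
- exact: grp_B2_Z2.
- exact/grp_B2_const/oner_neq0.
- move=> _ _ [u u0 ->] [v v0 ->]; exists (fun x => u x * v x) => [x|]; first exact: mulf_neq0.
  apply/funext => x; apply/funext => y; rewrite /pmul2.
  by field; rewrite u0 v0.
- by move=> c d _ dB; exists d => //; apply/funext => x; apply/funext => y; apply: mulrC.
Qed.

Lemma hom_wedge2_group : is_quot_group (hom_wedge2 G).
Proof.
split=> //=.
- by split=> *; rewrite ?oner_neq0 ?mulr1.
- move=> b d [b0 bl br ba] [d0 dl dr da]; split=> *; rewrite /pmul2.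
  + exact: mulf_neq0.
  + by rewrite bl dl mulrACA.
  + by rewrite br dr mulrACA.
  + by rewrite ba da mulr1.
- by move=> c d e _ _ _; apply/funext => x; apply/funext => y; apply: mulrA.
- by move=> c _; apply/funext => x; apply/funext => y; apply: mul1r.
- by move=> c _; apply/funext => x; apply/funext => y; apply: mulr1.
- move=> b [b0 bl br ba]; exists (fun x y => (b x y)^-1); split.
  + by split=> *; rewrite ?invr_eq0 ?bl ?br ?ba ?invfM ?invr1.
  + by apply/funext => x; apply/funext => y; apply: mulfV.
  + by apply/funext => x; apply/funext => y; apply: mulVf.
  + by move=> ->; apply/funext => x; apply/funext => y; rewrite /= invr1.
- by move=> b ->; split=> *; rewrite ?oner_neq0 ?mulr1.
- by move=> b d -> ->; apply/funext => x; apply/funext => y; apply: mulr1.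
- by move=> c d _ ->; exists (fun _ _ => 1) => //; apply/funext => x; apply/funext => y; apply: mulrC.
Qed.

(** Hopf 2-cocycles are normalized while group cocycles need not be; the difference is a constant,
    which is a coboundary. *)
Lemma char_cocycle_normalize c : cocX c -> exists d,
  [/\ cocX d, d 0 0 = 1, alternate d = alternate c & qg_eqv (Q := grp_H2 G) c d].
Proof.
move=> [c0 cc]; exists (fun x y => c x y / c 0 0); split.
- by split=> [x y|x y z]; [rewrite mulf_neq0 ?invr_eq0 | rewrite !mulf_div cc].
- exact: mulfV.
- by apply/funext => x; apply/funext => y; rewrite /alternate; field; rewrite !c0.
- exists (fun _ _ => c 0 0); first exact: grp_B2_const.
  by apply/funext => x; apply/funext => y; rewrite /= /pmul2 divfK.
Qed.

(** The kernel is trivial by [symmetric_cocycle_trivial]; surjectivity is [alternating_lift], which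
    uses the finite generation. *)
Lemma alternate_iso : (exists n (g : 'I_n -> character G), forall x,
    exists p : {ffun 'I_n -> int}, x = \sum_i g i *~ p i) ->
  @group_iso (grp_H2 G) (hom_wedge2 G) (@alternate k G).
Proof.
move=> [n [g gP]]; split.
- exact: grp_H2_group.
- exact: hom_wedge2_group.
- exact: alternate_bichar.
- move=> c d [c0 _] [d0 _]; exists (fun _ _ => 1) => //.
  by apply/funext => x; apply/funext => y; rewrite /= /pmul2 /alternate /= mulr1 invfM mulrACA.
- move=> c [c0 cc]; split=> [a1|[u u0 ->]].
    have cs x y : c x y = c y x.
      have := congr1 (fun f => f x y) a1; rewrite /= /alternate => e.
      by apply: (mulfI (_ : (c y x)^-1 != 0)); rewrite ?invr_eq0 // e mulVf.
    have [u [u0 uE]] := @symmetric_cocycle_trivial k (character G) setT c Logic.I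
      (fun _ _ _ _ => Logic.I) (fun x y _ _ => c0 x y) (fun x y z _ _ _ => cc x y z) (fun x y _ _ => cs x y).
    exists u => [x|]; first exact: u0.
    by apply/funext => x; apply/funext => y; apply: uE.
  apply/funext => x; apply/funext => y; rewrite /alternate.
  have -> : char_mul y x = char_mul x y by exact: char_mulC.
  by rewrite [u y * _]mulrC mulVf // !mulf_neq0 ?invr_eq0.
- move=> b [b0 bl br ba]; have bP : bicharacter b by split.
  have [c [c0 cc cb]] := alternating_lift bP ba gP.
  exists c; first by split.
  exists (fun _ _ => 1) => //; apply/funext => x; apply/funext => y.
  by rewrite /= /pmul2 mulr1 /alternate mulrC cb.
Qed.

End CharacterCohomology.

Section Classification.
Variables (k : fieldType) (char0 : [pchar k] =i pred0).
Variables (G : affine_group k) (X : nmodType) (I : eqType) (C : coords G X I).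
Local Notation H := (coord_alg G).

Lemma qg_eqv_H2inv J K (u : X -> k) : @Z2inv k H J -> @Z2inv k H K ->
  (forall t, u t != 0) -> (forall s t, onX C J s t = onX C K s t * (u s * u t / u (s + t))) ->
  alt C J = alt C K -> qg_eqv (Q := H2inv H) J K.
Proof.
move=> ZJ ZK u0 cE aE; have [L [ZL KL LK _]] := Z2inv_inv C ZK.
have [bJ _ _] := (Z2invE C J).1 ZJ; have [bK _ _] := (Z2invE C K).1 ZK.
have [bL _ _] := (Z2invE C L).1 ZL.
have ZLJ : @Z2inv k H (conv L J) by apply: (Z2invM C).
exists (conv L J); last by rewrite /= (convA C) // KL (conv1l C).
apply: (trivial_B2inv char0 (C := C) ZLJ u0).
  move=> s t; rewrite onX_conv // cE mulrA.
  have /(congr1 (fun f => f s t)) := onX_conv C bL bK; rewrite LK => <-.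
  by rewrite /onX /conv_one !cch_eps mulr1 mul1r.
apply/funext => a; apply/funext => b; rewrite (alt_conv char0 C) // aE.
have /(congr1 (fun f => f a b)) := alt_conv char0 C ZL ZK; rewrite LK => <-.
by rewrite alt_B2inv //; apply: (B2inv1 C).
Qed.

Lemma alt_eqv J K : @Z2inv k H J -> @Z2inv k H K -> qg_eqv (Q := H2inv H) J K -> alt C J = alt C K.
Proof.
move=> ZJ ZK [N BN ->]; have ZN := BN.1.
apply/funext => a; apply/funext => b.
by rewrite /= (alt_conv char0 C) // (alt_B2inv char0 C BN) addr0.
Qed.

Lemma alternator_sum r r' : alternator C r -> alternator C r' -> alternator C (fun a b => r a b + r' a b).
Proof.
move=> [br vr ar dr] [br' vr' ar' dr']; split.
- exact: biformD.
- by move=> s t; rewrite vr vr' addr0.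
- by move=> a b; rewrite ar ar' opprD.
- by move=> a b c; rewrite dr dr'; ring.
Qed.

Lemma alternator_scale t r : alternator C r -> alternator C (fun a b => t * r a b).
Proof.
move=> [br vr ar dr]; split.
- exact: biformZ.
- by move=> s u; rewrite vr mulr0.
- by move=> a b; rewrite ar mulrN.
- by move=> a b c; rewrite dr; ring.
Qed.

Lemma alternator0 : alternator C (fun _ _ => 0).
Proof.
split; first by split=> ?; apply: scalar_zero.
- by [].
- by move=> a b; rewrite oppr0.
- by move=> a b c; rewrite !mulr0 addr0.
Qed.

Lemma alternator_group : is_quot_group (additive_group [set r | alternator C r]).
Proof.
apply: additive_group_group => [|r r'|r rP]; first exact: alternator0.
- exact: alternator_sum.
- have := alternator_scale (-1) rP; congr alternator.
  by apply/funext => a; apply/funext => b; rewrite mulN1r.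
Qed.

Lemma tilde_one : tilde C (fun _ _ => 1) = conv_one H.
Proof.
have [bt tE] := tildeE C (fun _ _ => 1).
apply: (hat2_inj (C := C)) => //; first exact: biform_one.
by rewrite tE hat2_one conc1.
Qed.

Lemma exp_half_alt r : alternator C r ->
  let J := conv_exp H (fun a b => r a b / 2%:R) in
  [/\ @Z2inv k H J, onX C J = (fun _ _ => 1) & alt C J = r].
Proof.
move=> rP; have c1 : cocX (fun _ _ : X => 1 : k) by split=> *; rewrite ?oner_neq0.
have [] := twist_ex char0 c1 erefl rP.
rewrite tilde_one (conv1l C) //.
have [br vr _ _] := rP.
have bf : biform (fun a b => r a b / 2%:R).
  by have := biformZ (2%:R^-1) br; under eq_fun do under eq_fun do rewrite mulrC.
have fv : vanish C (fun a b => r a b / 2%:R) by move=> s t; rewrite vr mul0r.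
by case: (conv_expE bf fv).
Qed.

End Classification.

(** * The reductive part, the unipotent part and the product *)

Section TorusPart.
Variables (k : closedFieldType) (char0 : [pchar k] =i pred0) (G : affine_group k).
Hypothesis Gdiag : diagonalizable_group G.
Local Notation H := (coord_alg G).

Lemma torus_iso : @group_iso (H2inv H) (grp_H2 G) (@char_restrict k G).
Proof.
have [C CE] := diag_coords Gdiag char0.
have cE J : char_restrict J = onX C J by rewrite /onX CE.
split.
- exact: (H2inv_group C).
- exact: grp_H2_group.
- by move=> J ZJ; rewrite cE; have [] := onX_cocX C ZJ.
- move=> J K ZJ ZK; exists (fun _ _ => 1); first exact/grp_B2_const/oner_neq0.
  have [bJ _ _] := (Z2invE C J).1 ZJ; have [bK _ _] := (Z2invE C K).1 ZK.
  rewrite /= !cE onX_conv //; apply/funext => x; apply/funext => y.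
  by rewrite /pmul2 mulr1.
- move=> J ZJ; rewrite /= cE; split=> [[u u0 uE]|BJ].
    apply: (trivial_B2inv char0 (C := C) ZJ u0) => [s t|]; first by rewrite uE.
    (* The index type of variables is ['I_0], so every alternator is 0. *)
    by apply: (alternator_eq (alt_alternator char0 C ZJ) (alternator0 C)) => ? [].
  have [u u0 uE] := onX_B2inv C BJ; exists u => //.
  by apply/funext => s; apply/funext => t.
- move=> c cZ; have [d [dP d1 _ cd]] := char_cocycle_normalize cZ.
  exists (tilde C d); first exact: tilde_Z2inv.
  have -> : char_restrict (tilde C d) = d; last exact: cd.
  by rewrite cE; apply/funext => s; apply/funext => t; apply: tilde_char.
Qed.

Lemma torus_minimal J : hopf_2cocycle H J ->
  minimal_2cocycle H J <-> nondegenerate_bichar (alternate (char_restrict J)).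
Proof.
have [C CE] := diag_coords Gdiag char0.
move=> /(hopf_2cocycle_Z2inv C) ZJ; rewrite (minimal_2cocycleE C ZJ).
rewrite (torus_nondegenerate CE Gdiag ZJ).
by split=> [[]//|]; split=> //; exact: (rform_cotriangular C ZJ).
Qed.

End TorusPart.

Section VectorPart.
Variables (k : closedFieldType) (char0 : [pchar k] =i pred0) (G : affine_group k) (m : nat).
Variable C : coords G 'I_1 'I_m.
Hypothesis Cch : forall t, cch C t = hone (coord_alg G).
Local Notation H := (coord_alg G).
Local Notation exp_half := (fun r : H -> H -> k => conv_exp H (fun f g => r f g / 2%:R)).

(** The only character is trivial, and normalized cocycles take the value 1 there; [alt] alone
    decides the class. *)
Lemma vector_eqv J K : @Z2inv k H J -> @Z2inv k H K ->
  qg_eqv (Q := H2inv H) J K <-> alt C J = alt C K.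
Proof.
move=> ZJ ZK; split; first exact: alt_eqv.
apply: (qg_eqv_H2inv char0 (u := fun=> 1)) => // [t|s t]; first exact: oner_neq0.
by rewrite mulr1 divff ?oner_neq0 // mulr1 /onX (normal_vector Cch ZJ) (normal_vector Cch ZK).
Qed.

(** As J^t = exp(t log J), powers become scalar multiples of [alt]. With [vector_eqv] this reduces
    the vector space axioms to those of bilinear forms. *)
Lemma powr_alt t J : @Z2inv k H J -> @Z2inv k H (conv_powr H t J) /\
  alt C (conv_powr H t J) = fun a b => t * alt C J a b.
Proof.
move=> ZJ; have [bl lv lc lE _] := log_addcocycle char0 ZJ (normal_vector Cch ZJ).
have bf : biform (fun a b => t * conv_log J a b) by apply: biformZ.
have fv : vanish C (fun a b => t * conv_log J a b) by move=> x y; rewrite lv mulr0.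
have fc : addcocycle (fun a b => t * conv_log J a b).
  by move=> a b c; rewrite -mulrA -mulrDr lc; ring.
have ZP : @Z2inv k H (conv_powr H t J) := exp_Z2inv char0 bf fv fc.
have [be eE] := conv_expE bf fv.
split=> //.
have [bl' _ _ lE' _] := log_addcocycle char0 ZP (normal_vector Cch ZP).
have l : conv_log (conv_powr H t J) = fun a b => t * conv_log J a b.
  apply: (hat2_inj (C := C)) => //; rewrite lE' eE ser_expK //.
  exact/vanishP.
apply/funext => a; apply/funext => b.
by rewrite /alt !(logpart_vector Cch) // l mulrBr.
Qed.

Lemma vector_iso : @group_iso (additive_group (wedge (lie G) (lie G))) (H2inv H)
  exp_half.
Proof.
rewrite (wedge_lie char0 Cch); split.
- exact: alternator_group.
- exact: (H2inv_group C).
- by move=> r /= /(exp_half_alt char0)[].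
- move=> r r' /= rP rP'; have [ZJ _ aJ] := exp_half_alt char0 rP.
  have [ZJ' _ aJ'] := exp_half_alt char0 rP'.
  have [Zs _ as_] := exp_half_alt char0 (alternator_sum rP rP').
  apply/(vector_eqv Zs (Z2invM C ZJ ZJ')).
  by rewrite (alt_conv char0 C ZJ ZJ') aJ aJ'; exact: as_.
- move=> r /= rP; have [ZJ cJ aJ] := exp_half_alt char0 rP; split=> [BJ|r0].
    by rewrite -aJ; apply: (alt_B2inv char0 C BJ).
  apply: (trivial_B2inv char0 (C := C) (u := fun=> 1) ZJ) => [t|s t|]; first exact: oner_neq0.
    by rewrite cJ mulr1 divff ?oner_neq0.
  by rewrite aJ r0.
- move=> J /= ZJ; have aP := alt_alternator char0 C ZJ; exists (alt C J) => //.
  have [ZE _ aE] := exp_half_alt char0 aP.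
  exact/(vector_eqv ZJ ZE).
Qed.

Lemma vector_space_H2inv : is_vector_space (Q := H2inv H) (conv_powr H).
Proof.
have Z t J := (powr_alt t (J := J)); have M := Z2invM C.
split.
- exact: (H2inv_group C).
- move=> J K /= ZJ ZK; apply/vector_eqv; [exact: M|exact: M|].
  by rewrite !(alt_conv char0 C) //; apply/funext => a; apply/funext => b; rewrite addrC.
- by move=> t J /= /(Z t)[].
- move=> t J K /= ZJ ZK /(vector_eqv ZJ ZK) e.
  have [ZtJ aJ] := Z t J ZJ; have [ZtK aK] := Z t K ZK.
  by apply/(vector_eqv ZtJ ZtK); rewrite aJ aK e.
- move=> t J K /= ZJ ZK; have [ZtJ aJ] := Z t J ZJ; have [ZtK aK] := Z t K ZK.
  have [ZtJK aJK] := Z t _ (M _ _ ZJ ZK).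
  apply/(vector_eqv ZtJK (M _ _ ZtJ ZtK)).
  rewrite aJK (alt_conv char0 C ZJ ZK) (alt_conv char0 C ZtJ ZtK) aJ aK.
  by apply/funext => a; apply/funext => b; exact: mulrDr.
- move=> s t J /= ZJ; have [ZsJ aK] := Z s J ZJ; have [ZtJ aJ] := Z t J ZJ.
  have [ZtJK aJK] := Z (s + t) J ZJ.
  apply/(vector_eqv ZtJK (M _ _ ZsJ ZtJ)).
  rewrite aJK (alt_conv char0 C ZsJ ZtJ) aK aJ.
  by apply/funext => a; apply/funext => b; exact: mulrDl.
- move=> s t J /= ZJ; have [ZtJ aJ] := Z t J ZJ; have [ZsJ aK] := Z s _ ZtJ.
  have [ZtJK aJK] := Z (s * t) J ZJ.
  apply/(vector_eqv ZtJK ZsJ); rewrite aJK aK aJ.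
  by apply/funext => a; apply/funext => b; rewrite mulrA.
- move=> J /= ZJ; have [ZtJ aJ] := Z 1 J ZJ; apply/(vector_eqv ZtJ ZJ); rewrite aJ.
  by apply/funext => a; apply/funext => b; rewrite mul1r.
Qed.

Lemma exp_half_scale (t : k) (r : H -> H -> k) : wedge (lie G) (lie G) r ->
  qg_eqv (Q := H2inv H) (exp_half (fun f g => t * r f g)) (conv_powr H t (exp_half r)).
Proof.
rewrite (wedge_lie char0 Cch) => rP; have [ZJ _ aJ] := exp_half_alt char0 rP.
have [Zt _ at_] := exp_half_alt char0 (alternator_scale t rP).
have [ZP aP] := powr_alt t ZJ.
by apply/(vector_eqv Zt ZP); rewrite aP aJ; exact: at_.
Qed.

Lemma vector_minimal J r : hopf_2cocycle H J -> wedge (lie G) (lie G) r ->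
  qg_eqv (Q := H2inv H) J (exp_half r) ->
  (minimal_2cocycle H J <-> nondegenerate_tensor (lie G) r).
Proof.
rewrite (wedge_lie char0 Cch) => /(hopf_2cocycle_Z2inv C) ZJ rP.
have [ZE _ aE] := exp_half_alt char0 rP; move=> /(vector_eqv ZJ ZE); rewrite aE => aJ.
rewrite (minimal_2cocycleE C ZJ) (vector_nondegenerate char0 Cch ZJ) aJ.
rewrite (nonsingular_tensor char0 Cch rP).
by split=> [[]//|]; split=> //; exact: (rform_cotriangular C ZJ).
Qed.

Lemma vector_minimal_even :
  (exists J, hopf_2cocycle H J /\ minimal_2cocycle H J) <-> ~~ odd m.
Proof.
split=> [[J [/(hopf_2cocycle_Z2inv C) ZJ /(minimal_2cocycleE C ZJ)[_ nd]]]|em].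
  have aP := alt_alternator char0 C ZJ.
  exact: (nonsingular_even char0 aP ((vector_nondegenerate char0 Cch ZJ).1 nd)).
have [r [rP ns]] := even_nonsingular C em; have [ZJ _ aJ] := exp_half_alt char0 rP.
exists (exp_half r); split; first by case: ZJ.
apply/(minimal_2cocycleE C ZJ); split; first exact: (rform_cotriangular C ZJ).
by apply/(vector_nondegenerate char0 Cch ZJ); rewrite aJ.
Qed.

End VectorPart.

Section ProductPart.
Variables (k : closedFieldType) (char0 : [pchar k] =i pred0).
Variables (A Ar Au : affine_group k) (m : nat).
Variables (ir : alg_hom Ar A) (iu : alg_hom Au A) (P : projections ir iu).
Hypothesis Ar_diag : diagonalizable_group Ar.
Variables (CA : coords A (character Ar) 'I_m) (CU : coords Au 'I_1 'I_m).
Hypotheses (CAch : forall t, cch CA t = pullback (proj_r P) (char_reg t))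
  (CAvar : forall i, cvar CA i = pullback (proj_u P) (cvar CU i))
  (CUch : forall t, cch CU t = hone (coord_alg Au)).
Local Notation a_au := (wedge (lie A) [set pushforward iu y | y in lie Au]).
Local Notation Q1 := (quot_prod (grp_H2 Ar) (additive_group a_au)).
Local Notation Q2 := (quot_prod (hom_wedge2 Ar)
  (quot_prod (additive_group (tensor (lie Ar) (lie Au)))
             (additive_group (wedge (lie Au) (lie Au))))).

Let a_auE : a_au = [set r | alternator CA r].
Proof. exact: (wedge_product char0 CAch CAvar). Qed.

Lemma Q1_group : is_quot_group Q1.
Proof.
apply: quot_prod_group; first exact: grp_H2_group.
rewrite a_auE; exact: alternator_group.
Qed.

Lemma tensor_group : is_quot_group (additive_group (tensor (lie Ar) (lie Au))).
Proof.
apply: additive_group_group.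
- exists [::] => //; apply/funext => a; apply/funext => b; by rewrite /sum_tensor big_nil.
- move=> _ _ [s sP ->] [t tP ->]; exists (s ++ t).
    by move=> p; rewrite mem_cat => /orP[/sP|/tP].
  by apply/funext => a; apply/funext => b; rewrite /sum_tensor big_cat.
- move=> _ [s sP ->]; exists [seq ((fun a => -1 * p.1 a), p.2) | p <- s].
    by move=> p /mapP[q qs ->]; have [q1 q2] := sP q qs; split=> //; apply: lieZ.
  apply/funext => a; apply/funext => b; rewrite /sum_tensor big_map /=.
  rewrite -[LHS]/(- (\sum_(p <- s) p.1 a * p.2 b)) -sumrN; apply: eq_bigr => p _.
  by rewrite mulN1r mulNr.
Qed.

Lemma Q2_group : is_quot_group Q2.
Proof.
apply: quot_prod_group; first exact: hom_wedge2_group.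
apply: quot_prod_group; first exact: tensor_group.
rewrite (wedge_lie char0 CUch); exact: alternator_group.
Qed.

Lemma product_iso1 : exists f : H2inv (coord_alg A) -> Q1, group_iso f.
Proof.
exists (fun J => (onX CA J, alt CA J)); split.
- exact: (H2inv_group CA).
- exact: Q1_group.
- move=> J ZJ; split; first by have [] := onX_cocX CA ZJ.
  by rewrite /= a_auE; apply: alt_alternator.
- move=> J K /= ZJ ZK; exists (fun _ _ => 1, 0).
    by split=> //; apply/grp_B2_const/oner_neq0.
  have [bJ _ _] := (Z2invE CA J).1 ZJ; have [bK _ _] := (Z2invE CA K).1 ZK.
  rewrite /= onX_conv // (alt_conv char0 CA) //; congr (_, _).
    by apply/funext => s; apply/funext => t; rewrite /pmul2 mulr1.
  by rewrite addr0.
- move=> J /= ZJ; split=> [[[u u0 uE] aJ]|BJ].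
    apply: (trivial_B2inv char0 (C := CA) ZJ u0) => [s t|]; first by rewrite uE.
    exact: aJ.
  split; last exact: (alt_B2inv char0 CA BJ).
  have [u u0 uE] := onX_B2inv CA BJ; exists u => //.
  by apply/funext => s; apply/funext => t.
- move=> [c v] [/= cZ]; rewrite a_auE => vP.
  (* [twist_ex] needs a normalized cocycle; [n] is the coboundary by which c differs from d. *)
  have [d [dP d1 _ [n nB cd]]] := char_cocycle_normalize cZ.
  have [ZJ cJ aJ] := twist_ex char0 dP d1 vP.
  set J := conv _ _ in ZJ cJ aJ.
  exists J => //; exists (n, 0); first by split.
  by rewrite /= cJ aJ cd addr0.
Qed.

Definition ru_part (v : coord_alg A -> coord_alg A -> k) : coord_alg Ar -> coord_alg Au -> k :=
  fun f g => v (pullback (proj_r P) f) (pullback (proj_u P) g).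
Definition uu_part (v : coord_alg A -> coord_alg A -> k) : coord_alg Au -> coord_alg Au -> k :=
  fun f g => v (pullback (proj_u P) f) (pullback (proj_u P) g).

Lemma parts_wedge_sum t w : tensor (lie Ar) (lie Au) t -> wedge (lie Au) (lie Au) w ->
  ru_part (wedge_sum ir iu t w) = t /\ uu_part (wedge_sum ir iu t w) = w.
Proof.
move=> tP wP; split; apply/funext => f; apply/funext => g.
  exact: (wedge_sum_ru char0 P CUch tP wP).
exact: (wedge_sum_uu char0 P CUch tP wP).
Qed.

Lemma wedge_parts v : a_au v -> [/\ tensor (lie Ar) (lie Au) (ru_part v),
  wedge (lie Au) (lie Au) (uu_part v) & wedge_sum ir iu (ru_part v) (uu_part v) = v].
Proof.
move=> vP; have [t [w [tP wP <-]]] := wedge_sum_surj char0 CAch CAvar CUch vP.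
by have [-> ->] := parts_wedge_sum tP wP.
Qed.

(** On the additive part the map inverts [wedge_sum] by reading off its components on Ar x Au and Au
    x Au. *)
Lemma product_iso2 : exists2 f : Q1 -> Q2, group_iso f &
  forall c t w, grp_Z2 c -> tensor (lie Ar) (lie Au) t -> wedge (lie Au) (lie Au) w ->
    qg_eqv (f (c, wedge_sum ir iu t w)) (alternate c, (t, w)).
Proof.
have [_ _ an am ak as_] := alternate_iso (diag_char_fg Ar_diag char0).
pose f (x : Q1) : Q2 := (alternate x.1, (ru_part x.2, uu_part x.2)).
have fE c t w : tensor (lie Ar) (lie Au) t -> wedge (lie Au) (lie Au) w ->
    f (c, wedge_sum ir iu t w) = (alternate c, (t, w)).
  by move=> tP wP; rewrite /f /=; have [-> ->] := parts_wedge_sum tP wP.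
exists f; last first.
  move=> c t w cZ tP wP; rewrite fE //; apply: qg_eqv_refl; first exact: Q2_group.
  by split; [exact: an | split].
split.
- exact: Q1_group.
- exact: Q2_group.
- move=> [c v] [/= cZ vP]; have [tP wP _] := wedge_parts vP.
  by split; [exact: an | split].
- move=> [c v] [d u] [/= cZ vP] [/= dZ uP]; have [n nB e] := am _ _ cZ dZ.
  exists (n, (0, 0)) => //; rewrite /f /= e; congr (_, (_, _)).
    by rewrite addr0.
  by rewrite addr0.
- move=> [c v] [/= cZ vP]; have [tP wP vE] := wedge_parts vP; split.
    move=> [/(ak _ cZ) cB [/= t0 w0]]; split=> //=; rewrite -vE t0 w0.
    by apply/funext => a; apply/funext => b; rewrite /wedge_sum subrr addr0.
  by move=> [/= /(ak _ cZ) cB v0]; split=> //; rewrite /= v0.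
- move=> [b [t w]] [/= bP [tP wP]]; have [c cZ [n nB bE]] := as_ _ bP.
  exists (c, wedge_sum ir iu t w).
    by split=> //; apply: wedge_sumP.
  exists (n, (0, 0)); first by split.
  by rewrite (fE _ _ _ tP wP) /= bE !addr0.
Qed.

End ProductPart.

Theorem theorem3p4 (k : closedFieldType) (char0 : [pchar k] =i pred0)
    (A Ar Au : affine_group k) (m : nat)
    (A_comm : forall x y : A, (x * y)%g = (y * x)%g)
    (ir : alg_hom Ar A) (iu : alg_hom Au A)
    (A_prod : product_decomposition ir iu)
    (Ar_diag : diagonalizable_group Ar) (Au_vect : vector_group Au m) :
  (* (1) *)
  [/\ @group_iso (H2inv (coord_alg Ar)) (grp_H2 Ar) (@char_restrict k Ar),
      @group_iso (grp_H2 Ar) (hom_wedge2 Ar) (@alternate k Ar)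
    & forall J, hopf_2cocycle (coord_alg Ar) J ->
        (minimal_2cocycle (coord_alg Ar) J <->
         nondegenerate_bichar (alternate (char_restrict J)))]
  /\
  (* (2) *)
  (let exp_half (r : coord_alg Au -> coord_alg Au -> k) :=
     conv_exp (coord_alg Au) (fun f g => r f g / 2%:R) in
   [/\ @group_iso (additive_group (wedge (lie Au) (lie Au)))
         (H2inv (coord_alg Au)) exp_half,
       is_vector_space (Q := H2inv (coord_alg Au))
         (conv_powr (coord_alg Au))
     & forall (t : k) r, wedge (lie Au) (lie Au) r ->
         qg_eqv (Q := H2inv (coord_alg Au))
           (exp_half (fun f g => t * r f g)) (conv_powr (coord_alg Au) t (exp_half r))]
   /\
   (forall J r, hopf_2cocycle (coord_alg Au) J ->
      wedge (lie Au) (lie Au) r ->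
      qg_eqv (Q := H2inv (coord_alg Au)) J (exp_half r) ->
      (minimal_2cocycle (coord_alg Au) J <->
       nondegenerate_tensor (lie Au) r))
   /\
   ((exists J, hopf_2cocycle (coord_alg Au) J /\
       minimal_2cocycle (coord_alg Au) J) <-> ~~ odd m))
  /\
  (* (3) *)
  (let a_wedge_au : set (coord_alg A -> coord_alg A -> k) :=
     wedge (lie A) [set pushforward iu y | y in lie Au] in
   let Q1 := quot_prod (grp_H2 Ar) (additive_group a_wedge_au) in
   let Q2 := quot_prod (hom_wedge2 Ar)
     (quot_prod (additive_group (tensor (lie Ar) (lie Au)))
                (additive_group (wedge (lie Au) (lie Au)))) in
   (exists f : H2inv (coord_alg A) -> Q1, group_iso f) /\
   (exists2 f : Q1 -> Q2, group_iso f &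
      forall c t w, grp_Z2 c -> tensor (lie Ar) (lie Au) t ->
        wedge (lie Au) (lie Au) w ->
        qg_eqv (f (c, wedge_sum ir iu t w)) (alternate c, (t, w)))).
Proof.
have [P] := projections_ex A_comm A_prod.
have [CA [CU [CAch CAvar CUch]]] := product_coords char0 A_prod P Ar_diag Au_vect.
split; [|split].
- split; first exact: torus_iso.
    exact: (alternate_iso (diag_char_fg Ar_diag char0)).
  by move=> J; apply: torus_minimal.
- split; [|split].
  + split; first exact: (vector_iso char0 CUch).
      exact: (vector_space_H2inv char0 CUch).
    exact: (exp_half_scale char0 CUch).
  + exact: (vector_minimal char0 CUch).
  + exact: (vector_minimal_even char0 CUch).
- split; first exact: (product_iso1 char0 CAch CAvar).
  exact: (product_iso2 char0 Ar_diag CAch CAvar CUch).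
Qed.
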